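(* Let $C>0$ and $D\in\mathbb{R}$, and consider the alternative densities $$g(x;\theta)=e^{-x}+e^{-x}\theta\big(C\psi(x)+D(x-1)\big),\qquad x\ge 0,$$ for small $\theta>0$, where $\psi(x)=-\frac{1}{20}+\frac{2}{5}e^{-3x}-\frac{9}{10}e^{-2x}+\frac{1}{2}e^{-x}$. Then, for small $\theta$, these alternatives are locally asymptotically optimal in the Bahadur sense for the test based on $I_n$, i.e. the local Bahadur efficiency of $I_n$ against this family equals $1$.
   Context: For i.i.d. non-negative observations $X_1,\dots,X_n$ with empirical distribution function $F_n$, define $G_n(t)=n^{-4}\sum_{i,j,k,l=1}^n I\{X_i+\mathrm{med}(X_j,X_k,X_l)<t\}$, $H_n(t)=n^{-3}\sum_{j,k,l=1}^n I\{\max(X_j,X_k,X_l)<t\}$ ($\mathrm{med}$ = median of three numbers), and $I_n=\int_0^\infty (H_n(t)-G_n(t))\,dF_n(t)$; large values of $I_n$ are significant for testing the null hypothesis that the data are exponential $\mathcal{E}(\lambda)$ with unknown $\lambda>0$. For a family of alternative densities $g(\cdot,\theta)$, $\theta\ge0$, with $g(x,0)=e^{-x}$, regular enough that differentiation in $\theta$ under the relevant integrals is permitted, and with $h(x)=\partial_\theta g(x,\theta)|_{\theta=0}$ satisfying $\int_0^\infty e^x h^2(x)\,dx<\infty$: let $b_I(\theta)$ be the limit in probability of $I_n$ under $g(\cdot,\theta)$; let $f_I(\epsilon)=-\lim_{n}n^{-1}\ln P_{H_0}\{I_n\ge\epsilon\}$; the Bahadur exact slope is $c_I(\theta)=2f_I(b_I(\theta))$;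 the Kullback–Leibler distance to the exponential family is $K(\theta)=\inf_{\lambda>0}\int_0^\infty \ln\big[g(x,\theta)/(\lambda e^{-\lambda x})\big]g(x,\theta)\,dx$; and the local Bahadur efficiency is $e^B(I)=\lim_{\theta\to0}c_I(\theta)/(2K(\theta))$. Local asymptotic optimality means $e^B(I)=1$.
   Formalization: The functions g(x;θ) are assumed nonnegative on x≥0 for small θ>0; this forces D≥0, since for D<0 g is negative for large x and is no density. The null probability is taken at λ=1; I_n is scale invariant, so it is the same for every λ. *)

(* Defs.v *)
From HB Require Import structures.
From mathcomp Require Import all_boot all_order all_algebra.
From mathcomp Require Import all_classical all_reals all_analysis.
Set Implicit Arguments. Unset Strict Implicit. Unset Printing Implicit Defensive.
Import Order.TTheory GRing.Theory Num.Theory.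
Import numFieldNormedType.Exports.
Local Open Scope classical_set_scope.
Local Open Scope ring_scope.

Section Defs.
Variable R : realType.

Definition med3 (a b c : R) : R := Num.max (Num.min a b) (Num.min (Num.max a b) c).

Definition ind (P : Prop) : R := if `[< P >] then 1 else 0.

(* sample s = [:: X_1; ...; X_n], n = size s *)
Definition Gn (s : seq R) (t : R) : R :=
  (size s)%:R ^- 4 *
  \sum_(xi <- s) \sum_(xj <- s) \sum_(xk <- s) \sum_(xl <- s)
     ind (xi + med3 xj xk xl < t).

Definition Hn (s : seq R) (t : R) : R :=
  (size s)%:R ^- 3 *
  \sum_(xj <- s) \sum_(xk <- s) \sum_(xl <- s)
     ind (Num.max xj (Num.max xk xl) < t).

(* I_n = \int_0^oo (H_n - G_n) dF_n = n^{-1} \sum_m (H_n(X_m) - G_n(X_m)) *)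
Definition In (s : seq R) : R :=
  (size s)%:R ^-1 * \sum_(x <- s) (Hn s x - Gn s x).

(* expectation of F(X_1,...,X_n) for X_i i.i.d. with density f on [0,+oo)
   (iterated Lebesgue integrals, = integral w.r.t. the product law) *)
Fixpoint iidE (f : R -> R) (n : nat) (F : seq R -> \bar R) : \bar R :=
  match n with
  | 0 => F [::]
  | n'.+1 => (\int[@lebesgue_measure R]_(x in (`[0%R, +oo[%classic : set R))
               ((f x)%:E * iidE f n' (fun s => F (x :: s))))%E
  end.

Definition iid_prob (f : R -> R) (n : nat) (A : seq R -> Prop) : R :=
  fine (iidE f n (fun s => (ind (A s))%:E)).

Definition exp_dens (x : R) : R := expR (- x).

Definition psi (x : R) : R :=
  - (1 / 20) + 2 / 5 * expR (- (3 * x)) - 9 / 10 * expR (- (2 * x))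
  + 1 / 2 * expR (- x).

Definition gfam (C D theta : R) (x : R) : R :=
  expR (- x) + expR (- x) * theta * (C * psi x + D * (x - 1)).

Definition KL (g : R -> R) (lambda : R) : \bar R :=
  (\int[@lebesgue_measure R]_(x in (`[0%R, +oo[%classic : set R))
     (ln (g x / (lambda * expR (- (lambda * x)))) * g x)%:E)%E.

Definition Kdist (g : R -> R) : R :=
  fine (ereal_inf [set KL g l | l in (`]0%R, +oo[%classic : set R)]).

End Defs.

(* Main.v *)
(* Put u = exp (- x), so that under the hypothesis the letters u are uniform on [0, 1] and X_i + med < t becomes u_t < u_i * med' with med' the median of the corresponding letters (x -> exp (- x) is decreasing): I_n is then a 5-linear form, evaluated on the diagonal, in the empirical law of the letters, with the kernel [ker5] of values in {-1, 0, 1}.  Each section of the kernel is monotone, so rounding the letters up to a grid of mesh 1/m moves the form by at most ten times the largest mass of a cell; this replaces the law of u by a distribution on a finite alphabet.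
   There, the form vanishes at the uniform law up to O(1/m), and its derivative is 5 psi, where psi = [psih] (u): a density 1 + w (u) thus gives I = 5 \int w psi + O(|w|^2).  Counting types shows that f_I (eps) is the infimum of the relative entropy over the laws with I >= eps; by the Gibbs inequality with exponential weight t psi and by the tilted law 1 + t psi it equals eps^2 / (50 s) + O(eps^3), with s = \int psi^2.  For the alternative, w = theta (C psi + D (x - 1)); as psi is orthogonal to 1 and to x, b_I (theta) = 5 theta C s + O(theta^2), hence f_I (b_I (theta)) = theta^2 C^2 s / 2 + O(theta^3).  The best exponential fit removes the D (x - 1) part, and K (theta) has the same expansion.  The densities are nonnegative for large x only if D >= 0. *)
Require Import Defs.
From HB Require Import structures.
From mathcomp Require Import all_boot all_order all_algebra.
From mathcomp Require Import all_classical all_reals all_analysis measurable_realfun.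
From mathcomp Require Import ring lra.
Import Order.TTheory GRing.Theory Num.Theory.
Import numFieldNormedType.Exports.
Local Open Scope classical_set_scope.
Local Open Scope ring_scope.
Set Implicit Arguments. Unset Strict Implicit. Unset Printing Implicit Defensive.

(** * Quinary forms on a finite alphabet *)

(** The kernel is discontinuous, so the form is controlled on a grid only when no cell is heavy: the
    estimates carry a bound [delta] on the cell masses. On a fine grid a heavy cell is costly, since
    mass [delta] in one of [m] cells forces an entropy of at least [delta * ln m - ln 2]. The main
    obstacle is that f_I is an exact limit and not merely an expansion. The lower bound on
    probabilities needs laws whose form exceeds [eps] by a multiple of [delta], whereas the upper
    bound only provides laws whose form is at least [eps - 10 * delta]. The two infima agree because
    the entropy is convex and the form grows at linear speed towards a tilt. That growth is
    available only near the uniform law, which is why the large deviation theorem assumes a small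
    rate. The limit b (theta) is not computed as an integral. The values of the form at the cell
    masses of finer and finer grids are a Cauchy sequence, and only the expansion of the limit up to
    O(theta^2) is used. *)

Section WeightedSums.
Variables (R : realType) (I : finType).
Implicit Types (p q r : I -> R) (f g : I -> R).

Definition wsum q f : R := \sum_a q a * f a.
Definition norm1 q : R := \sum_a `|q a|.

Lemma wsumBl p q f : wsum (fun a => p a - q a) f = wsum p f - wsum q f.
Proof. by rewrite -sumrB; apply: eq_bigr => a _; rewrite mulrBl. Qed.

Lemma wsumBr q f g : wsum q (fun a => f a - g a) = wsum q f - wsum q g.
Proof. by rewrite -sumrB; apply: eq_bigr => a _; rewrite mulrBr. Qed.

Lemma wsumDr q f g : wsum q (fun a => f a + g a) = wsum q f + wsum q g.
Proof. by rewrite -big_split; apply: eq_bigr => a _; rewrite mulrDr. Qed.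

Lemma wsumZl k q f : wsum (fun a => k * q a) f = k * wsum q f.
Proof. by rewrite mulr_sumr; apply: eq_bigr => a _; rewrite mulrA. Qed.

Lemma wsumZr k q f : wsum q (fun a => k * f a) = k * wsum q f.
Proof. by rewrite mulr_sumr; apply: eq_bigr => a _; rewrite mulrCA. Qed.

Lemma wsum_cst q k : wsum q (fun=> k) = (\sum_a q a) * k.
Proof. by rewrite /wsum -mulr_suml. Qed.

Lemma eq_wsum q f g : f =1 g -> wsum q f = wsum q g.
Proof. by move=> fg; apply: eq_bigr => a _; rewrite fg. Qed.

Lemma norm1_ge0 q : 0 <= norm1 q.
Proof. by apply: sumr_ge0 => a _. Qed.

Lemma norm1_prob q : (forall a, 0 <= q a) -> \sum_a q a = 1 -> norm1 q = 1.
Proof. by move=> q0 <-; apply: eq_bigr => a _; rewrite ger0_norm. Qed.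

Lemma ler_norm_wsum q f (B : R) :
  (forall a, `|f a| <= B) -> `|wsum q f| <= norm1 q * B.
Proof.
move=> fB; rewrite (le_trans (ler_norm_sum _ _ _))// mulr_suml.
by apply: ler_sum => a _; rewrite normrM ler_wpM2l.
Qed.

Lemma ler_wsum q f g : (forall a, 0 <= q a) -> (forall a, f a <= g a) ->
  wsum q f <= wsum q g.
Proof. by move=> q0 fg; apply: ler_sum => a _; rewrite ler_wpM2l. Qed.

Lemma wsum_prob_norm q f (B : R) : (forall a, 0 <= q a) -> \sum_a q a = 1 ->
  (forall a, `|f a| <= B) -> `|wsum q f| <= B.
Proof. by move=> q0 q1 /(ler_norm_wsum q); rewrite norm1_prob// mul1r. Qed.

End WeightedSums.

Lemma wsum_exchange (R : realType) (I J : finType) (p : I -> R) (q : J -> R) f :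
  wsum p (fun a => wsum q (fun b => f a b)) = wsum q (fun b => wsum p (fun a => f a b)).
Proof.
rewrite /wsum (eq_bigr _ (fun a _ => mulr_sumr _ _ _ _)) exchange_big /=.
by apply: eq_bigr => b _; rewrite mulr_sumr; apply: eq_bigr => a _; rewrite mulrCA.
Qed.

Section QuinaryForms.
Variables (R : realType) (I : finType) (H : I -> I -> I -> I -> I -> R).
Implicit Types (p q r : I -> R).

Definition form5 (q1 q2 q3 q4 q5 : I -> R) : R :=
  wsum q1 (fun a => wsum q2 (fun b => wsum q3 (fun c =>
  wsum q4 (fun d => wsum q5 (fun e => H a b c d e))))).

Definition diag5 q := form5 q q q q q.

(** The differential of [diag5] at [p] in the direction [r]. *)
Definition lin5 p r : R :=
  form5 r p p p p + form5 p r p p p + form5 p p r p p + form5 p p p r p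
  + form5 p p p p r.

Lemma form5B1 p q q2 q3 q4 q5 :
  form5 (fun a => p a - q a) q2 q3 q4 q5 = form5 p q2 q3 q4 q5 - form5 q q2 q3 q4 q5.
Proof. exact: wsumBl. Qed.

Lemma form5B2 p q q1 q3 q4 q5 :
  form5 q1 (fun a => p a - q a) q3 q4 q5 = form5 q1 p q3 q4 q5 - form5 q1 q q3 q4 q5.
Proof. by rewrite /form5 -wsumBr; apply: eq_wsum => a; rewrite wsumBl. Qed.

Lemma form5B3 p q q1 q2 q4 q5 :
  form5 q1 q2 (fun a => p a - q a) q4 q5 = form5 q1 q2 p q4 q5 - form5 q1 q2 q q4 q5.
Proof.
rewrite /form5 -wsumBr; apply: eq_wsum => a; rewrite -wsumBr.
by apply: eq_wsum => b; rewrite wsumBl.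
Qed.

Lemma form5B4 p q q1 q2 q3 q5 :
  form5 q1 q2 q3 (fun a => p a - q a) q5 = form5 q1 q2 q3 p q5 - form5 q1 q2 q3 q q5.
Proof.
rewrite /form5 -wsumBr; apply: eq_wsum => a; rewrite -wsumBr.
apply: eq_wsum => b; rewrite -wsumBr; apply: eq_wsum => c.
by rewrite wsumBl.
Qed.

Lemma form5B5 p q q1 q2 q3 q4 :
  form5 q1 q2 q3 q4 (fun a => p a - q a) = form5 q1 q2 q3 q4 p - form5 q1 q2 q3 q4 q.
Proof.
rewrite /form5 -wsumBr; apply: eq_wsum => a; rewrite -wsumBr.
apply: eq_wsum => b; rewrite -wsumBr; apply: eq_wsum => c.
by rewrite -wsumBr; apply: eq_wsum => d; rewrite wsumBl.
Qed.

Lemma lin5Z p k r : lin5 p (fun a => k * r a) = k * lin5 p r.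
Proof.
have e1 : form5 (fun a => k * r a) p p p p = k * form5 r p p p p by exact: wsumZl.
have e2 : form5 p (fun a => k * r a) p p p = k * form5 p r p p p.
  by rewrite /form5 -wsumZr; apply: eq_wsum => a; exact: wsumZl.
have e3 : form5 p p (fun a => k * r a) p p = k * form5 p p r p p.
  rewrite /form5 -wsumZr; apply: eq_wsum => a; rewrite -wsumZr.
  by apply: eq_wsum => b; exact: wsumZl.
have e4 : form5 p p p (fun a => k * r a) p = k * form5 p p p r p.
  rewrite /form5 -wsumZr; apply: eq_wsum => a; rewrite -wsumZr.
  by apply: eq_wsum => b; rewrite -wsumZr; apply: eq_wsum => c; exact: wsumZl.
have e5 : form5 p p p p (fun a => k * r a) = k * form5 p p p p r.
  rewrite /form5 -wsumZr; apply: eq_wsum => a; rewrite -wsumZr.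
  apply: eq_wsum => b; rewrite -wsumZr; apply: eq_wsum => c.
  by rewrite -wsumZr; apply: eq_wsum => d; exact: wsumZl.
by rewrite /lin5 e1 e2 e3 e4 e5; ring.
Qed.

Hypothesis H1 : forall a b c d e, `|H a b c d e| <= 1.

Lemma ler_norm_form5 q1 q2 q3 q4 q5 : `|form5 q1 q2 q3 q4 q5| <=
  norm1 q1 * (norm1 q2 * (norm1 q3 * (norm1 q4 * norm1 q5))).
Proof.
do 4!(apply: ler_norm_wsum => ?); rewrite -[norm1 q5]mulr1.
exact: ler_norm_wsum.
Qed.

Section Probabilities.
Variables p q : I -> R.
Hypotheses (p1 : norm1 p = 1) (q1 : norm1 q = 1).
Let d := norm1 (fun a => q a - p a).
Let d0 : 0 <= d. Proof. exact: norm1_ge0. Qed.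

Lemma lin5_diag : lin5 p p = 5 * diag5 p.
Proof. by rewrite /lin5 /diag5; ring. Qed.

Lemma lin5B r1 r2 : lin5 p (fun a => r1 a - r2 a) = lin5 p r1 - lin5 p r2.
Proof. by rewrite /lin5 form5B1 form5B2 form5B3 form5B4 form5B5; ring. Qed.

Let bound a1 a2 a3 a4 a5 k :
  norm1 a1 * (norm1 a2 * (norm1 a3 * (norm1 a4 * norm1 a5))) = k ->
  `|form5 a1 a2 a3 a4 a5| <= k.
Proof. by move=> <-; exact: ler_norm_form5. Qed.

(** Telescoping over the slots: each of the five terms has one factor [q - p] and four factors of
    norm 1. *)
Lemma diag5_lipschitz : `|diag5 q - diag5 p| <= 5 * d.
Proof.
have -> : diag5 q - diag5 p =
   form5 (fun a => q a - p a) q q q q + form5 p (fun a => q a - p a) q q q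
 + form5 p p (fun a => q a - p a) q q + form5 p p p (fun a => q a - p a) q
 + form5 p p p p (fun a => q a - p a).
  by rewrite form5B1 form5B2 form5B3 form5B4 form5B5 /diag5; ring.
have -> : 5 * d = d + d + d + d + d by ring.
by do 4?[apply: (le_trans (ler_normD _ _)); apply: lerD]; apply: bound;
  rewrite -/d ?q1 ?p1 !(mul1r, mulr1).
Qed.

(** The remainder telescopes into one term for each of the ten pairs of slots that hold [q - p]. *)
Lemma diag5_taylor :
  `|diag5 q - diag5 p - lin5 p (fun a => q a - p a)| <= 10 * d ^+ 2.
Proof.
pose D := fun a => q a - p a.
have -> : diag5 q - diag5 p - lin5 p (fun a => q a - p a) =
    form5 D D q q q + form5 D p D q q + form5 D p p D q + form5 D p p p D
  + form5 p D D q q + form5 p D p D q + form5 p D p p D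
  + form5 p p D D q + form5 p p D p D + form5 p p p D D.
  rewrite /D /lin5 /diag5.
  rewrite !(form5B1, form5B2, form5B3, form5B4, form5B5); ring.
have -> : 10 * d ^+ 2 = d ^+ 2 + d ^+ 2 + d ^+ 2 + d ^+ 2 + d ^+ 2
                 + d ^+ 2 + d ^+ 2 + d ^+ 2 + d ^+ 2 + d ^+ 2 by ring.
by do 9?[apply: (le_trans (ler_normD _ _)); apply: lerD]; apply: bound;
  rewrite -/d ?q1 ?p1 !(mul1r, mulr1) expr2.
Qed.

(** There are five slots for [r] and four remaining ones for [q - p]. *)
Lemma lin5_lipschitz r : norm1 r = 1 -> `|lin5 q r - lin5 p r| <= 20 * d.
Proof.
move=> r1; pose D := fun a => q a - p a.
have -> : lin5 q r - lin5 p r =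
    form5 r D q q q + form5 r p D q q + form5 r p p D q + form5 r p p p D
  + form5 D r q q q + form5 p r D q q + form5 p r p D q + form5 p r p p D
  + form5 D q r q q + form5 p D r q q + form5 p p r D q + form5 p p r p D
  + form5 D q q r q + form5 p D q r q + form5 p p D r q + form5 p p p r D
  + form5 D q q q r + form5 p D q q r + form5 p p D q r + form5 p p p D r.
  rewrite /D /lin5.
  rewrite !(form5B1, form5B2, form5B3, form5B4, form5B5); ring.
have -> : 20 * d = d + d + d + d + d + d + d + d + d + d
                 + d + d + d + d + d + d + d + d + d + d by ring.
by do 19?[apply: (le_trans (ler_normD _ _)); apply: lerD]; apply: bound;
  rewrite -/d ?q1 ?p1 ?r1 !(mul1r, mulr1).
Qed.

End Probabilities.
End QuinaryForms.

(** Rotations bring a chosen slot to the innermost position, where a bound on sections applies. *)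
Lemma form5_rot (R : realType) (I : finType) (H : I -> I -> I -> I -> I -> R)
  (q1 q2 q3 q4 q5 : I -> R) :
  form5 H q1 q2 q3 q4 q5 = form5 (fun b c d e a => H a b c d e) q2 q3 q4 q5 q1.
Proof.
rewrite /form5 wsum_exchange; apply: eq_wsum => b.
rewrite wsum_exchange; apply: eq_wsum => c.
rewrite wsum_exchange; apply: eq_wsum => d.
by rewrite wsum_exchange.
Qed.

(** * The kernel and its rounding *)

Section Kernel.
Variable R : realType.

(** The letter [d] is a dummy here and stands for X_i in [kmed], so that both indicators have the
    same five slots; [e] is the letter of the observation over which F_n integrates. *)
Definition kmax (a b c d e : R) : bool := e < Num.min a (Num.min b c).
Definition kmed (a b c d e : R) : bool := e < d * med3 a b c.
Definition ker5 (a b c d e : R) : R := (kmax a b c d e)%:R - (kmed a b c d e)%:R.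

Lemma lt_med3 (y a b c : R) :
  (y < med3 a b c) = ((y < a) && (y < b)) || (((y < a) || (y < b)) && (y < c)).
Proof. by rewrite /med3 !(lt_max, lt_min). Qed.

Lemma med3_lt (y a b c : R) :
  (med3 a b c < y) = ((a < y) || (b < y)) && (((a < y) && (b < y)) || (c < y)).
Proof. by rewrite /med3 !(gt_max, gt_min). Qed.

Lemma med3_ge0 (a b c : R) : 0 <= a -> 0 <= b -> 0 <= c -> 0 <= med3 a b c.
Proof. by move=> a0 b0 c0; rewrite /med3 !(le_max, le_min) a0 b0. Qed.

Lemma med3_le1 (a b c : R) : a <= 1 -> b <= 1 -> med3 a b c <= 1.
Proof. by move=> a0 b0; rewrite /med3 !(ge_max, ge_min) a0 b0. Qed.

Lemma ler_med3 (a a' b b' c c' : R) : a <= a' -> b <= b' -> c <= c' ->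
  med3 a b c <= med3 a' b' c'.
Proof.
move=> aa bb cc; rewrite leNgt; apply/negP => h; move: (h).
rewrite lt_med3; set y := med3 a' b' c' => h'.
suff : y < y by rewrite ltxx.
rewrite {2}/y lt_med3; case/orP: h' => [/andP[h1 h2]|/andP[/orP[h1|h1] h2]];
  by rewrite ?(lt_le_trans h1 aa) ?(lt_le_trans h1 bb) ?(lt_le_trans h2 bb)
       ?(lt_le_trans h2 cc) ?orbT.
Qed.

Lemma ler_norm_ker5 (a b c d e : R) : `|ker5 a b c d e| <= 1.
Proof.
rewrite /ker5; case: kmax; case: kmed;
  by rewrite ?subrr ?subr0 ?sub0r ?normrN ?normr0 ?normr1.
Qed.

Definition monob (s : R -> bool) :=
  (forall x y, 0 <= x -> x <= y -> s x -> s y) \/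
  (forall x y, 0 <= x -> x <= y -> s y -> s x).

Lemma kmax_mono (a b c d e : R) :
  [/\ monob (fun x => kmax x b c d e), monob (fun x => kmax a x c d e),
      monob (fun x => kmax a b x d e), monob (fun x => kmax a b c x e)
    & monob (fun x => kmax a b c d x)].
Proof.
split; last (by right=> x y _ xy /(le_lt_trans xy)); left=> x y _ xy //;
  rewrite /kmax !lt_min => /and3P[h1 h2 h3]; rewrite ?h1 ?h2 ?h3 ?andbT /=.
- exact: lt_le_trans xy.
- exact: lt_le_trans xy.
- exact: lt_le_trans xy.
Qed.

Lemma kmed_mono (a b c d e : R) :
  0 <= a -> 0 <= b -> 0 <= c -> 0 <= d ->
  [/\ monob (fun x => kmed x b c d e), monob (fun x => kmed a x c d e),
      monob (fun x => kmed a b x d e), monob (fun x => kmed a b c x e)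
    & monob (fun x => kmed a b c d x)].
Proof.
move=> a0 b0 c0 d0.
split; last (by right=> x y _ xy /(le_lt_trans xy)); left=> x y _ xy;
  rewrite /kmed => h; apply: (lt_le_trans h).
- by rewrite ler_wpM2l// ler_med3.
- by rewrite ler_wpM2l// ler_med3.
- by rewrite ler_wpM2l// ler_med3.
- by rewrite ler_wpM2r// med3_ge0.
Qed.

End Kernel.

Section Rounding.
Variables (R : realType) (I J : finType) (om : I -> R) (u : I -> R)
  (w : I -> J) (v : J -> R).

Definition pushw (j : J) : R := \sum_(i | w i == j) om i.

Lemma wsum_push (F : J -> R) : wsum om (fun i => F (w i)) = wsum pushw F.
Proof.
rewrite /wsum (partition_big w predT)//=; apply: eq_bigr => j _.
by rewrite /pushw mulr_suml; apply: eq_bigr => i /eqP ->.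
Qed.

Lemma form5_push (H : J -> J -> J -> J -> J -> R) :
  form5 (fun a b c d e => H (w a) (w b) (w c) (w d) (w e)) om om om om om
  = form5 H pushw pushw pushw pushw pushw.
Proof.
rewrite /form5 -wsum_push; apply: eq_wsum => a.
rewrite -wsum_push; apply: eq_wsum => b.
rewrite -wsum_push; apply: eq_wsum => c.
rewrite -wsum_push; apply: eq_wsum => d.
by rewrite -wsum_push.
Qed.

Hypotheses (om0 : forall i, 0 <= om i) (om1 : \sum_i om i = 1).
Hypotheses (u0 : forall i, 0 <= u i) (v0 : forall j, 0 <= v j) (vI : injective v).
(** The fibres of [w] are consecutive intervals: a letter lies below the value of its own cell and
    strictly above the values of all lower cells. *)
Hypotheses (uv : forall i, u i <= v (w i))
  (vu : forall i j, v (w i) < v (w j) -> v (w i) < u j).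
Variable delta : R.
Hypotheses (delta0 : 0 <= delta) (cell : forall j, pushw j <= delta).

Let round_incr (s : R -> bool) : (forall x y, 0 <= x -> x <= y -> s x -> s y) ->
  `|wsum om (fun i => (s (u i))%:R - (s (v (w i)))%:R)| <= delta.
Proof.
move=> sm; pose P i := s (v (w i)) && ~~ s (u i).
have E i : (s (u i))%:R - (s (v (w i)))%:R = - (P i)%:R :> R.
  rewrite /P; have := sm _ _ (u0 i) (uv i).
  by case: (s (u i)); case: (s (v (w i))) => h; rewrite /= ?subrr ?sub0r ?oppr0//; have := h isT.
rewrite (eq_wsum _ E) /wsum.
under eq_bigr do rewrite mulrN.
rewrite sumrN normrN ger0_norm; last by apply: sumr_ge0 => i _; rewrite mulr_ge0.
case: (pickP P) => [i0 P0|P0]; last by rewrite big1// => i _; rewrite P0 mulr0.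
apply: le_trans (cell (w i0)); rewrite /pushw [leRHS]big_mkcond /=.
apply: ler_sum => i _; case: ifPn => [_|ne].
  by case: (P i); rewrite ?mulr1 ?mulr0.
suff -> : P i = false by rewrite mulr0.
apply/negP => Pi; move: Pi P0 => /andP[s1 s2] /andP[s3 s4].
(* Of two changed letters in different cells, the one in the higher cell would exceed the value of
   the lower cell, where [s] already holds. *)
have /lt_total /orP[/vu h|/vu h] : v (w i) != v (w i0) by rewrite inj_eq.
  by move: s4; rewrite (sm _ _ (v0 _) (ltW h) s1).
by move: s2; rewrite (sm _ _ (v0 _) (ltW h) s3).
Qed.

(* The sections of the kernel are indicators of half-lines, and rounding changes such an indicator only on the letters of a single cell. *)
Lemma rounding_section (s : R -> bool) : monob s ->
  `|wsum om (fun i => (s (u i))%:R - (s (v (w i)))%:R)| <= delta.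
Proof.
case=> sm; first exact: round_incr.
have := @round_incr (fun x => ~~ s x).
rewrite (@eq_wsum _ _ _ _ (fun i => -1 * ((s (u i))%:R - (s (v (w i)))%:R))).
  rewrite wsumZr mulN1r normrN; apply => x y x0 xy.
  by apply: contra; exact: sm xy.
by move=> i; case: (s (u i)); case: (s (v (w i))); rewrite /=; ring.
Qed.

(** The slots are rounded one at a time. Before each step the form is rotated until the slot in
    question is innermost; the section bound is then averaged over the other four. *)
Lemma rounding_kernel (k : R -> R -> R -> R -> R -> bool) :
  (forall a b c d e, 0 <= a -> 0 <= b -> 0 <= c -> 0 <= d ->
    [/\ monob (fun x => k x b c d e), monob (fun x => k a x c d e),
      monob (fun x => k a b x d e), monob (fun x => k a b c x e)
    & monob (fun x => k a b c d x)]) ->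
  `|diag5 (fun a b c d e => (k (u a) (u b) (u c) (u d) (u e))%:R) om
    - diag5 (fun a b c d e => (k (v a) (v b) (v c) (v d) (v e))%:R) pushw|
  <= 5 * delta.
Proof.
move=> km; rewrite /diag5 -form5_push.
pose x a := v (w a); have x0 a : 0 <= x a by exact: v0.
pose F i := form5 i om om om om om.
have FB i j : F i - F j = F (fun a b c d e => i a b c d e - j a b c d e).
  rewrite /F /form5 -wsumBr; apply: eq_wsum => a.
  rewrite -wsumBr; apply: eq_wsum => b; rewrite -wsumBr; apply: eq_wsum => c.
  by rewrite -wsumBr; apply: eq_wsum => d; rewrite -wsumBr.
have Fle i : (forall a b c d, `|wsum om (i a b c d)| <= delta) -> `|F i| <= delta.
  by move=> h; do 4!(apply: wsum_prob_norm => // ?).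
have Frot i : F i = F (fun b c d e a => i a b c d e) by exact: form5_rot.
have tri (r1 r2 r3 : R) c : `|r1 - r2| <= delta -> `|r2 - r3| <= c ->
    `|r1 - r3| <= delta + c.
  move=> h1 h2; rewrite (_ : r1 - r3 = (r1 - r2) + (r2 - r3)); last by ring.
  by rewrite (le_trans (ler_normD _ _))// lerD.
rewrite (_ : 5 * delta = delta + (delta + (delta + (delta + delta)))); last by ring.
apply: (tri _ (F (fun a b c d e => (k (x a) (u b) (u c) (u d) (u e))%:R))).
  rewrite FB Frot; apply: Fle => b c d e; apply: rounding_section (fun z => k z _ _ _ _) _.
  by case: (km 0 (u b) (u c) (u d) (u e)).
apply: (tri _ (F (fun a b c d e => (k (x a) (x b) (u c) (u d) (u e))%:R))).
  rewrite FB 2!Frot; apply: Fle => c d e a; apply: rounding_section (fun z => k _ z _ _ _) _.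
  by case: (km (x a) 0 (u c) (u d) (u e)).
apply: (tri _ (F (fun a b c d e => (k (x a) (x b) (x c) (u d) (u e))%:R))).
  rewrite FB 3!Frot; apply: Fle => d e a b; apply: rounding_section (fun z => k _ _ z _ _) _.
  by case: (km (x a) (x b) 0 (u d) (u e)).
apply: (tri _ (F (fun a b c d e => (k (x a) (x b) (x c) (x d) (u e))%:R))).
  rewrite FB 4!Frot; apply: Fle => e a b c; apply: rounding_section (fun z => k _ _ _ z _) _.
  by case: (km (x a) (x b) (x c) 0 (u e)).
rewrite FB; apply: Fle => a b c d; apply: rounding_section (fun z => k _ _ _ _ z) _.
by case: (km (x a) (x b) (x c) (x d) 0).
Qed.

Lemma diag5_rounding :
  `|diag5 (fun a b c d e => ker5 (u a) (u b) (u c) (u d) (u e)) om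
    - diag5 (fun a b c d e => ker5 (v a) (v b) (v c) (v d) (v e)) pushw|
  <= 10 * delta.
Proof.
have diag5B (K : finType) (q : K -> R) i j :
    diag5 (fun a b c d e => i a b c d e - j a b c d e) q = diag5 i q - diag5 j q.
  rewrite /diag5 /form5 -wsumBr; apply: eq_wsum => a.
  rewrite -wsumBr; apply: eq_wsum => b; rewrite -wsumBr; apply: eq_wsum => c.
  by rewrite -wsumBr; apply: eq_wsum => d; rewrite -wsumBr.
rewrite /ker5 !diag5B.
have h1 := rounding_kernel (fun a b c d e _ _ _ _ => kmax_mono a b c d e).
have h2 := rounding_kernel (@kmed_mono R).
move: h1 h2; set x := diag5 _ om; set x' := diag5 _ pushw.
set y := diag5 _ om; set y' := diag5 _ pushw => h1 h2.
rewrite (_ : x - y - (x' - y') = (x - x') - (y - y')); last by ring.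
by rewrite (le_trans (ler_normB _ _))// (le_trans (lerD h1 h2))//; lra.
Qed.

End Rounding.

(** * Projections of the kernel on a uniform grid *)

Section Grid.
Variables (R : realType) (m : nat).
Hypothesis m0 : (0 < m)%N.

(** The upper end of the cell: grid values are positive, which permits division by them, and do not
    exceed 1. *)
Definition gridv (c : 'I_m) : R := c.+1%:R / m%:R.
Definition unif (c : 'I_m) : R := m%:R^-1.
Definition avg (f : R -> R) : R := wsum unif (fun c => f (gridv c)).

Let mR : 0 < m%:R :> R. Proof. by rewrite ltr0n. Qed.
Let mV : 0 < m%:R^-1 :> R. Proof. by rewrite invr_gt0. Qed.

Lemma gridv_gt0 c : 0 < gridv c. Proof. by rewrite divr_gt0. Qed.
Lemma gridv_ge0 c : 0 <= gridv c. Proof. exact/ltW/gridv_gt0. Qed.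
Lemma gridv_le1 c : gridv c <= 1.
Proof. by rewrite ler_pdivrMr// mul1r ler_nat. Qed.
Lemma gridv_inj : injective gridv.
Proof.
move=> c d /(divIf (lt0r_neq0 mR)) /eqP; rewrite eqr_nat => /eqP[].
exact: val_inj.
Qed.

Lemma unif_ge0 c : 0 <= unif c. Proof. exact: ltW. Qed.
Lemma unif_sum : \sum_c unif c = 1.
Proof. by rewrite /unif sumr_const card_ord -[_ *+ _]mulr_natl divff// lt0r_neq0. Qed.
Lemma norm1_unif : norm1 unif = 1.
Proof. exact: norm1_prob unif_ge0 unif_sum. Qed.

Lemma avgB f g : avg (fun t => f t - g t) = avg f - avg g.
Proof. exact: wsumBr. Qed.
Lemma avgD f g : avg (fun t => f t + g t) = avg f + avg g.
Proof. exact: wsumDr. Qed.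
Lemma avgZ k f : avg (fun t => k * f t) = k * avg f.
Proof. exact: wsumZr. Qed.
Lemma avg_cst k : avg (fun=> k) = k.
Proof. by rewrite /avg wsum_cst unif_sum mul1r. Qed.
Lemma avg_exchange f :
  avg (fun x => avg (fun y => f x y)) = avg (fun y => avg (fun x => f x y)).
Proof. exact: wsum_exchange. Qed.
Lemma eq_avg f g : (forall x, 0 < x -> x <= 1 -> f x = g x) -> avg f = avg g.
Proof.
by move=> fg; apply: eq_wsum => c; rewrite fg ?gridv_gt0 ?gridv_le1.
Qed.
Lemma avg_ge0 f : (forall x, 0 <= f x) -> 0 <= avg f.
Proof. by move=> f0; apply: sumr_ge0 => c _; rewrite mulr_ge0 ?unif_ge0. Qed.
Lemma avg_le1 f : (forall x, f x <= 1) -> avg f <= 1.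
Proof.
by move=> f1; rewrite -[leRHS](avg_cst 1); apply: ler_wsum => // c; rewrite ?unif_ge0.
Qed.

Definition close (k x y : R) := `|x - y| <= k / m%:R.

Lemma close_trans k1 k2 y x z : close k1 x y -> close k2 y z -> close (k1 + k2) x z.
Proof.
rewrite /close => h1 h2; rewrite (_ : x - z = (x - y) + (y - z)); last by ring.
by rewrite (le_trans (ler_normD _ _))// mulrDl lerD.
Qed.

Lemma closeZ c k x y : `|c| <= 1 -> close k x y -> close k (c * x) (c * y).
Proof.
rewrite /close -mulrBr normrM => c1 h; apply: le_trans h.
by rewrite ler_piMl.
Qed.

Lemma closeN k x y : close k x y -> close k (- x) (- y).
Proof. by rewrite /close -opprD normrN. Qed.

Lemma close_lip k L (g : R -> R) x y :
  (`|g x - g y| <= L * `|x - y|) -> 0 <= L -> close k x y -> close (L * k) (g x) (g y).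
Proof.
by rewrite /close => h L0 xy; rewrite (le_trans h)// -mulrA ler_wpM2l.
Qed.

Lemma avg_close k f g :
  (forall x, 0 < x -> x <= 1 -> close k (f x) (g x)) -> close k (avg f) (avg g).
Proof.
move=> fg; rewrite /close -avgB; apply: wsum_prob_norm unif_ge0 unif_sum _ => c.
by apply: fg; rewrite ?gridv_gt0 ?gridv_le1.
Qed.

(* [f] is a subgradient of the convex function [F], hence monotone, and upper and lower Riemann sums of [f] differ by a telescoping sum. *)
Lemma riemann_convex (f F : R -> R) :
  (forall x y, 0 <= x -> x <= 1 -> 0 <= y -> y <= 1 -> f x * (y - x) <= F y - F x) ->
  close (f 1 - f 0) (avg f) (F 1 - F 0).
Proof.
move=> sub; pose t (k : nat) : R := k%:R / m%:R.
have t0 : t 0%N = 0 by rewrite /t mul0r.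
have t1 : t m = 1 by rewrite /t divff// lt0r_neq0.
have tS k : t k.+1 - t k = m%:R^-1 by rewrite /t -mulrBl -natr1 addrC addKr mul1r.
have tin k : (k <= m)%N -> 0 <= t k /\ t k <= 1.
  by move=> km; rewrite divr_ge0// ler_pdivrMr// mul1r ler_nat.
have E : avg f = \sum_(0 <= k < m) f (t k.+1) / m%:R.
  rewrite /avg /wsum big_mkord; apply: eq_bigr => i _; by rewrite mulrC.
have T G : G 1 - G 0 = \sum_(0 <= k < m) (G (t k.+1) - G (t k)) :> R.
  by rewrite (telescope_sumr (fun k => G (t k)))// t0 t1.
have up : avg f - (F 1 - F 0) <= (f 1 - f 0) / m%:R.
  rewrite E T T mulr_suml -sumrB; apply: ler_sum_nat => k /andP[_ km].
  have [a1 a2] := tin _ (ltnW km); have [b1 b2] := tin _ km.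
  have := sub _ _ a1 a2 b1 b2; rewrite tS mulrBl; lra.
have lo : 0 <= avg f - (F 1 - F 0).
  rewrite E T -sumrB big_mkord; apply: sumr_ge0 => -[k km] _ /=.
  have [a1 a2] := tin _ (ltnW km); have [b1 b2] := tin _ km.
  have := sub _ _ b1 b2 a1 a2; have := tS k.
  rewrite -[t k - t k.+1]opprB => ->; rewrite mulrN; lra.
by rewrite /close ger0_norm.
Qed.

End Grid.

Section GridAverages.
Variables (R : realType) (m : nat).
Hypothesis m0 : (0 < m)%N.
Local Notation avg := (@avg R m).
Local Notation close := (@close R m).

Lemma close_weaken k k' (x y : R) : k <= k' -> close k x y -> close k' x y.
Proof. by move=> kk /le_trans; apply; rewrite ler_wpM2r// invr_ge0 ler0n. Qed.

Lemma riemann_concave (f F : R -> R) (k l : R) :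
  (forall x y, 0 <= x -> x <= 1 -> 0 <= y -> y <= 1 -> F y - F x <= f x * (y - x)) ->
  f 0 - f 1 <= k -> F 1 - F 0 = l -> close k (avg f) l.
Proof.
move=> sub fk Fl.
have := @riemann_convex R m m0 (fun t => -1 * f t) (fun t => - F t).
rewrite avgZ => h.
have {}h := close_weaken _ (h _); rewrite -[avg f]opprK -Fl.
rewrite (_ : F 1 - F 0 = - (- F 1 - - F 0)); last by ring.
apply: closeN; rewrite -mulN1r; apply: h; first by lra.
by move=> x y x0 x1 y0 y1; have := sub x y x0 x1 y0 y1; lra.
Qed.

(** Two concave primitives with slopes dropping at [v] glue to a concave one. This serves the
    nonincreasing integrands with a jump or a kink at the letter [v] that the projections
    produce. *)
Lemma riemann_glue (v : R) (f1 f2 F1 F2 : R -> R) (k l : R) :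
  0 <= v -> v <= 1 -> F1 v = F2 v ->
  (forall x y, 0 <= x -> x <= v -> 0 <= y -> y <= v -> F1 y - F1 x <= f1 x * (y - x)) ->
  (forall x y, v <= x -> x <= 1 -> v <= y -> y <= 1 -> F2 y - F2 x <= f2 x * (y - x)) ->
  (forall x, 0 <= x -> x <= v -> f2 v <= f1 x) ->
  (forall x, v <= x -> x <= 1 -> f2 x <= f1 v) ->
  f1 0 - f2 1 <= k -> F2 1 - F1 0 = l ->
  close k (avg (fun t => if t < v then f1 t else f2 t)) l.
Proof.
move=> v0 v1 Fv s1 s2 d1 d2 fk Fl.
have vv : v <= v by [].
apply: (@riemann_concave _ (fun t => if t < v then F1 t else F2 t)).
- move=> x y x0 x1 y0 y1; case: (ltP x v) => xv; case: (ltP y v) => yv.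
  + by apply: s1 => //; exact: ltW.
  + have h1 := s1 _ _ x0 (ltW xv) v0 vv.
    have h2 := s2 _ _ vv v1 yv y1.
    have h3 := d1 _ x0 (ltW xv).
    have : f2 v * (y - v) <= f1 x * (y - v) by rewrite ler_wpM2r// subr_ge0.
    by rewrite Fv in h1; lra.
  + have h1 := s1 _ _ v0 vv y0 (ltW yv).
    have h2 := s2 _ _ xv x1 vv v1.
    have h3 := d2 _ xv x1.
    have : f2 x * (v - y) <= f1 v * (v - y) by rewrite ler_wpM2r// subr_ge0 ltW.
    by rewrite Fv in h1; lra.
  + exact: s2.
- rewrite (ltNge 1) v1 /=; case: ltP => // v0'.
  have e : v = 0 by apply/le_anti; rewrite v0 v0'.
  by have := d1 0 (lexx 0) v0; rewrite e; lra.
- rewrite (ltNge 1) v1 /=; case: ltP => // v0'.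
  by rewrite -Fl (_ : 0 = v) ?Fv//; apply/le_anti; rewrite v0.
Qed.

Lemma avg_lt (y : R) : 0 <= y -> y <= 1 -> close 1 (avg (fun t : R => (t < y)%R%:R)) y.
Proof.
move=> y0 y1; have := @riemann_glue y (fun=> 1) (fun=> 0) id (fun=> y) 1 y.
rewrite (_ : (fun t : R => if t < y then 1 else 0) = (fun t : R => (t < y)%R%:R) :> (R -> R)); last first.
  by apply/funext => t; case: ltP.
by apply => // *; lra.
Qed.

Definition Fbar (y : R) := avg (fun t => (y < t)%R%:R).

Lemma Fbar_ge0 y : 0 <= Fbar y.
Proof. exact: avg_ge0. Qed.

Lemma Fbar_le1 y : Fbar y <= 1.
Proof. by apply: avg_le1 => // x; case: ltP. Qed.

(** The truncation at 0 accounts for levels above 1, which occur as [v / d] in [proj_med5]. *)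
Lemma Fbar_approx (y : R) : 0 <= y -> close 1 (Fbar y) (Num.max (1 - y) 0).
Proof.
move=> y0; have := @riemann_convex R m m0 (fun t => (y < t)%R%:R) (fun t => Num.max (t - y) 0).
have -> : Num.max (0 - y) 0 = 0 by apply/max_idPr; lra.
rewrite subr0 => h; apply: (close_weaken _ (h _)).
  by rewrite (ltNge y 0) y0 subr0; case: (y < 1).
move=> x z x0 x1 z0 z1; rewrite !maxElt.
by case: (ltP y x) => h1; case: ltP => h2; case: ltP => h3; rewrite /= ?mul1r ?mul0r; lra.
Qed.

Lemma Fbar_approx1 (y : R) : 0 <= y -> y <= 1 -> close 1 (Fbar y) (1 - y).
Proof. by move=> y0 y1; rewrite -[1 - y](@max_l _ _ _ 0) ?subr_ge0//; exact: Fbar_approx. Qed.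

Lemma avg_id : close 1 (avg id) 2^-1.
Proof.
have -> : 2^-1 = 1 ^+ 2 / 2 - 0 ^+ 2 / 2 :> R by lra.
have := @riemann_convex R m m0 id (fun t => t ^+ 2 / 2); rewrite subr0; apply.
move=> x y x0 x1 y0 y1; have := sqr_ge0 (x - y); lra.
Qed.

(** The probability that at least two of three letters exceed a level, when one of them has the
    indicator [a] and each of the others exceeds it with probability [F]; in [majority3] all three
    are random. *)
Definition majority2 (a F : R) := a * (2 * F - 2 * F ^+ 2) + F ^+ 2.
Definition majority3 (F : R) := 3 * F ^+ 2 - 2 * F ^+ 3.

Lemma avg_med2 (v y : R) : avg (fun b => avg (fun c => (y < med3 v b c)%R%:R))
  = majority2 (y < v)%R%:R (Fbar y).
Proof.
pose a : R := (y < v)%R%:R.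
transitivity (avg (fun b => avg (fun c => a * (y < b)%R%:R
   + (a + (1 - 2 * a) * (y < b)%R%:R) * (y < c)%R%:R))).
  apply: (eq_avg m0) => b _ _; apply: (eq_avg m0) => c _ _; rewrite lt_med3 /a.
  by case: (y < v); case: (y < b); case: (y < c); rewrite /=; ring.
transitivity (avg (fun b => a * Fbar y + (a + (1 - 2 * a) * Fbar y) * (y < b)%R%:R)).
  by apply: (eq_avg m0) => b _ _; rewrite avgD avg_cst// avgZ /=; rewrite -/(Fbar y); ring.
by rewrite avgD avg_cst// avgZ -/(Fbar y) /majority2 -/a; ring.
Qed.

Lemma avg_med3 (y : R) : avg (fun a => avg (fun b => avg (fun c => (y < med3 a b c)%R%:R)))
  = majority3 (Fbar y).
Proof.
transitivity (avg (fun a => Fbar y ^+ 2 + (2 * Fbar y - 2 * Fbar y ^+ 2) * (y < a)%R%:R)).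
  by apply: (eq_avg m0) => a _ _; rewrite avg_med2 /majority2; ring.
by rewrite avgD avg_cst// avgZ -/(Fbar y) /majority3; ring.
Qed.

Lemma close_majority2 (b : bool) (y : R) : 0 <= y -> y <= 1 ->
  close 2 (majority2 b%:R (Fbar y)) (majority2 b%:R (1 - y)).
Proof.
move=> y0 y1; rewrite -[2]mulr1; apply: close_lip (Fbar_approx1 y0 y1) => //.
have F0 := Fbar_ge0 y; have F1 := Fbar_le1 y.
move: (Fbar y) F0 F1 => F F0 F1; rewrite /majority2.
case: b => /=.
  rewrite (_ : _ - _ = (2 - F - (1 - y)) * (F - (1 - y))); last by ring.
  by rewrite normrM ler_wpM2r// ger0_norm; lra.
rewrite (_ : _ - _ = (F + (1 - y)) * (F - (1 - y))); last by ring.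
by rewrite normrM ler_wpM2r// ger0_norm; lra.
Qed.

Lemma majority3_lip (F G : R) : 0 <= F -> F <= 1 -> 0 <= G -> G <= 1 ->
  `|majority3 F - majority3 G| <= 2 * `|F - G|.
Proof.
move=> F0 F1 G0 G1; rewrite /majority3.
rewrite (_ : _ - _ = (3 * (F + G) - 2 * (F ^+ 2 + F * G + G ^+ 2)) * (F - G)); last by ring.
have a1 : F * (1 - F) >= 0 by rewrite mulr_ge0// subr_ge0.
have a2 : G * (1 - G) >= 0 by rewrite mulr_ge0// subr_ge0.
have a3 := sqr_ge0 (F - G); have a4 := sqr_ge0 (F + G - 1).
by rewrite normrM ler_wpM2r// ger0_norm; lra.
Qed.

End GridAverages.

Section Projections.
Variables (R : realType) (m : nat).
Hypothesis m0 : (0 < m)%N.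
Local Notation avg := (@avg R m).
Local Notation close := (@close R m).
Local Notation Fbar := (@Fbar R m).

Lemma kmaxE (a b c d e : R) :
  (kmax a b c d e)%:R = (e < a)%R%:R * (e < b)%R%:R * (e < c)%R%:R :> R.
Proof.
by rewrite /kmax !lt_min; case: (e < a); case: (e < b); case: (e < c); rewrite /= ?mulr1 ?mulr0.
Qed.

Lemma close_Fbar2 (y : R) : 0 <= y -> y <= 1 -> close 2 (Fbar y ^+ 2) ((1 - y) ^+ 2).
Proof.
move=> y0 y1; have := close_majority2 m0 false y0 y1.
by rewrite /majority2 /= !mul0r !add0r.
Qed.

Lemma close_Fbar3 (y : R) : 0 <= y -> y <= 1 -> close 3 (Fbar y ^+ 3) ((1 - y) ^+ 3).
Proof.
move=> y0 y1; rewrite -[3]mulr1; apply: (close_lip (g := fun z => z ^+ 3)) (Fbar_approx1 m0 y0 y1) => //.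
have F0 := Fbar_ge0 m0 y; have F1 := Fbar_le1 m0 y.
move: (Fbar y) F0 F1 => F F0 F1.
rewrite (_ : _ - _ = (F ^+ 2 + F * (1 - y) + (1 - y) ^+ 2) * (F - (1 - y))); last by ring.
have a1 : F * (1 - F) >= 0 by rewrite mulr_ge0// subr_ge0.
have a2 : y * (1 - y) >= 0 by rewrite mulr_ge0// subr_ge0.
have a3 : F * (1 - y) >= 0 by rewrite mulr_ge0// subr_ge0.
have a4 : F * y >= 0 by rewrite mulr_ge0.
have a5 := sqr_ge0 F; have a6 := sqr_ge0 (1 - y).
by rewrite normrM ler_wpM2r// ger0_norm; lra.
Qed.

(** The limit is the integral of (1 - e)^2 over e < v, as [b] and [c] must both exceed [e]. *)
Lemma proj_max1 (v : R) : 0 <= v -> v <= 1 ->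
  close 3 (avg (fun b => avg (fun c => avg (fun d => avg (fun e => (kmax v b c d e)%:R)))))
    ((1 - (1 - v) ^+ 3) / 3).
Proof.
move=> v0 v1.
have -> : avg (fun b => avg (fun c => avg (fun d => avg (fun e => (kmax v b c d e)%:R))))
    = avg (fun e => (e < v)%R%:R * Fbar e ^+ 2).
  transitivity (avg (fun b => avg (fun c => avg (fun e => (e < v)%R%:R * (e < b)%R%:R * (e < c)%R%:R)))).
    apply: (eq_avg m0) => b _ _; apply: (eq_avg m0) => c _ _.
    rewrite avg_exchange; apply: (eq_avg m0) => e _ _.
    rewrite -[RHS](avg_cst m0); apply: (eq_avg m0) => d _ _; exact: kmaxE.
  transitivity (avg (fun b => avg (fun e => (e < v)%R%:R * Fbar e * (e < b)%R%:R))).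
    apply: (eq_avg m0) => b _ _; rewrite avg_exchange; apply: (eq_avg m0) => e _ _.
    by rewrite avgZ mulrAC.
  by rewrite avg_exchange; apply: (eq_avg m0) => e _ _; rewrite avgZ expr2 mulrA.
apply: (@close_weaken _ _ (2 + 1)); first by lra.
apply: (@close_trans _ _ _ _ (avg (fun e => if e < v then (1 - e) ^+ 2 else 0))).
  apply: avg_close => // e e0 e1; case: ifP => _; rewrite ?mul1r ?mul0r.
    exact: close_Fbar2 (ltW e0) e1.
  by rewrite /close subrr normr0 divr_ge0// ler0n.
apply: (@riemann_glue _ _ m0 _ (fun e => (1 - e) ^+ 2) (fun=> 0) (fun e => - (1 - e) ^+ 3 / 3)
  (fun=> - (1 - v) ^+ 3 / 3)) => //.
- move=> x y x0 xv y0 yv.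
  have : 0 <= (y - x) ^+ 2 * (2 * (1 - x) + (1 - y)) by rewrite mulr_ge0 ?sqr_ge0//; lra.
  lra.
- by move=> *; lra.
- by move=> *; rewrite sqr_ge0.
- by move=> *; rewrite sqr_ge0.
- lra.
Qed.

Lemma proj_max5 (v : R) : 0 <= v -> v <= 1 ->
  close 3 (avg (fun a => avg (fun b => avg (fun c => avg (fun d => (kmax a b c d v)%:R)))))
    ((1 - v) ^+ 3).
Proof.
move=> v0 v1.
suff -> : avg (fun a => avg (fun b => avg (fun c => avg (fun d => (kmax a b c d v)%:R))))
    = Fbar v ^+ 3 by exact: close_Fbar3.
transitivity (avg (fun a => (v < a)%R%:R * Fbar v ^+ 2)).
  apply: (eq_avg m0) => a _ _.
  transitivity (avg (fun b => (v < a)%R%:R * Fbar v * (v < b)%R%:R)).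
    apply: (eq_avg m0) => b _ _.
    transitivity (avg (fun c => (v < a)%R%:R * (v < b)%R%:R * (v < c)%R%:R)).
      apply: (eq_avg m0) => c _ _; rewrite -[RHS](avg_cst m0).
      by apply: (eq_avg m0) => d _ _; exact: kmaxE.
    by rewrite avgZ mulrAC.
  by rewrite avgZ expr2 mulrA.
transitivity (Fbar v ^+ 2 * Fbar v); last by rewrite -exprSr.
by rewrite {3}/Fbar -avgZ; apply: (eq_avg m0) => a _ _; rewrite mulrC.
Qed.

(** The fixed dummy letter may be replaced by an average over it, which leads back to
    [proj_max5]. *)
Lemma proj_max4 (v : R) :
  close 4 (avg (fun a => avg (fun b => avg (fun c => avg (fun e => (kmax a b c v e)%:R)))))
    (1 / 4).
Proof.
have -> : avg (fun a => avg (fun b => avg (fun c => avg (fun e => (kmax a b c v e)%:R))))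
   = avg (fun e => avg (fun a => avg (fun b => avg (fun c => avg (fun d => (kmax a b c d e)%:R))))).
  rewrite [RHS]avg_exchange; apply: (eq_avg m0) => a _ _.
  rewrite [RHS]avg_exchange; apply: (eq_avg m0) => b _ _.
  rewrite [RHS]avg_exchange; apply: (eq_avg m0) => c _ _.
  apply: (eq_avg m0) => e _ _; rewrite -[LHS](avg_cst m0).
  by apply: (eq_avg m0) => d _ _; rewrite !kmaxE.
apply: (@close_weaken _ _ (3 + 1)); first by lra.
apply: (@close_trans _ _ _ _ (avg (fun e => (1 - e) ^+ 3))).
  by apply: avg_close => // e e0 e1; exact: proj_max5 (ltW e0) e1.
apply: (riemann_concave m0 (F := fun e => - (1 - e) ^+ 4 / 4)); [|lra|lra].
move=> x y x0 x1 y0 y1.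
have : 0 <= (y - x) ^+ 2 * (3 * (1 - x) ^+ 2 + 2 * ((1 - x) * (1 - y)) + (1 - y) ^+ 2).
  rewrite mulr_ge0 ?sqr_ge0// !addr_ge0 ?sqr_ge0 ?mulr_ge0 ?sqr_ge0//; lra.
lra.
Qed.

Lemma med3_in01 (a b c : R) : 0 < a -> a <= 1 -> 0 < b -> b <= 1 -> 0 < c -> c <= 1 ->
  0 <= med3 a b c /\ med3 a b c <= 1.
Proof. by move=> *; split; [apply: med3_ge0; apply: ltW | apply: med3_le1]. Qed.

Lemma avg_lt_med (y z : R) : 0 <= y -> y <= 1 -> 0 <= z -> z <= 1 ->
  close 1 (avg (fun e => (e < y * z)%R%:R)) (y * z).
Proof.
move=> y0 y1 z0 z1; apply: avg_lt => //; first by rewrite mulr_ge0.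
by rewrite mulr_ile1.
Qed.

(** Layer cake: up to 1/m the median is the average over y of the indicators [y < med3 v b c].
    Averaging over [b] and [c] then leaves a polynomial in y on each side of [v]. *)
Lemma avg_med2_approx (v : R) : 0 < v -> v <= 1 ->
  close 4 (avg (fun b => avg (fun c => med3 v b c))) (1 / 3 + v ^+ 2 - 2 * v ^+ 3 / 3).
Proof.
move=> v0 v1; apply: (@close_weaken _ _ (1 + (2 + 1))); first by lra.
apply: (@close_trans _ _ _ _ (avg (fun b => avg (fun c => avg (fun y => (y < med3 v b c)%R%:R))))).
  apply: avg_close => // b b0 b1; apply: avg_close => // c c0 c1.
  have [h0 h1] := med3_in01 v0 v1 b0 b1 c0 c1.
  by rewrite /close distrC; exact: avg_lt.
have -> : avg (fun b => avg (fun c => avg (fun y => (y < med3 v b c)%R%:R)))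
  = avg (fun y => majority2 (y < v)%R%:R (Fbar y)).
  transitivity (avg (fun b => avg (fun y => avg (fun c => (y < med3 v b c)%R%:R)))).
    by apply: (eq_avg m0) => b _ _; rewrite avg_exchange.
  rewrite avg_exchange; apply: (eq_avg m0) => y _ _; exact: avg_med2.
apply: (@close_trans _ _ _ _ (avg (fun y => if y < v then 1 - y ^+ 2 else (1 - y) ^+ 2))).
  apply: avg_close => // y y0 y1; have := close_majority2 m0 (y < v) (ltW y0) y1.
  rewrite [X in close _ _ X -> _]/majority2; case: ifP => _ /=; congr close; ring.
apply: (@riemann_glue _ _ m0 _ (fun y => 1 - y ^+ 2) (fun y => (1 - y) ^+ 2)
  (fun y => y - y ^+ 3 / 3) (fun y => v - v ^+ 3 / 3 + ((1 - v) ^+ 3 - (1 - y) ^+ 3) / 3)) => //.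
- exact: ltW.
- lra.
- move=> x y x0 xv y0 yv.
  have : 0 <= (y - x) ^+ 2 * (2 * x + y) by rewrite mulr_ge0 ?sqr_ge0//; lra.
  lra.
- move=> x y x0 xv y0 yv.
  have : 0 <= (y - x) ^+ 2 * (2 * (1 - x) + (1 - y)) by rewrite mulr_ge0 ?sqr_ge0//; lra.
  lra.
- move=> x x0 xv; have : x ^+ 2 <= v * v by rewrite expr2 ler_pM.
  have : v * v <= v by rewrite ler_piMl// ltW.
  lra.
- move=> x vx x1; have : (1 - x) ^+ 2 <= (1 - v) * (1 - v) by rewrite expr2 ler_pM//; lra.
  have : v * v <= v by rewrite ler_piMl// ltW.
  lra.
- lra.
Qed.

Lemma avg_med3_approx : close 4 (avg (fun a => avg (fun b => avg (fun c => med3 a b c)))) (1 / 2).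
Proof.
apply: (@close_weaken _ _ (1 + (2 + 1))); first by lra.
apply: (@close_trans _ _ _ _
   (avg (fun a => avg (fun b => avg (fun c => avg (fun y => (y < med3 a b c)%R%:R)))))).
  apply: avg_close => // a a0 a1; apply: avg_close => // b b0 b1; apply: avg_close => // c c0 c1.
  have [h0 h1] := med3_in01 a0 a1 b0 b1 c0 c1.
  by rewrite /close distrC; exact: avg_lt.
have -> : avg (fun a => avg (fun b => avg (fun c => avg (fun y => (y < med3 a b c)%R%:R))))
  = avg (fun y => majority3 (Fbar y)).
  transitivity (avg (fun a => avg (fun y => avg (fun b => avg (fun c => (y < med3 a b c)%R%:R))))).
    apply: (eq_avg m0) => a _ _.
    rewrite [RHS]avg_exchange; apply: (eq_avg m0) => b _ _.
    by rewrite [RHS]avg_exchange.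
  rewrite avg_exchange; apply: (eq_avg m0) => y _ _; exact: avg_med3.
apply: (@close_trans _ _ _ _ (avg (fun y => 1 - 3 * y ^+ 2 + 2 * y ^+ 3))).
  apply: avg_close => // y y0 y1.
  have -> : 1 - 3 * y ^+ 2 + 2 * y ^+ 3 = majority3 (1 - y) by rewrite /majority3; ring.
  rewrite -[2]mulr1; apply: close_lip (Fbar_approx1 m0 (ltW y0) y1) => //.
  apply: majority3_lip; rewrite ?Fbar_ge0 ?Fbar_le1//; lra.
apply: (riemann_concave m0 (F := fun y => y - y ^+ 3 + y ^+ 4 / 2)); [|lra|lra].
move=> x y x0 x1 y0 y1.
have : 0 <= (y - x) ^+ 2 * (y + 2 * x - (y ^+ 2 + 2 * (x * y) + 3 * x ^+ 2) / 2).
  rewrite mulr_ge0 ?sqr_ge0//.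
  have : x * (1 - x) >= 0 by rewrite mulr_ge0// subr_ge0.
  have : y * (1 - y) >= 0 by rewrite mulr_ge0// subr_ge0.
  have := sqr_ge0 (x - y); lra.
lra.
Qed.

Lemma proj_med1 (v : R) : 0 < v -> v <= 1 ->
  close 6 (avg (fun b => avg (fun c => avg (fun d => avg (fun e => (kmed v b c d e)%:R)))))
    ((1 / 3 + v ^+ 2 - 2 * v ^+ 3 / 3) / 2).
Proof.
move=> v0 v1; apply: (@close_weaken _ _ (1 + (4 + 1))); first by lra.
apply: (@close_trans _ _ _ _ (avg (fun b => avg (fun c => avg (fun d => d * med3 v b c))))).
  apply: avg_close => // b b0 b1; apply: avg_close => // c c0 c1; apply: avg_close => // d d0 d1.
  have [h0 h1] := med3_in01 v0 v1 b0 b1 c0 c1.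
  exact: avg_lt_med (ltW d0) d1 h0 h1.
have -> : avg (fun b => avg (fun c => avg (fun d => d * med3 v b c)))
  = avg id * avg (fun b => avg (fun c => med3 v b c)).
  rewrite -avgZ; apply: (eq_avg m0) => b _ _; rewrite -avgZ; apply: (eq_avg m0) => c _ _.
  rewrite [RHS]mulrC -avgZ; apply: (eq_avg m0) => d _ _; exact: mulrC.
apply: (@close_trans _ _ _ _ (avg id * (1 / 3 + v ^+ 2 - 2 * v ^+ 3 / 3))).
  apply: closeZ; last exact: avg_med2_approx.
  apply: wsum_prob_norm; [exact: unif_ge0|exact: unif_sum|] => c.
  by rewrite ger0_norm ?gridv_ge0 ?gridv_le1.
rewrite mulrC; apply: closeZ; last exact: avg_id.
have h2 : v ^+ 2 <= 1 by rewrite expr_le1// ltW.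
have h3 : v ^+ 3 <= v ^+ 2 by rewrite exprS ler_piMl// sqr_ge0.
have h4 : 0 <= v ^+ 3 by rewrite exprn_ge0// ltW.
have h5 : 0 <= (1 - v) ^+ 2 * (1 + 2 * v) by rewrite mulr_ge0 ?sqr_ge0//; lra.
by rewrite ler_norml; apply/andP; split; lra.
Qed.

Lemma proj_med4 (v : R) : 0 < v -> v <= 1 ->
  close 5 (avg (fun a => avg (fun b => avg (fun c => avg (fun e => (kmed a b c v e)%:R)))))
    (v / 2).
Proof.
move=> v0 v1; apply: (@close_weaken _ _ (1 + 4)); first by lra.
apply: (@close_trans _ _ _ _ (avg (fun a => avg (fun b => avg (fun c => v * med3 a b c))))).
  apply: avg_close => // a a0 a1; apply: avg_close => // b b0 b1; apply: avg_close => // c c0 c1.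
  have [h0 h1] := med3_in01 a0 a1 b0 b1 c0 c1.
  exact: avg_lt_med (ltW v0) v1 h0 h1.
have -> : avg (fun a => avg (fun b => avg (fun c => v * med3 a b c)))
  = v * avg (fun a => avg (fun b => avg (fun c => med3 a b c))).
  rewrite -avgZ; apply: (eq_avg m0) => a _ _; rewrite -avgZ; apply: (eq_avg m0) => b _ _.
  by rewrite -avgZ.
rewrite -[v / 2]/(v * 2^-1) -[2^-1]mul1r; apply: closeZ; last exact: avg_med3_approx.
by rewrite ger0_norm// ltW.
Qed.

(** For fixed [d] this is the survival function of the median at [v / d]. The limit equals that of
    [proj_max5]: for exponential data X + med and max have the same law, which is the
    characterization behind the statistic. The fifth slot therefore contributes nothing to the
    differential. *)
Lemma proj_med5 (v : R) : 0 < v -> v <= 1 ->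
  close 3 (avg (fun a => avg (fun b => avg (fun c => avg (fun d => (kmed a b c d v)%:R)))))
    ((1 - v) ^+ 3).
Proof.
move=> v0 v1.
have -> : avg (fun a => avg (fun b => avg (fun c => avg (fun d => (kmed a b c d v)%:R))))
   = avg (fun d => majority3 (Fbar (v / d))).
  transitivity (avg (fun d => avg (fun a => avg (fun b => avg (fun c => (kmed a b c d v)%:R))))).
    rewrite [RHS]avg_exchange; apply: (eq_avg m0) => a _ _.
    rewrite [RHS]avg_exchange; apply: (eq_avg m0) => b _ _.
    by rewrite [RHS]avg_exchange.
  apply: (eq_avg m0) => d d0 d1; rewrite -avg_med3//.
  apply: (eq_avg m0) => a _ _; apply: (eq_avg m0) => b _ _; apply: (eq_avg m0) => c _ _.
  by rewrite /kmed ltr_pdivrMr// mulrC.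
apply: (@close_weaken _ _ (2 + 1)); first by lra.
apply: (@close_trans _ _ _ _
   (avg (fun d => if d < v then 0 else 1 - 3 * (v / d) ^+ 2 + 2 * (v / d) ^+ 3))).
  apply: avg_close => // d d0 d1.
  have y0 : 0 <= v / d by rewrite divr_ge0// ltW.
  have -> : (if d < v then 0 else 1 - 3 * (v / d) ^+ 2 + 2 * (v / d) ^+ 3)
     = majority3 (Num.max (1 - v / d) 0).
    case: (ltP d v) => dv.
      rewrite max_r; first by rewrite /majority3 !expr0n/=; ring.
      by rewrite subr_le0 ler_pdivlMr// mul1r ltW.
    rewrite max_l; first by rewrite /majority3; ring.
    by rewrite subr_ge0 ler_pdivrMr// mul1r.
  rewrite -[2]mulr1; apply: close_lip (Fbar_approx m0 y0) => //.
  apply: majority3_lip; rewrite ?Fbar_ge0 ?Fbar_le1//.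
  - by rewrite le_max lexx orbT.
  - by rewrite ge_max ler01 andbT; lra.
(* The integrand increases from 0 at [v], while the gluing lemma is for nonincreasing ones: it is
   applied to the opposite. *)
rewrite -[avg _]opprK -[(1 - v) ^+ 3]opprK; apply: closeN.
rewrite -mulN1r -avgZ.
have -> : (fun x : R => -1 * (if x < v then 0 else 1 - 3 * (v / x) ^+ 2 + 2 * (v / x) ^+ 3))
  = (fun x : R => if x < v then 0 else - (1 - 3 * (v / x) ^+ 2 + 2 * (v / x) ^+ 3)).
  by apply/funext => x; case: ifP => _; rewrite ?mulr0 ?mulN1r.
have f0 x : v <= x -> 0 <= 1 - 3 * (v / x) ^+ 2 + 2 * (v / x) ^+ 3.
  move=> vx; have x0 : 0 < x by exact: lt_le_trans vx.
  have y0 : 0 <= v / x by rewrite divr_ge0// ltW.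
  have y1 : v / x <= 1 by rewrite ler_pdivrMr// mul1r.
  move: (v / x) y0 y1 => y y0 y1.
  have : 0 <= (1 - y) ^+ 2 * (1 + 2 * y) by rewrite mulr_ge0 ?sqr_ge0//; lra.
  lra.
have vN : v != 0 by rewrite lt0r_neq0.
(* The function x + 3 v^2 / x - v^3 / x^2 has the derivative 1 - 3 (v/x)^2 + 2 (v/x)^3 and the value
   3 v at v. *)
apply: (@riemann_glue _ _ m0 _ (fun=> 0) (fun x => - (1 - 3 * (v / x) ^+ 2 + 2 * (v / x) ^+ 3))
  (fun=> 0) (fun x => - (x + 3 * v ^+ 2 / x - v ^+ 3 / x ^+ 2 - 3 * v))) => //.
- exact: ltW.
- by field.
- by move=> *; lra.
- move=> x y vx x1 vy y1.
  have x0 : 0 < x by exact: lt_le_trans vx.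
  have y0 : 0 < y by exact: lt_le_trans vy.
  rewrite -subr_ge0.
  have -> : - (1 - 3 * (v / x) ^+ 2 + 2 * (v / x) ^+ 3) * (y - x) -
    (- (y + 3 * v ^+ 2 / y - v ^+ 3 / y ^+ 2 - 3 * v) -
     - (x + 3 * v ^+ 2 / x - v ^+ 3 / x ^+ 2 - 3 * v))
    = v ^+ 2 * (y - x) ^+ 2 * (x * y - v * x + 2 * (x * y - v * y)) / (x ^+ 3 * y ^+ 2).
    by field; rewrite !lt0r_neq0.
  apply: divr_ge0; last by rewrite mulr_ge0// exprn_ge0// ltW.
  apply: mulr_ge0; first by apply: mulr_ge0; exact: sqr_ge0.
  have : v * x <= y * x by rewrite ler_wpM2r// ltW.
  have : v * y <= x * y by rewrite ler_wpM2r// ltW.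
  lra.
- by move=> * /=; rewrite oppr_le0 f0.
- by move=> * /=; rewrite oppr_le0 f0.
- rewrite divr1 sub0r opprK.
  have : v ^+ 3 <= v ^+ 2 by rewrite exprS ler_piMl// sqr_ge0.
  have := sqr_ge0 v; lra.
- by rewrite divr1 expr1n divr1; ring.
Qed.

End Projections.

(** * The limit of the differential at the uniform law, and the tilted laws *)

Section Polynomial.
Variable R : realType.

Definition psih (u : R) : R := - (1 / 20) + u / 2 - 9 / 10 * u ^+ 2 + 2 / 5 * u ^+ 3.

(* [\int_0^1 psih^2] *)
Definition sigma2 : R := 29 / 42 / 1000.

Lemma sigma2_gt0 : 0 < sigma2.
Proof. by rewrite /sigma2; lra. Qed.

Lemma psih_bound (u : R) : 0 <= u -> u <= 1 -> `|psih u| <= 2.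
Proof.
move=> u0 u1; rewrite /psih ler_norml.
have h2 : u ^+ 2 <= u by rewrite expr2 ler_piMl.
have h3 : u ^+ 3 <= u ^+ 2 by rewrite exprS ler_piMl// sqr_ge0.
have h4 : 0 <= u ^+ 3 by rewrite exprn_ge0.
by apply/andP; split; lra.
Qed.

Lemma psih_lip (u v : R) : 0 <= u -> u <= 1 -> 0 <= v -> v <= 1 ->
  `|psih u - psih v| <= 4 * `|u - v|.
Proof.
move=> u0 u1 v0 v1.
rewrite (_ : _ - _ = (1 / 2 - 9 / 10 * (u + v) + 2 / 5 * (u ^+ 2 + u * v + v ^+ 2)) * (u - v));
  last by rewrite /psih; ring.
rewrite normrM ler_wpM2r//.
have h2 : u ^+ 2 <= 1 by rewrite expr_le1.
have h3 : v ^+ 2 <= 1 by rewrite expr_le1.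
have h4 : 0 <= u * v by rewrite mulr_ge0.
have h5 : u * v <= 1 by rewrite mulr_ile1.
have h6 := sqr_ge0 u; have h7 := sqr_ge0 v.
by rewrite ler_norml; apply/andP; split; lra.
Qed.

Lemma power_subgradient (k : nat) (x y : R) : 0 <= x -> 0 <= y ->
  k.+1%:R * x ^+ k * y <= y ^+ k.+1 + k%:R * x ^+ k.+1.
Proof.
move=> x0 y0; elim: k => [|k IH]; first by rewrite !expr0; lra.
have h1 : k.+1%:R * x ^+ k * y * y <= (y ^+ k.+1 + k%:R * x ^+ k.+1) * y.
  by rewrite ler_wpM2r.
have h2 : 0 <= k.+1%:R * (x ^+ k * (x - y) ^+ 2).
  by apply: mulr_ge0 => //; apply: mulr_ge0; [exact: exprn_ge0|exact: sqr_ge0].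
move: h1 h2; rewrite -!natr1 !(exprS _ k.+1) !(exprS _ k); lra.
Qed.

Variable m : nat.
Hypothesis m0 : (0 < m)%N.
Local Notation avg := (@avg R m).
Local Notation close := (@close R m).

Lemma avg_power (k : nat) : close 1 (avg (fun t => t ^+ k)) (k.+1%:R^-1).
Proof.
have k0 : 0 < k.+1%:R :> R by rewrite ltr0n.
have := @riemann_convex R m m0 (fun t => t ^+ k) (fun t => t ^+ k.+1 / k.+1%:R).
rewrite !expr1n (expr0n _ k.+1) /= mul0r subr0 mul1r => h.
apply: (close_weaken _ (h _)); first by rewrite gerBl exprn_ge0.
move=> x y x0 _ y0 _; have := power_subgradient k x0 y0.
rewrite -mulrBl ler_pdivlMr// [in _ -> _]exprS [in X in _ -> X]exprS.
rewrite -natr1 (exprS x k); lra.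
Qed.

Definition psim : R := avg psih.

Lemma psim_close : close 2 psim 0.
Proof.
rewrite /psim; have -> : avg psih = - (1 / 20) + (1 / 2) * avg (fun t => t ^+ 1)
  + (- (9 / 10)) * avg (fun t => t ^+ 2) + (2 / 5) * avg (fun t => t ^+ 3).
  rewrite -!avgZ -[- (1 / 20)](avg_cst m0) -!avgD; apply: (eq_avg m0) => x _ _.
  by rewrite /psih; ring.
have h1 := avg_power 1; have h2 := avg_power 2; have h3 := avg_power 3.
move: h1 h2 h3; rewrite /close !ler_norml subr0.
move=> /andP[? ?] /andP[? ?] /andP[? ?]; apply/andP; split; lra.
Qed.

Lemma psih2_close : close 4 (avg (fun t => psih t ^+ 2)) sigma2.
Proof.
have -> : avg (fun t => psih t ^+ 2) = 1 / 400 + (- (1 / 20)) * avg (fun t => t ^+ 1)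
  + (1 / 4 + 9 / 100) * avg (fun t => t ^+ 2) + (- (1 / 25) - 9 / 10) * avg (fun t => t ^+ 3)
  + (81 / 100 + 2 / 5) * avg (fun t => t ^+ 4) + (- (18 / 25)) * avg (fun t => t ^+ 5)
  + 4 / 25 * avg (fun t => t ^+ 6).
  rewrite -!avgZ -[1 / 400](avg_cst m0) -!avgD; apply: (eq_avg m0) => x _ _.
  by rewrite /psih; field.
have h1 := avg_power 1; have h2 := avg_power 2; have h3 := avg_power 3.
have h4 := avg_power 4; have h5 := avg_power 5; have h6 := avg_power 6.
move: h1 h2 h3 h4 h5 h6; rewrite /close !ler_norml /sigma2.
move=> /andP[? ?] /andP[? ?] /andP[? ?] /andP[? ?] /andP[? ?] /andP[? ?].
apply/andP; split; lra.
Qed.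

Definition kerm (a b c d e : 'I_m) : R :=
  ker5 (gridv R a) (gridv R b) (gridv R c) (gridv R d) (gridv R e).

Lemma ler_norm_kerm a b c d e : `|kerm a b c d e| <= 1.
Proof. exact: ler_norm_ker5. Qed.

Lemma med3C12 (a b c : R) : med3 a b c = med3 b a c.
Proof. by rewrite /med3 minC maxC (maxC a b) [in LHS]maxC. Qed.

Lemma med3C23 (a b c : R) : med3 a b c = med3 a c b.
Proof.
have E y : (y < med3 a b c) = (y < med3 a c b).
  by rewrite !lt_med3; case: (y < a); case: (y < b); case: (y < c).
by apply/le_anti; rewrite !leNgt E ltxx -E ltxx.
Qed.

Lemma ker5C12 (a b c d e : R) : ker5 a b c d e = ker5 b a c d e.
Proof. by rewrite /ker5 /kmax /kmed med3C12 minCA. Qed.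

Lemma ker5C23 (a b c d e : R) : ker5 a b c d e = ker5 a c b d e.
Proof. by rewrite /ker5 /kmax /kmed med3C23 (minC b c). Qed.

Lemma form5C12 (q1 q2 q3 q4 q5 : 'I_m -> R) :
  form5 kerm q1 q2 q3 q4 q5 = form5 kerm q2 q1 q3 q4 q5.
Proof.
rewrite /form5 wsum_exchange; apply: eq_wsum => a; apply: eq_wsum => b.
apply: eq_wsum => c; apply: eq_wsum => d; apply: eq_wsum => e; exact: ker5C12.
Qed.

Lemma form5C23 (q1 q2 q3 q4 q5 : 'I_m -> R) :
  form5 kerm q1 q2 q3 q4 q5 = form5 kerm q1 q3 q2 q4 q5.
Proof.
rewrite /form5; apply: eq_wsum => a; rewrite wsum_exchange; apply: eq_wsum => b.
apply: eq_wsum => c; apply: eq_wsum => d; apply: eq_wsum => e; exact: ker5C23.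
Qed.

Local Notation u := (unif R (m := m)).

Let avg4B (f g : R -> R -> R -> R -> R) :
  avg (fun a => avg (fun b => avg (fun c => avg (fun d => f a b c d - g a b c d))))
  = avg (fun a => avg (fun b => avg (fun c => avg (fun d => f a b c d))))
    - avg (fun a => avg (fun b => avg (fun c => avg (fun d => g a b c d)))).
Proof.
rewrite -avgB; apply: (eq_avg m0) => a _ _; rewrite -avgB; apply: (eq_avg m0) => b _ _.
by rewrite -avgB; apply: (eq_avg m0) => c _ _; rewrite -avgB.
Qed.

(** The first three slots are exchangeable, so three projections suffice, and their limits add up to
    5 [psih]. The error is 42 = 3 (3 + 6) + (4 + 5) + (3 + 3). *)
Lemma lin5_projection (r : 'I_m -> R) :
  `|lin5 kerm u r - 5 * wsum r (fun c => psih (gridv R c))| <= norm1 r * (42 / m%:R).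
Proof.
pose q1 v := avg (fun b => avg (fun c => avg (fun d => avg (fun e => ker5 v b c d e)))).
pose q4 v := avg (fun a => avg (fun b => avg (fun c => avg (fun e => ker5 a b c v e)))).
pose q5 v := avg (fun a => avg (fun b => avg (fun c => avg (fun d => ker5 a b c d v)))).
have E1 : form5 kerm r u u u u = wsum r (fun c => q1 (gridv R c)) by [].
have E4 : form5 kerm u u u r u = wsum r (fun c => q4 (gridv R c)).
  rewrite /form5 /q4 [RHS]wsum_exchange; apply: eq_wsum => a.
  rewrite [RHS]wsum_exchange; apply: eq_wsum => b.
  by rewrite [RHS]wsum_exchange.
have E5 : form5 kerm u u u u r = wsum r (fun c => q5 (gridv R c)).
  rewrite /form5 /q5 [RHS]wsum_exchange; apply: eq_wsum => a.
  rewrite [RHS]wsum_exchange; apply: eq_wsum => b.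
  rewrite [RHS]wsum_exchange; apply: eq_wsum => c.
  by rewrite [RHS]wsum_exchange.
have G (P : 'I_m -> R) : lin5 kerm u r - 5 * wsum r P =
   wsum r (fun c => 3 * q1 (gridv R c) + q4 (gridv R c) + q5 (gridv R c) - 5 * P c).
  rewrite wsumBr !wsumDr !wsumZr -E1 -E4 -E5 /lin5.
  by rewrite (form5C23 u u r) (form5C12 u r); ring.
rewrite G.
apply: ler_norm_wsum => c; have v0 := gridv_gt0 R m0 c; have v1 := gridv_le1 R m0 c.
have h1 := proj_max1 m0 (ltW v0) v1; have h2 := proj_med1 m0 v0 v1.
have h3 := proj_max4 m0 (gridv R c); have h4 := proj_med4 m0 v0 v1.
have h5 := proj_max5 m0 (ltW v0) v1; have h6 := proj_med5 m0 v0 v1.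
rewrite /q1 /q4 /q5 /ker5 !avg4B.
move: h1 h2 h3 h4 h5 h6; rewrite /close !ler_norml /psih; move: (gridv R c) => v.
move=> /andP[? ?] /andP[? ?] /andP[? ?] /andP[? ?] /andP[? ?] /andP[? ?].
by apply/andP; split; lra.
Qed.

(** Euler's identity: in the direction of [u] itself the differential is five times the form, while
    [psih] has mean at most 2/m; and (42 + 10) / 5 is below 11. *)
Lemma diag5_unif : close 11 (diag5 kerm u) 0.
Proof.
have := lin5_projection u; rewrite (lin5_diag kerm) norm1_unif// mul1r.
have := psim_close; rewrite /close /psim /avg !ler_norml subr0.
by move=> /andP[? ?] /andP[? ?]; apply/andP; split; lra.
Qed.

(** On the grid the mean of [psih] is only O(1/m); the centring gives the tilts total mass exactly
    1. *)
Definition psic (c : 'I_m) : R := psih (gridv R c) - psim.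

Lemma psim_bound : `|psim| <= 2.
Proof.
apply: wsum_prob_norm; [exact: unif_ge0|exact: unif_sum|] => c.
by apply: psih_bound; rewrite ?gridv_ge0 ?gridv_le1.
Qed.

Lemma psic_bound c : `|psic c| <= 4.
Proof.
rewrite /psic (le_trans (ler_normB _ _))//.
have := psim_bound; have := @psih_bound (gridv R c); rewrite gridv_ge0 ?gridv_le1//.
by move=> /(_ isT isT); lra.
Qed.

Lemma psic_mean : wsum u psic = 0.
Proof. by rewrite /psic wsumBr wsum_cst unif_sum// mul1r subrr. Qed.

Definition sigma2m : R := wsum u (fun c => psic c ^+ 2).

Lemma sigma2mE : sigma2m = avg (fun t => psih t ^+ 2) - psim ^+ 2.
Proof.
have := avgD m (fun t => psih t ^+ 2) (fun t => (- 2 * psim) * psih t).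
rewrite avgZ -/psim => h.
transitivity (avg (fun x => psih x ^+ 2 + -2 * psim * psih x) + psim ^+ 2); last by rewrite h; ring.
rewrite -[psim ^+ 2](avg_cst m0) -avgD; apply: eq_wsum => c.
by rewrite /psic; ring.
Qed.

Lemma sigma2m_close : close 8 sigma2m sigma2.
Proof.
rewrite sigma2mE; have := psih2_close; have := psim_close; have := psim_bound.
rewrite /close !ler_norml subr0 => /andP[a1 a2] /andP[a3 a4] /andP[a5 a6].
have h : psim ^+ 2 <= 4 / m%:R.
  have [h|h] := leP 0 psim.
    have : psim * psim <= 2 * (2 / m%:R) by rewrite ler_pM.
    lra.
  have : - psim * - psim <= 2 * (2 / m%:R) by rewrite ler_pM//; lra.
  lra.
by have h0 := sqr_ge0 psim; apply/andP; split; lra.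
Qed.

(** For t at most 1/8 the bound 4 on [psic] keeps the second factor between 1/2 and 3/2. *)
Definition tilt (t : R) (c : 'I_m) : R := u c * (1 + t * psic c).

Lemma tilt_sum t : \sum_c tilt t c = 1.
Proof.
have -> : \sum_c tilt t c = wsum u (fun c => 1 + t * psic c) by [].
by rewrite wsumDr wsumZr psic_mean wsum_cst unif_sum// mulr0 addr0 mulr1.
Qed.

Lemma tilt_psic t c : 0 <= t -> t <= 1 / 8 -> `|t * psic c| <= 1 / 2.
Proof.
move=> t0 t1; rewrite normrM ger0_norm//.
have := psic_bound c; have := normr_ge0 (psic c) => h0 h4.
by rewrite (le_trans (ler_pM t0 h0 t1 h4))//; lra.
Qed.

Lemma tilt_ge0 t c : 0 <= t -> t <= 1 / 8 -> 0 <= tilt t c.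
Proof.
move=> t0 t1; rewrite mulr_ge0 ?unif_ge0//.
by have := tilt_psic c t0 t1; rewrite ler_norml => /andP[? _]; lra.
Qed.

Lemma tilt_max t c : 0 <= t -> t <= 1 / 8 -> tilt t c <= 2 / m%:R.
Proof.
move=> t0 t1; rewrite /tilt mulrC ler_wpM2r ?unif_ge0//.
by have := tilt_psic c t0 t1; rewrite ler_norml => /andP[_ ?]; lra.
Qed.

Lemma tilt_norm1 t : 0 <= t -> t <= 1 / 8 -> norm1 (tilt t) = 1.
Proof. by move=> t0 t1; apply: norm1_prob (tilt_sum t) => c; exact: tilt_ge0. Qed.

Lemma tilt_dist t : 0 <= t -> norm1 (fun c => tilt t c - u c) <= 4 * t.
Proof.
move=> t0; rewrite (_ : (fun c => _) = (fun c => u c * (t * psic c))); last first.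
  by apply/funext => c; rewrite /tilt; ring.
apply: (@le_trans _ _ (wsum u (fun=> 4 * t))); last by rewrite wsum_cst unif_sum// mul1r.
apply: ler_sum => c _; rewrite normrM ger0_norm ?unif_ge0// ler_wpM2l ?unif_ge0//.
by rewrite normrM ger0_norm// mulrC ler_wpM2r// psic_bound.
Qed.

Lemma lin5_tilt t : 0 <= t -> t <= 1 / 8 ->
  5 * t * sigma2m - 21 / m%:R <= lin5 kerm u (fun c => tilt t c - u c).
Proof.
move=> t0 t1; have := lin5_projection (fun c => tilt t c - u c).
have -> : wsum (fun c => tilt t c - u c) (fun c => psih (gridv R c)) = t * sigma2m.
  transitivity (t * (wsum u (fun c => psic c ^+ 2 + psim * psic c))); last first.
    by rewrite wsumDr wsumZr psic_mean mulr0 addr0.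
  rewrite -wsumZr; apply: eq_bigr => c _; rewrite /tilt /psic; ring.
have := tilt_dist t0; have m1 : 0 <= m%:R^-1 :> R by rewrite invr_ge0.
move=> h; have : norm1 (fun c => tilt t c - u c) * (42 / m%:R) <= 1 / 2 * (42 / m%:R).
  by rewrite ler_wpM2r ?mulr_ge0//; lra.
by move=> h2; rewrite ler_norml => /andP[h3 h4]; lra.
Qed.

(** The quadratic loss is the Taylor remainder 10 (4 t)^2. The 40/m covers 21/m from the
    differential, 11/m from the value at the uniform law and 5/m from the passage of [sigma2m] to
    [sigma2]. *)
Lemma diag5_tilt t : 0 <= t -> t <= 1 / 8 ->
  5 * t * sigma2 - 160 * t ^+ 2 - 40 / m%:R <= diag5 kerm (tilt t).
Proof.
move=> t0 t1; have := lin5_tilt t0 t1.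
have := diag5_taylor ler_norm_kerm (norm1_unif R m0) (tilt_norm1 t0 t1).
have : norm1 (fun c => tilt t c - u c) ^+ 2 <= 16 * t ^+ 2.
  rewrite (_ : 16 * t ^+ 2 = (4 * t) ^+ 2); last by ring.
  by rewrite lerXn2r ?nnegrE ?norm1_ge0 ?mulr_ge0// tilt_dist.
have := diag5_unif; have := sigma2m_close; rewrite /close !ler_norml subr0.
have m1 : 0 <= m%:R^-1 :> R by rewrite invr_ge0.
move=> /andP[h1 h2] /andP[h3 h4] h5 /andP[h6 h7] h8.
have : 5 * t * (sigma2 - sigma2m) <= 5 * (1 / 8) * (8 / m%:R).
  have [s0|s0] := leP 0 (sigma2 - sigma2m); first by rewrite ler_pM//; lra.
  apply: (@le_trans _ _ 0); last by rewrite !mulr_ge0//; lra.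
  by rewrite mulr_ge0_le0//; lra.
lra.
Qed.

End Polynomial.

(** * Relative entropy *)

Lemma ln_taylor3 (R : realType) (y : R) : -1 < y ->
  ln (1 + y) <= y - y ^+ 2 / 2 + y ^+ 3 / 3.
Proof.
move=> y1.
(* [f (1 + y) - f 1] is the gap between the two sides, and the derivative (z - 1)^3 / z puts the
   minimum of [f] at 1. *)
pose f (z : R) := 3 * z - 3 / 2 * z ^+ 2 + 1 / 3 * z ^+ 3 - ln z.
have df (z : R) : 0 < z -> is_derive z (1 : R) f ((z - 1) ^+ 3 / z).
  move=> z0; have dl := is_derive1_ln z0.
  rewrite /f; apply: is_derive_eq.
  rewrite /GRing.scale /=.
  by field; rewrite lt0r_neq0.
have fc a b : 0 < a -> {within `[a, b], continuous f}.
  move=> a0; apply: derivable_within_continuous => z; rewrite in_itv/= => /andP[az _].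
  have dz := df z (lt_le_trans a0 az); exact: ex_derive.
suff : f 1 <= f (1 + y) by rewrite /f ln1; lra.
have dv (z : R) : 0 < z -> derivable f z 1.
  by move=> z0; have dz := df z z0; exact: ex_derive.
have de (z : R) : 0 < z -> derive1 f z = (z - 1) ^+ 3 / z.
  by move=> z0; have dz := df z z0; rewrite derive1E; exact: derive_val.
clearbody f.
have [y0|y0] := leP 0 y.
  have h1 z : z \in `]1, (1 + y)[ -> derivable f z 1.
    by rewrite in_itv/= => /andP[z1 _]; apply: dv; lra.
  have h2 z : z \in `]1, (1 + y)[ -> 0 <= derive1 f z.
    rewrite in_itv/= => /andP[z1 _]; have z0 : 0 < z by lra.
    by rewrite de// divr_ge0 ?(ltW z0)// exprn_ge0// subr_ge0 ltW.
  by apply: (ger0_derive1_ndecr h1 h2 (fc _ _ _)); lra.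
have h1 z : z \in `](1 + y), 1[ -> derivable f z 1.
  by rewrite in_itv/= => /andP[z1 _]; apply: dv; lra.
have h2 z : z \in `](1 + y), 1[ -> derive1 f z <= 0.
  rewrite in_itv/= => /andP[z1 z2]; have z0 : 0 < z by lra.
  rewrite de// mulr_le0_ge0 ?invr_ge0 ?(ltW z0)// -oppr_ge0.
  rewrite (_ : - _ = (1 - z) ^+ 3); last by ring.
  by rewrite exprn_ge0// subr_ge0 ltW.
by apply: (ler0_derive1_nincr h1 h2 (fc _ _ _)); lra.
Qed.

Lemma xlnx_upper (R : realType) (y : R) : `|y| <= 1 / 2 ->
  (1 + y) * ln (1 + y) <= y + y ^+ 2 / 2 + `|y| ^+ 3.
Proof.
rewrite ler_norml => /andP[y1 y2].
have h1 : -1 < y by lra.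
have h0 : 0 < 1 + y by lra.
apply: (le_trans (ler_wpM2l (ltW h0) (ln_taylor3 h1))).
have [y0|y0] := leP 0 y.
  rewrite ger0_norm//; have : 0 <= y ^+ 3 * (1 / 2 - y).
    by apply: mulr_ge0; [exact: exprn_ge0|lra].
  have := exprn_ge0 3 y0; lra.
rewrite ltr0_norm//; have z0 : 0 <= - y by lra.
have : 0 <= (- y) ^+ 3 * (1 / 2 + y) by apply: mulr_ge0; [exact: exprn_ge0|lra].
have := exprn_ge0 3 z0; lra.
Qed.

(** The upper bound on the logarithm, applied to the inverse of 1 + y, becomes a lower bound. *)
Lemma xlnx_lower (R : realType) (y : R) : - (1 / 2) <= y ->
  y + y ^+ 2 / 2 - 3 * `|y| ^+ 3 <= (1 + y) * ln (1 + y).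
Proof.
move=> y1; have h0 : 0 < 1 + y by lra.
pose z := - y / (1 + y).
have zE : 1 + z = (1 + y)^-1 by rewrite /z; field; rewrite lt0r_neq0.
have zp : 0 < 1 + z by rewrite zE invr_gt0.
have z1 : -1 < z by lra.
have := ler_wpM2l (ltW h0) (ln_taylor3 z1).
rewrite zE lnV ?posrE// mulrN => h.
have -> : (1 + y) * ln (1 + y) = - - ((1 + y) * ln (1 + y)) by ring.
rewrite -lerN2 in h; apply: le_trans h.
pose w := (1 + y)^-1.
have w0 : 0 < w by rewrite invr_gt0.
have w2 : w <= 2 by rewrite /w -[leRHS]invrK lef_pV2 ?posrE ?invr_gt0//; lra.
have -> : - ((1 + y) * (z - z ^+ 2 / 2 + z ^+ 3 / 3))
    = y + y ^+ 2 / 2 + y ^+ 3 * (w ^+ 2 / 3 - w / 2).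
  by rewrite /z /w; field; rewrite lt0r_neq0.
have : `|y ^+ 3 * (w ^+ 2 / 3 - w / 2)| <= `|y| ^+ 3 * 3.
  rewrite normrM normrX ler_wpM2l ?exprn_ge0//.
  have : w * w <= 2 * 2 by rewrite ler_pM// ltW.
  have := sqr_ge0 w.
  by rewrite ler_norml => ? ?; apply/andP; split; lra.
rewrite ler_norml => /andP[? ?]; lra.
Qed.

Section Entropy.
Variables (R : realType) (m : nat).
Hypothesis m0 : (0 < m)%N.
Implicit Types q r : 'I_m -> R.

(* Kullback-Leibler divergence with respect to the uniform law; the convention [0 * ln 0 = 0] holds because [ln 0 = 0]. *)
Definition entu q : R := \sum_c q c * ln (m%:R * q c).

Definition prob q := (forall c, 0 <= q c) /\ \sum_c q c = 1.

Let mR : 0 < m%:R :> R. Proof. by rewrite ltr0n. Qed.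

Lemma log_sum_ineq (x y : R) : 0 <= x -> 0 <= y -> (0 < x -> 0 < y) ->
  x * (ln y - ln x) <= y - x.
Proof.
move=> x0 y0 xy; move: x0; rewrite le_eqVlt => /predU1P[<-|x0].
  by rewrite mul0r subr0.
have {}y0 := xy x0.
rewrite -ln_div ?posrE//.
have h : ln (y / x) <= y / x - 1.
  have yx := divr_gt0 y0 x0; have := @le_ln1Dx R (y / x - 1).
  by rewrite [1 + _]addrC subrK; apply; lra.
have := ler_wpM2l (ltW x0) h.
by rewrite mulrBr mulr1 mulrCA divff ?mulr1// lt0r_neq0.
Qed.

(** The difference of the two sides is the relative entropy of [q] with respect to the uniform law
    reweighted by [expR (phi c) / Z]. *)
Lemma gibbs q (phi : 'I_m -> R) : prob q ->
  wsum q phi - ln (wsum (unif R (m := m)) (fun c => expR (phi c))) <= entu q.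
Proof.
move=> [q0 q1]; set Z := wsum (unif R (m := m)) _.
have Z0 : 0 < Z.
  rewrite /Z /wsum; have [c _] : exists c : 'I_m, True by exists (Ordinal m0).
  rewrite (bigD1 c)//=; apply: ltr_wpDr.
    by apply: sumr_ge0 => i _; apply: mulr_ge0; [exact: unif_ge0|exact: expR_ge0].
  by rewrite mulr_gt0 ?expR_gt0// /unif invr_gt0.
have h c : q c * (phi c - ln Z - ln (m%:R * q c)) <= (m%:R^-1 * expR (phi c)) / Z - q c.
  have [e|/negbTE ne] := eqVneq (q c) 0.
    rewrite e mul0r subr0; apply: divr_ge0 (ltW Z0).
    by apply: mulr_ge0; rewrite ?expR_ge0// invr_ge0 ltW.
  have qc : 0 < q c by rewrite lt0r ne q0.
  have := @log_sum_ineq (q c) ((m%:R^-1 * expR (phi c)) / Z) (q0 c).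
  have p0 : 0 < m%:R^-1 * expR (phi c) / Z.
    by rewrite divr_gt0// mulr_gt0 ?invr_gt0 ?expR_gt0.
  move=> /(_ (ltW p0) (fun=> p0)).
  have E1 : ln (m%:R^-1 * expR (phi c) / Z) = - ln m%:R + phi c - ln Z.
    rewrite ln_div ?posrE//; last by rewrite mulr_gt0 ?invr_gt0 ?expR_gt0.
    by rewrite lnM ?posrE ?invr_gt0 ?expR_gt0// expRK lnV ?posrE.
  rewrite E1 (@lnM _ m%:R) ?posrE//.
  by congr (_ * _ <= _); ring.
have : \sum_c q c * (phi c - ln Z - ln (m%:R * q c))
     <= \sum_c ((m%:R^-1 * expR (phi c)) / Z - q c) by apply: ler_sum => c _; exact: h.
rewrite sumrB q1 -mulr_suml -[\sum_c _ * expR _]/Z divff ?lt0r_neq0// subrr.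
have -> : \sum_c q c * (phi c - ln Z - ln (m%:R * q c)) = wsum q phi - ln Z - entu q.
  have EZ : \sum_c q c * ln Z = ln Z by rewrite -mulr_suml q1 mul1r.
  rewrite -[in RHS]EZ /wsum /entu -!sumrB; apply: eq_bigr => c _; ring.
by rewrite subr_le0.
Qed.

Lemma entu_ge0 q : prob q -> 0 <= entu q.
Proof.
move=> pq; have := @gibbs q (fun=> 0) pq.
by rewrite !wsum_cst unif_sum// expR0 mulr0 mulr1 ln1 subrr.
Qed.

Lemma entu_cross q r : prob q -> prob r -> (forall c, 0 < q c -> 0 < r c) ->
  \sum_c q c * ln (m%:R * r c) <= entu q.
Proof.
move=> [q0 q1] [r0 r1] qr; rewrite -subr_le0 /entu -sumrB.
apply: (@le_trans _ _ (\sum_c (r c - q c))); last by rewrite sumrB q1 r1 subrr.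
apply: ler_sum => c _; have := log_sum_ineq (q0 c) (r0 c) (@qr c).
have [e|/negbTE ne] := eqVneq (q c) 0; first by rewrite e !mul0r subrr.
have qc : 0 < q c by rewrite lt0r ne q0.
have rc := qr _ qc.
rewrite !lnM ?posrE// -mulrBr; congr (_ * _ <= _); ring.
Qed.

(** The entropy of the mixture [s] is the mixture of the cross terms of [q] and of [r] with [s], and
    [entu_cross] bounds each of these. *)
Lemma entu_convex q r (t : R) : prob q -> prob r -> 0 < t -> t < 1 ->
  entu (fun c => (1 - t) * q c + t * r c) <= (1 - t) * entu q + t * entu r.
Proof.
move=> pq pr t0 t1; set s := fun c => _.
have t1' : 0 < 1 - t by rewrite subr_gt0.
have ps : prob s.
  split; last by rewrite big_split -!mulr_sumr pq.2 pr.2 /=; ring.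
  by move=> c; rewrite addr_ge0 ?mulr_ge0 ?pq.1 ?pr.1 ?ltW.
have -> : entu s = (1 - t) * (\sum_c q c * ln (m%:R * s c)) + t * (\sum_c r c * ln (m%:R * s c)).
  by rewrite !mulr_sumr -big_split; apply: eq_bigr => c _; rewrite /s /=; ring.
apply: lerD; (rewrite ler_wpM2l ?(ltW t0) ?(ltW t1')//; apply: entu_cross => // c h).
  by rewrite /s ltr_pwDl ?mulr_gt0// mulr_ge0 ?pr.1// ltW.
by rewrite /s ltr_wpDl ?mulr_gt0// mulr_ge0 ?pq.1// ltW.
Qed.

Local Notation u := (unif R (m := m)).

Lemma expR_taylor3 (t : R) : t <= 1 -> expR t <= 1 + t + t ^+ 2 / 2 + `|t| ^+ 3.
Proof.
move=> t1.
(* The cubic coefficient is [b = 1] to the right of 0 and [b = 0] to its left; in both cases [f b]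
   has its least value, 1, at 0 on the range considered. *)
pose f (b z : R) := expR (- z) * (1 + z + 1 / 2 * z ^+ 2 + b * z ^+ 3).
have df (b z : R) : is_derive z (1 : R) (f b)
    (expR (- z) * ((3 * b - 1 / 2) * z ^+ 2 - b * z ^+ 3)).
  rewrite /f; apply: is_derive_eq; rewrite /GRing.scale /=; by field.
have fc k x y : {within `[x, y], continuous (f k)}.
  by apply: derivable_within_continuous => z _; exact: ex_derive.
have de (b z : R) : derive1 (f b) z = expR (- z) * ((3 * b - 1 / 2) * z ^+ 2 - b * z ^+ 3).
  by rewrite derive1E; exact: derive_val.
have dv (b z : R) : derivable (f b) z 1 by exact: ex_derive.
have f0 b : f b 0 = 1 by rewrite /f oppr0 expR0; ring.
suff [b bt] : exists b, b * t ^+ 3 <= `|t| ^+ 3 /\ f b 0 <= f b t.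
  move: bt => [bt]; rewrite f0 /f expRN => h.
  have := ler_wpM2l (expR_ge0 t) h; rewrite mulr1 mulVKf ?lt0r_neq0 ?expR_gt0//; lra.
clearbody f; have [t0|t0] := leP 0 t.
  exists 1; split; first by rewrite ger0_norm// mul1r.
  have h2 z : z \in `]0, t[ -> 0 <= derive1 (f 1) z.
    rewrite in_itv/= => /andP[z1 z2]; rewrite de mulr_ge0 ?expR_ge0//.
    rewrite (_ : _ - _ = z ^+ 2 * (5 / 2 - z)); last by field.
    by rewrite mulr_ge0 ?sqr_ge0//; lra.
  by apply: (ger0_derive1_ndecr (fun z _ => dv 1 z) h2 (fc _ _ _)).
exists 0; split; first by rewrite mul0r exprn_ge0.
have h2 z : z \in `]t, 0[ -> derive1 (f 0) z <= 0.
  rewrite in_itv/= => /andP[z1 z2]; rewrite de mulr_ge0_le0 ?expR_ge0//.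
  by have := sqr_ge0 z; lra.
by apply: (ler0_derive1_nincr (fun z _ => dv 0 z) h2 (fc _ _ _)); rewrite // ltW.
Qed.

Lemma expR_quadratic (t : R) : `|t| <= 1 / 2 -> expR t <= 1 + t + t ^+ 2.
Proof.
move=> t1; have t2 : t <= 1 by have := ler_norm t; lra.
apply: (le_trans (expR_taylor3 t2)).
have : `|t| ^+ 2 * `|t| <= `|t| ^+ 2 * (1 / 2) by rewrite ler_wpM2l// exprn_ge0.
by rewrite -exprSr real_normK ?num_real//; lra.
Qed.

(** The Gibbs inequality is tested on d/4 times the sign of [q - u]. As d is at most 2, the exponent
    stays below 1/2, where the quadratic bound on exp holds; the outcome 3 d^2 / 16 exceeds d^2 /
    8. *)
Lemma pinsker q : prob q -> norm1 (fun c => q c - u c) ^+ 2 / 8 <= entu q.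
Proof.
move=> pq; set d := norm1 _.
have d0 : 0 <= d by exact: norm1_ge0.
have d2 : d <= 2.
  have : d <= norm1 q + norm1 u.
    by rewrite /d /norm1 -big_split; apply: ler_sum => c _; exact: ler_normB.
  by rewrite norm1_unif// (norm1_prob pq.1 pq.2); lra.
pose s c := Num.sg (q c - u c).
have ss c : `|s c| <= 1 by rewrite /s normr_sg; case: eqP.
have sd : wsum q s - wsum u s = d.
  by rewrite -wsumBl; apply: eq_bigr => c _; rewrite /s [RHS]normrEsg mulrC.
have us : `|wsum u s| <= 1 by apply: wsum_prob_norm => //; [exact: unif_ge0|exact: unif_sum].
have := gibbs (fun c => d / 4 * s c) pq; rewrite wsumZr.
set Z := wsum u _ => h; apply: le_trans h.
have Zle : Z <= 1 + (d / 4 * wsum u s + d ^+ 2 / 16).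
  have -> : 1 + (d / 4 * wsum u s + d ^+ 2 / 16)
    = wsum u (fun c => 1 + (d / 4 * s c + d ^+ 2 / 16)).
    by rewrite !wsumDr wsumZr !wsum_cst unif_sum// !mul1r.
  apply: ler_wsum => [c|c]; first exact: unif_ge0.
  have hs : `|d / 4 * s c| <= 1 / 2.
    rewrite normrM ger0_norm ?divr_ge0//.
    have := ler_wpM2l (divr_ge0 d0 (ler0n _ 4)) (ss c); lra.
  apply: (le_trans (expR_quadratic hs)); rewrite -addrA lerD2l lerD2l.
  have : s c ^+ 2 <= 1 by rewrite -real_normK ?num_real// expr_le1.
  move=> /(ler_wpM2l (sqr_ge0 (d / 4))); lra.
have Z0 : 0 < Z.
  apply: lt_le_trans (_ : wsum u (fun=> expR (- 1)) <= _).
    by rewrite wsum_cst unif_sum// mul1r expR_gt0.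
  apply: ler_wsum => c; first exact: unif_ge0.
  rewrite ler_expR; have := ss c; rewrite ler_norml => /andP[h _].
  have := ler_wpM2l (divr_ge0 d0 (ler0n _ 4)) h; lra.
have : ln Z <= Z - 1.
  by have := @le_ln1Dx R (Z - 1); rewrite [1 + _]addrC subrK; apply; lra.
by have := congr1 (fun x => d / 4 * x) sd => /=; have := sqr_ge0 d; lra.
Qed.

(** The Gibbs inequality with weight [ln m] on the single cell [c], whose normalization is at most
    2. *)
Lemma entu_max q c (delta : R) : prob q -> delta <= q c ->
  delta * ln m%:R - ln 2 <= entu q.
Proof.
move=> pq dq; pose phi (a : 'I_m) : R := (a == c)%:R * ln m%:R.
have lm : 0 <= ln (m%:R : R) by rewrite ln_ge0// ler1n.
have := gibbs phi pq.
have -> : wsum q phi = q c * ln m%:R.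
  rewrite /wsum (bigD1 c)//= /phi eqxx mul1r big1 ?addr0// => a /negbTE ->.
  by rewrite mul0r mulr0.
set Z := wsum u _.
have Zle : Z <= 2.
  rewrite /Z /wsum (bigD1 c)//= /phi eqxx mul1r lnK ?posrE//.
  rewrite /unif mulVf ?lt0r_neq0//.
  have -> : \sum_(i < m | i != c) m%:R^-1 * expR ((i == c)%:R * ln m%:R)
    = \sum_(i < m | i != c) (u i : R).
    by apply: eq_bigr => i /negbTE ->; rewrite mul0r expR0 mulr1.
  have := unif_sum R m0; rewrite (bigD1 c)//=; have := unif_ge0 R m0 c; lra.
have Z0 : 0 < Z.
  apply: lt_le_trans (_ : wsum u (fun=> 1) <= _).
    by rewrite wsum_cst unif_sum// mul1r.
  apply: ler_wsum => a; first exact: unif_ge0.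
  by rewrite -expR0 ler_expR /phi mulr_ge0.
have : ln Z <= ln 2 by rewrite ler_ln ?posrE.
have := ler_wpM2r lm dq; lra.
Qed.

Lemma psic_cube (c : 'I_m) (t : R) : 0 <= t -> `|t * psic R c| ^+ 3 <= 64 * t ^+ 3.
Proof.
move=> t0; rewrite (_ : 64 * t ^+ 3 = (4 * t) ^+ 3); last by ring.
rewrite lerXn2r ?nnegrE ?mulr_ge0//.
by rewrite normrM ger0_norm// mulrC ler_wpM2r//; exact: psic_bound.
Qed.

Lemma entu_psic_lower q (t : R) : prob q -> 0 <= t -> t <= 1 / 8 ->
  t * wsum q (@psic R m) - t ^+ 2 * sigma2m R m / 2 - 64 * t ^+ 3 <= entu q.
Proof.
move=> pq t0 t1; have := gibbs (fun c => t * psic R c) pq; rewrite wsumZr.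
set Z := wsum u _ => h; apply: le_trans h.
have Zle : Z <= 1 + (t ^+ 2 * sigma2m R m / 2 + 64 * t ^+ 3).
  have -> : 1 + (t ^+ 2 * sigma2m R m / 2 + 64 * t ^+ 3) =
     wsum u (fun c => 1 + 64 * t ^+ 3 + (t * psic R c + t ^+ 2 / 2 * psic R c ^+ 2)).
    by rewrite wsumDr wsum_cst unif_sum// wsumDr !wsumZr psic_mean// /sigma2m; ring.
  apply: ler_wsum => c; first exact: unif_ge0.
  have ht : t * psic R c <= 1 by have := tilt_psic m0 c t0 t1; have := ler_norm (t * psic R c); lra.
  apply: (le_trans (expR_taylor3 ht)); have := psic_cube c t0; lra.
have Z0 : 0 < Z.
  apply: lt_le_trans (_ : wsum u (fun=> expR (- 1)) <= _).
    by rewrite wsum_cst unif_sum// mul1r expR_gt0.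
  apply: ler_wsum => c; first exact: unif_ge0.
  rewrite ler_expR; have := tilt_psic m0 c t0 t1; rewrite ler_norml => /andP[? _]; lra.
have : ln Z <= Z - 1.
  by have := @le_ln1Dx R (Z - 1); rewrite [1 + _]addrC subrK; apply; lra.
lra.
Qed.

Lemma entu_tilt (t : R) : 0 <= t -> t <= 1 / 8 ->
  entu (tilt t) <= t ^+ 2 * sigma2m R m / 2 + 64 * t ^+ 3.
Proof.
move=> t0 t1.
have -> : t ^+ 2 * sigma2m R m / 2 + 64 * t ^+ 3 =
     wsum u (fun c => 64 * t ^+ 3 + (t * psic R c + t ^+ 2 / 2 * psic R c ^+ 2)).
  by rewrite wsumDr wsum_cst unif_sum// wsumDr !wsumZr psic_mean// /sigma2m; ring.
apply: ler_sum => c _; rewrite /tilt -mulrA ler_wpM2l ?unif_ge0//.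
rewrite /unif mulrA divff ?lt0r_neq0// mul1r.
apply: (le_trans (xlnx_upper (tilt_psic m0 c t0 t1))).
have := psic_cube c t0; lra.
Qed.

End Entropy.

(** * The rate function *)

Section Rate.
Variable R : realType.

Lemma big_nat_exists (x : R) : exists m : nat, (0 < m)%N /\ x < m%:R.
Proof.
exists (Num.truncn `|x|).+1; split => //.
by rewrite (le_lt_trans (ler_norm x))// truncnS_gt.
Qed.

(* The margin [115 * delta] covers the errors made by rounding the sample, by replacing [q] with a nearby type and, as [m^-1 <= delta], by the expansion of the form on the grid. *)
Definition admissible (m : nat) (q : 'I_m -> R) (delta eps : R) :=
  [/\ prob q, forall c, q c <= delta & eps + 115 * delta < diag5 (@kerm R m) q].

(** The grid varies together with the law, so that the infimum over finite alphabets stands for one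
    over laws on the half line. *)
Definition rateset (eps : R) : set R :=
  [set x | exists (m : nat) (q : 'I_m -> R) (delta : R),
     [/\ (0 < m)%N, admissible q delta eps & x = entu q]].

Definition rate (eps : R) : R := inf (rateset eps).

Lemma rateset_lbound eps : lbound (rateset eps) 0.
Proof. by move=> x [m [q [delta [m0 [pq _ _] ->]]]]; exact: entu_ge0. Qed.

Lemma rate_le eps m (q : 'I_m -> R) delta : (0 < m)%N ->
  admissible q delta eps -> rate eps <= entu q.
Proof.
move=> m0 aq; apply: ge_inf; first by exists 0; exact: rateset_lbound.
by exists m, q, delta.
Qed.

Lemma rate_ge eps x : rateset eps !=set0 -> lbound (rateset eps) x -> x <= rate eps.
Proof. by move=> h1 h2; exact: lb_le_inf. Qed.

Section FixedGrid.
Variable m : nat.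
Hypothesis m0 : (0 < m)%N.
Local Notation u := (unif R (m := m)).
Local Notation T := (diag5 (@kerm R m)).
Implicit Type q : 'I_m -> R.

Let mR : 0 < m%:R :> R. Proof. by rewrite ltr0n. Qed.
Let mV : 0 <= m%:R^-1 :> R. Proof. by rewrite invr_ge0. Qed.

Lemma prob_norm1 q : prob q -> norm1 q = 1.
Proof. by case; exact: norm1_prob. Qed.

Lemma prob_max_ge q delta : prob q -> (forall c, q c <= delta) -> m%:R^-1 <= delta.
Proof.
move=> [q0 q1] qd; rewrite -[m%:R^-1]mulr1 ler_pdivrMl//.
have : \sum_c q c <= \sum_(c < m) delta by apply: ler_sum => c _; exact: qd.
by rewrite q1 sumr_const card_ord -[_ *+ _]mulr_natl.
Qed.

Lemma wsum_psic q : prob q ->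
  wsum q (@psic R m) = wsum (fun c => q c - u c) (fun c => psih (gridv R c)).
Proof.
by move=> [_ q1]; rewrite wsumBl wsumBr wsum_cst q1 mul1r.
Qed.

(** The quadratic remainder 10 d^2 is paid by the entropy through [pinsker], whence 80; the 95 is 42
    * 2 + 11. *)
Lemma diag5_upper q : prob q ->
  T q <= 5 * wsum q (@psic R m) + 95 / m%:R + 80 * entu q.
Proof.
move=> pq; have q1 := prob_norm1 pq; have u1 := norm1_unif R m0.
have := diag5_taylor (@ler_norm_kerm R m) u1 q1.
have := lin5_projection m0 (fun c => q c - u c); rewrite -wsum_psic//.
have := diag5_unif R m0; rewrite /close subr0.
have := pinsker m0 pq; set d := norm1 _ => hp.
have d2 : d <= 2.
  have : d <= norm1 q + norm1 u.
    by rewrite /d /norm1 -big_split; apply: ler_sum => c _; exact: ler_normB.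
  by rewrite u1 q1; lra.
have := ler_wpM2r mV d2 => h0.
by rewrite !ler_norml => /andP[h1 h2] /andP[h3 h4] /andP[h5 h6]; lra.
Qed.

(** The margin 115 is 95, lost in [diag5_upper], plus 20, which pays for replacing [sigma2m] by
    [sigma2]. The 80 [entu q] of that bound, multiplied by t / 5, becomes the factor 1 + 16 t. *)
Lemma admissible_lower q delta (t : R) : 0 <= t -> t <= 1 / 8 ->
  admissible q delta (5 * t * sigma2 R) ->
  t ^+ 2 * sigma2 R / 2 - 64 * t ^+ 3 <= entu q * (1 + 16 * t).
Proof.
move=> t0 t1 [pq qd Tq]; have hm := prob_max_ge pq qd.
have := diag5_upper pq; have := entu_psic_lower m0 pq t0 t1.
have := sigma2m_close R m0; rewrite /close ler_norml => /andP[_ h1] h2 h3.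
have h4 : t ^+ 2 * sigma2m R m <= t ^+ 2 * (sigma2 R + 8 / m%:R).
  by rewrite ler_wpM2l ?sqr_ge0//; lra.
have h5 : 5 * t * sigma2 R + 20 / m%:R - 80 * entu q <= 5 * wsum q (@psic R m) by lra.
have h6 := ler_wpM2l t0 h5.
have h7 : 0 <= t * (1 - t) * m%:R^-1 by rewrite mulr_ge0// mulr_ge0//; lra.
lra.
Qed.

End FixedGrid.

Lemma rate_upper (t eps : R) : 0 <= t -> t <= 1 / 8 ->
  eps < 5 * t * sigma2 R - 160 * t ^+ 2 ->
  rateset eps !=set0 /\ rate eps <= t ^+ 2 * sigma2 R / 2 + 64 * t ^+ 3.
Proof.
move=> t0 t1 ht.
have key (e : R) : 0 < e -> exists m (q : 'I_m -> R) (delta : R),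
  [/\ (0 < m)%N, admissible q delta eps & entu q <= t ^+ 2 * sigma2 R / 2 + 64 * t ^+ 3 + e].
  move=> e0; set g := 5 * t * sigma2 R - 160 * t ^+ 2 - eps.
  have g0 : 0 < g by rewrite /g; lra.
  (* 270 = 115 * 2 + 40: the cells of the tilt weigh at most 2/m, and [diag5_tilt] loses 40/m. *)
  have [m [m0 hm]] := big_nat_exists (270 / g + 1 / e).
  have mR : 0 < m%:R :> R by rewrite ltr0n.
  have ge0 : 0 < 270 / g by apply: (divr_gt0 _ g0); lra.
  have ee0 : 0 < 1 / e by rewrite divr_gt0.
  have h1 : 270 / m%:R < g.
    by rewrite (ltr_pdivrMr _ _ mR) mulrC -(ltr_pdivrMr _ _ g0); lra.
  have h2 : 1 / m%:R < e.
    by rewrite (ltr_pdivrMr _ _ mR) mulrC -(ltr_pdivrMr _ _ e0); lra.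
  exists m, (@tilt R m t), (2 / m%:R); split => //.
    split.
    - by split; [move=> c; exact: tilt_ge0|exact: tilt_sum].
    - by move=> c; exact: tilt_max.
    - by have := diag5_tilt m0 t0 t1; rewrite /g in h1 *; lra.
  apply: (le_trans (entu_tilt m0 t0 t1)).
  have := sigma2m_close R m0; rewrite /close ler_norml => /andP[_ h3].
  have h4 : t ^+ 2 * (sigma2m R m) <= t ^+ 2 * (sigma2 R + 8 / m%:R).
    by rewrite ler_wpM2l ?sqr_ge0//; lra.
  have h5 : t ^+ 2 * m%:R^-1 <= 1 / 8 * m%:R^-1.
    rewrite ler_wpM2r ?invr_ge0 ?ltW//; have : t * t <= 1 / 8 * (1 / 8) by rewrite ler_pM.
    lra.
  lra.
split.
  by have [m [q [delta [m0 aq _]]]] := key 1 ltr01; exists (entu q), m, q, delta.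
apply/ler_addgt0Pr => e e0; have [m [q [delta [m0 aq h]]]] := key e e0.
exact: le_trans (rate_le m0 aq) h.
Qed.

(** From the uniform law towards the tilt of parameter 1/8 the form has slope 5 [s0]. At distance
    [rho0] this slope has lost at most [s0], because 45 = 20 + 5 * 5 by the Lipschitz bounds on
    [lin5] and [diag5]. *)
Definition s0 : R := sigma2 R / 8.
Definition rho0 : R := s0 / 45.

Lemma s0_gt0 : 0 < s0. Proof. by rewrite /s0; have := sigma2_gt0 R; lra. Qed.

(* Moving a law slightly towards a tilt increases the form at linear speed: this absorbs the margin in [admissible], so that the infimum over the laws with a margin is not larger than the one without. *)
Lemma diag5_push_tilt m (q : 'I_m -> R) (eta : R) : (0 < m)%N ->
  prob q -> norm1 (fun c => q c - unif R c) <= rho0 ->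
  0 <= eta -> eta <= s0 / 40 -> 136 / m%:R <= s0 ->
  diag5 (@kerm R m) q + 2 * s0 * eta <=
  diag5 (@kerm R m) (fun c => (1 - eta) * q c + eta * tilt (1 / 8) c).
Proof.
move=> m0 pq qrho eta0 eta1 hm; set d := norm1 _ in qrho.
have t0 : 0 <= 1 / 8 :> R by lra.
have t1 : 1 / 8 <= 1 / 8 :> R by [].
set r := tilt (1 / 8); set s := fun c => _.
have q1 := prob_norm1 pq; have u1 := norm1_unif R m0.
have r1 : norm1 r = 1 by exact: tilt_norm1.
have es0 := s0_gt0.
have eta2 : eta <= 1 by apply: (le_trans eta1); rewrite /s0 /sigma2; lra.
have s1 : norm1 s = 1.
  apply: norm1_prob.
    by move=> c; rewrite addr_ge0// mulr_ge0 ?pq.1 ?tilt_ge0//; lra.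
  have r2 : \sum_c r c = 1 by exact: tilt_sum.
  transitivity ((1 - eta) * (\sum_c q c) + eta * \sum_c r c); last by rewrite pq.2 r2; ring.
  by rewrite !mulr_sumr -big_split.
have sq : (fun c => s c - q c) = (fun c => eta * (r c - q c)).
  by apply/funext => c; rewrite /s; ring.
have dsq : norm1 (fun c => s c - q c) <= eta * 2.
  have -> : norm1 (fun c => s c - q c) = eta * norm1 (fun c => r c - q c).
    by rewrite sq /norm1 mulr_sumr; apply: eq_bigr => c _; rewrite normrM ger0_norm.
  rewrite ler_wpM2l//.
  have : norm1 (fun c => r c - q c) <= norm1 r + norm1 q.
    by rewrite /norm1 -big_split; apply: ler_sum => c _; exact: ler_normB.
  by rewrite r1 q1; lra.
have linZ : lin5 (@kerm R m) q (fun c => s c - q c) =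
   eta * (lin5 (@kerm R m) q r - 5 * diag5 (@kerm R m) q).
  by rewrite sq lin5Z lin5B lin5_diag.
have h1 := diag5_taylor (@ler_norm_kerm R m) q1 s1.
have h2 := lin5_lipschitz (@ler_norm_kerm R m) u1 q1 r1.
have h3 := lin5_tilt m0 t0 t1.
have h4 : lin5 (@kerm R m) (unif R (m := m)) r = lin5 (@kerm R m) (unif R (m := m)) (fun c => r c - unif R c) + 5 * diag5 (@kerm R m) (unif R (m := m)).
  by rewrite lin5B lin5_diag; ring.
have h5 := diag5_lipschitz (@ler_norm_kerm R m) u1 q1.
have h6 := diag5_unif R m0.
have h7 := sigma2m_close R m0.
have h8 : norm1 (fun c => s c - q c) ^+ 2 <= 4 * eta ^+ 2.
  rewrite (_ : 4 * eta ^+ 2 = (eta * 2) ^+ 2); last by ring.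
  by rewrite lerXn2r ?nnegrE ?norm1_ge0 ?mulr_ge0.
(* Of the slope 5 [s0], the distance to the uniform law takes at most [s0] and the grid at most
   another. The Taylor remainder, at most 40 eta^2, then costs at most [s0 * eta]. *)
have h9 : 3 * s0 <= lin5 (@kerm R m) q r - 5 * diag5 (@kerm R m) q.
  move: h2 h3 h5 h6 h7; rewrite -/d -/r /close subr0 !ler_norml.
  move=> /andP[? ?] ? /andP[? ?] /andP[? ?] /andP[? ?].
  by rewrite /rho0 in qrho; rewrite /s0 in qrho hm *; lra.
have h10 := ler_wpM2l eta0 h9.
have h11 : eta * eta <= eta * (s0 / 40) by rewrite ler_wpM2l.
move: h1; rewrite linZ ler_norml => /andP[h1 _]; lra.
Qed.

(** This closes the gap between the two large deviation bounds. If [q] has a heavy cell, [entu_max]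
    makes it costly; if it is far from uniform, [pinsker] does, which is where the smallness of the
    rate enters. Otherwise a small push towards a tilt makes it admissible, and convexity limits the
    change of entropy. *)
Lemma rate_uniform_lower (eps zeta : R) : rateset eps !=set0 ->
  rate eps <= rho0 ^+ 2 / 8 -> 0 < zeta ->
  exists m : nat, (0 < m)%N /\ forall q : 'I_m -> R, prob q ->
    (forall delta, (forall c, q c <= delta) -> eps - 10 * delta <= diag5 (@kerm R m) q) ->
    rate eps - zeta <= entu q.
Proof.
move=> ne hJ z0; have es0 := s0_gt0.
pose eta := Num.min zeta (s0 / 40).
have eta0 : 0 < eta by rewrite lt_min z0 divr_gt0.
have eta1 : eta <= s0 / 40 by rewrite ge_min lexx orbT.
have etaz : eta <= zeta by rewrite ge_min lexx.
have eta2 : eta < 1 by apply: (le_lt_trans eta1); rewrite /s0 /sigma2; lra.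
(* 125 = 115 + 10, the margin plus the loss in the hypothesis. Half of the gain [2 * s0 * eta] pays
   for this, the other half for 115 * 2 / m. *)
pose delta := eta * s0 / 125.
have es : 0 < eta * s0 by rewrite mulr_gt0.
have d0 : 0 < delta by apply: (divr_gt0 es); lra.
(* Once [ln m] exceeds [X], a single cell heavier than [delta] forces an entropy of at least
   [rate eps]. *)
pose X := (rate eps + ln 2) / delta.
have [m [m0 hm]] := big_nat_exists (expR X + 231 / (eta * s0) + 136 / s0).
have mR : 0 < m%:R :> R by rewrite ltr0n.
have a1 := expR_gt0 X.
have a2 : 0 < 231 / (eta * s0) by apply: (divr_gt0 _ es); lra.
have a3 : 0 < 136 / s0 by apply: (divr_gt0 _ es0); lra.
have b1 : X <= ln m%:R by rewrite -ler_expR lnK ?posrE//; lra.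
have b2 : 231 / m%:R < eta * s0.
  by rewrite (ltr_pdivrMr _ _ mR) mulrC -(ltr_pdivrMr _ _ es); lra.
have b3 : 136 / m%:R <= s0.
  by rewrite (ler_pdivrMr _ _ mR) mulrC -(ler_pdivrMr _ _ es0); lra.
exists m; split => // q pq hq.
have [[c hc]|hmax] := pselect (exists c, delta < q c).
  have := entu_max m0 pq (ltW hc); apply: le_trans.
  have := ler_wpM2l (ltW d0) b1; rewrite /X mulrC divfK ?lt0r_neq0//; lra.
have qd c : q c <= delta by rewrite leNgt; apply/negP => h; apply: hmax; exists c.
have [hr|hr] := leP (norm1 (fun c => q c - unif R c)) rho0; last first.
  have := pinsker m0 pq; set d := norm1 _ in hr *.
  have r0 : 0 <= rho0 by rewrite /rho0 divr_ge0// ltW.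
  have : rho0 ^+ 2 <= d ^+ 2 by rewrite lerXn2r ?nnegrE ?norm1_ge0// ltW.
  lra.
have t0 : 0 <= 1 / 8 :> R by lra.
have pr : prob (@tilt R m (1 / 8)).
  by split; [move=> c; exact: tilt_ge0|exact: tilt_sum].
set s := fun c => (1 - eta) * q c + eta * tilt (1 / 8) c.
have : rate eps <= entu s.
  apply: (@rate_le eps m s (delta + 2 / m%:R) m0); split.
  - split; last first.
      transitivity ((1 - eta) * (\sum_c q c) + eta * \sum_c @tilt R m (1 / 8) c).
        by rewrite !mulr_sumr -big_split.
      by rewrite pq.2 pr.2; ring.
    move=> c; apply: addr_ge0; apply: mulr_ge0; last exact: pr.1.
    + lra.
    + exact: pq.1.
    + exact: ltW.
  - move=> c; rewrite lerD//.
      apply: le_trans (qd c); rewrite ler_piMl ?pq.1//; lra.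
    apply: le_trans (tilt_max m0 c t0 (lexx _)).
    by rewrite ler_piMl ?pr.1// ltW.
  - have := diag5_push_tilt m0 pq hr (ltW eta0) eta1 b3.
    have := hq _ qd; rewrite /delta; rewrite -/s; lra.
move=> h; have := entu_convex m0 pq pr eta0 eta2; rewrite -/s => h2.
have h3 := entu_ge0 m0 pq.
have h4 : entu (@tilt R m (1 / 8)) <= 1.
  apply: (le_trans (entu_tilt m0 t0 (lexx _))).
  have := sigma2m_close R m0; rewrite /close ler_norml => /andP[_].
  have : 8 / m%:R <= 8 :> R by rewrite ler_pdivrMr// ler_peMr// ler1n.
  rewrite /sigma2; lra.
have h5 := ler_wpM2l (ltW eta0) h4; have h6 := mulr_ge0 (ltW eta0) h3.
lra.
Qed.

End Rate.

(** * Types *)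

Section Words.
Variables (R : realType) (m : nat).
Hypothesis m0 : (0 < m)%N.
Implicit Types (p q : 'I_m -> R) (w : seq 'I_m) (n : nat).
Local Notation u := (unif R (m := m)).

Let mR : 0 < m%:R :> R. Proof. by rewrite ltr0n. Qed.

(** The expectation over i.i.d. letters, with the same recursion as [iidE]. *)
Fixpoint wordE p n (F : seq 'I_m -> R) : R :=
  if n is n'.+1 then wsum p (fun c => wordE p n' (fun w => F (c :: w))) else F [::].

Lemma eq_wordE p n F G : (forall w, size w = n -> F w = G w) ->
  wordE p n F = wordE p n G.
Proof.
elim: n F G => [|n IH] F G FG /=; first exact: FG.
by apply: eq_wsum => c; apply: IH => w wn; apply: FG; rewrite /= wn.
Qed.

Lemma ler_wordE p n F G : (forall c, 0 <= p c) ->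
  (forall w, size w = n -> F w <= G w) -> wordE p n F <= wordE p n G.
Proof.
move=> p0; elim: n F G => [|n IH] F G FG /=; first exact: FG.
by apply: ler_wsum => // c; apply: IH => w wn; apply: FG; rewrite /= wn.
Qed.

Lemma wordE_ge0 p n F : (forall c, 0 <= p c) -> (forall w, 0 <= F w) -> 0 <= wordE p n F.
Proof.
move=> p0; elim: n F => [|n IH] F F0 //=.
by apply: sumr_ge0 => c _; rewrite mulr_ge0// IH.
Qed.

Lemma wordEZ p n k F : wordE p n (fun w => k * F w) = k * wordE p n F.
Proof.
by elim: n F => [|n IH] F //=; rewrite -wsumZr; apply: eq_wsum => c; exact: IH.
Qed.

Lemma wordED p n F G : wordE p n (fun w => F w + G w) = wordE p n F + wordE p n G.
Proof.
by elim: n F G => [|n IH] F G //=; rewrite -wsumDr; apply: eq_wsum => c; exact: IH.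
Qed.

Lemma wordE_sum (T : finType) (P : pred T) p n (F : T -> seq 'I_m -> R) :
  wordE p n (fun w => \sum_(t | P t) F t w) = \sum_(t | P t) wordE p n (F t).
Proof.
elim: n F => [|n IH] F //=.
under eq_wsum => c do rewrite IH.
rewrite /wsum exchange_big /=; under eq_bigr => c _ do rewrite mulr_sumr.
by rewrite exchange_big.
Qed.

Lemma wordE_cst p n k : \sum_c p c = 1 -> wordE p n (fun=> k) = k.
Proof.
move=> p1; elim: n => [|n IH] //=.
by under eq_wsum => c do rewrite IH; rewrite wsum_cst p1 mul1r.
Qed.

Lemma wordE_density p n (r : 'I_m -> R) F :
  wordE p n (fun w => (\prod_(c <- w) r c) * F w) = wordE (fun c => p c * r c) n F.
Proof.
elim: n F => [|n IH] F /=; first by rewrite big_nil mul1r.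
rewrite /wsum; apply: eq_bigr => c _; rewrite -mulrA -IH; congr (_ * _).
by rewrite -wordEZ; apply: eq_wordE => w _; rewrite big_cons mulrA.
Qed.

Lemma wordE_prod p n (f : 'I_m -> R) :
  wordE p n (fun w => \prod_(c <- w) f c) = wsum p f ^+ n.
Proof.
elim: n => [|n IH] /=; first by rewrite big_nil.
rewrite exprS -IH /wsum mulr_suml; apply: eq_bigr => c _.
by rewrite -mulrA; congr (_ * _); rewrite -wordEZ; apply: eq_wordE => w _; rewrite big_cons.
Qed.

Definition emp w (c : 'I_m) : R := (count_mem c w)%:R / (size w)%:R.

Lemma count_sum w : (\sum_c count_mem c w)%N = size w.
Proof.
elim: w => [|a w IH] /=; first by rewrite big1.
rewrite big_split /= IH (bigD1 a)//= eqxx big1 ?addn0// => i.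
by rewrite eq_sym => /negbTE ->.
Qed.

Lemma emp_prob w : (0 < size w)%N -> prob (emp w).
Proof.
move=> w0; split=> [c|]; first by rewrite divr_ge0.
by rewrite -mulr_suml -natr_sum count_sum divff// pnatr_eq0 -lt0n.
Qed.

Lemma prod_count w (f : 'I_m -> R) : \prod_(c <- w) f c = \prod_c f c ^+ count_mem c w.
Proof.
elim: w => [|a w IH]; first by rewrite big_nil big1.
rewrite big_cons IH [in RHS](bigD1 a)//= [in LHS](bigD1 a)//= eqxx add1n exprS mulrA.
congr (_ * _); apply: eq_bigr => i; rewrite eq_sym => /negbTE ->.
by rewrite add0n.
Qed.

Lemma prod_emp w : (0 < size w)%N ->
  \prod_(c <- w) (m%:R * emp w c) = expR ((size w)%:R * entu (emp w)).
Proof.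
move=> w0; rewrite prod_count /entu mulr_sumr expR_sum; apply: eq_bigr => c _.
have n0 : 0 < (size w)%:R :> R by rewrite ltr0n.
have E : (size w)%:R * (emp w c * ln (m%:R * emp w c)) = (count_mem c w)%:R * ln (m%:R * emp w c).
  by rewrite mulrA /emp mulrCA divff ?mulr1// lt0r_neq0.
rewrite E expRM_natl; have [->|/negbTE ne] := eqVneq (count_mem c w) 0%N.
  by rewrite !expr0.
by rewrite lnK// posrE mulr_gt0// divr_gt0// ltr0n lt0n ne.
Qed.

(** The indicator of a word in [B] is majorized by the likelihood ratio of its own type, divided by
    the value [expR (n * entu)] taken there. A likelihood ratio has mean 1 under the uniform law,
    and the types are among [n.+1 ^ m] functions. *)
Lemma word_type_bound n (B : pred (seq 'I_m)) (L : R) : (0 < n)%N ->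
  (forall w, size w = n -> B w -> L <= entu (emp w)) ->
  wordE u n (fun w => (B w)%:R) <= n.+1%:R ^+ m * expR (- (n%:R * L)).
Proof.
move=> n0 BL; pose T := {ffun 'I_m -> 'I_n.+1}.
pose q (t : T) c : R := (t c)%:R / n%:R.
pose P (t : T) := ((\sum_c (t c : nat))%N == n) && (L <= entu (q t)).
have nR : 0 < n%:R :> R by rewrite ltr0n.
apply: (@le_trans _ _ (wordE u n (fun w => \sum_(t | P t)
   (expR (- (n%:R * entu (q t))) * \prod_(c <- w) (m%:R * q t c))))).
  apply: ler_wordE => [c|w wn]; first exact: unif_ge0.
  have pos t : 0 <= expR (- (n%:R * entu (q t))) * \prod_(c <- w) (m%:R * q t c).
    rewrite mulr_ge0 ?expR_ge0// prodr_ge0// => c _.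
    by rewrite mulr_ge0// divr_ge0.
  have [Bw|nBw] := boolP (B w); last exact: sumr_ge0.
  pose t : T := [ffun c => inord (count_mem c w)].
  have tE c : (t c : nat) = count_mem c w.
    by rewrite ffunE inordK// ltnS -wn count_size.
  have qE : q t = emp w by apply/funext => c; rewrite /q /emp tE wn.
  have Pt : P t.
    rewrite /P qE (BL _ wn Bw) andbT; apply/eqP/(etrans _ wn).
    by rewrite -count_sum; apply: eq_bigr => c _; exact: tE.
  rewrite (bigD1 t)//= qE prod_emp ?wn// expRN mulVf ?lt0r_neq0 ?expR_gt0//.
  by rewrite lerDl sumr_ge0.
rewrite wordE_sum; apply: (@le_trans _ _ (\sum_(t : T) expR (- (n%:R * L)))).
  rewrite big_mkcond /=; apply: ler_sum => t _; case: ifPn => [/andP[/eqP tn Lt]|_]; last exact: expR_ge0.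
  rewrite wordEZ wordE_prod.
  have -> : wsum u (fun c => m%:R * q t c) = 1.
    rewrite /wsum /unif; under eq_bigr do rewrite mulrA mulVf ?lt0r_neq0// mul1r.
    by rewrite -mulr_suml -natr_sum tn divff// lt0r_neq0.
  by rewrite expr1n mulr1 ler_expR lerN2 ler_wpM2l// ltW.
by rewrite sumr_const card_ffun !card_ord -[_ *+ _]mulr_natl natrX.
Qed.

Lemma chernoff p n (f : 'I_m -> R) (d : R) : prob p -> (forall c, `|f c| <= 1) ->
  wsum p f = 0 -> 0 <= d -> d <= 1 ->
  wordE p n (fun w => (n%:R * d <= \sum_(c <- w) f c)%R%:R) <= expR (- (n%:R * (d ^+ 2 / 4))).
Proof.
move=> [p0 p1] f1 pf d0 d1.
(* Exponential Markov inequality with parameter d/2, which keeps the exponent in the range of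
   [expR_quadratic]. *)
apply: (@le_trans _ _ (wordE p n (fun w => expR (- (n%:R * (d ^+ 2 / 2)))
    * \prod_(c <- w) expR (d / 2 * f c)))).
  apply: ler_wordE => // w wn; have [h|h] := leP (n%:R * d) (\sum_(c <- w) f c); last first.
    by rewrite /= mulr_ge0 ?expR_ge0// prodr_ge0// => *; exact: expR_ge0.
  apply: (@le_trans _ _ (expR 0)); first by rewrite expR0.
  rewrite -expR_sum -expRD ler_expR -mulr_sumr.
  have := ler_wpM2l (divr_ge0 d0 (ler0n _ 2)) h; lra.
rewrite wordEZ wordE_prod.
have : wsum p (fun c => expR (d / 2 * f c)) <= expR (d ^+ 2 / 4).
  apply: (@le_trans _ _ (wsum p (fun c => 1 + d ^+ 2 / 4 + d / 2 * f c))).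
    apply: ler_wsum => // c; have h : `|d / 2 * f c| <= 1 / 2.
      rewrite normrM ger0_norm ?divr_ge0//.
      have := ler_wpM2l (divr_ge0 d0 (ler0n _ 2)) (f1 c); lra.
    apply: (le_trans (expR_quadratic h)).
    have : f c ^+ 2 <= 1 by rewrite -real_normK ?num_real// expr_le1.
    move=> /(ler_wpM2l (sqr_ge0 (d / 2))); lra.
  by rewrite wsumDr wsumZr wsum_cst p1 pf mulr0 addr0 mul1r expR_ge1Dx.
move=> h; apply: (@le_trans _ _ (expR (- (n%:R * (d ^+ 2 / 2))) * expR (d ^+ 2 / 4) ^+ n)).
  rewrite ler_wpM2l ?expR_ge0// lerXn2r ?nnegrE ?expR_ge0//.
  by apply: sumr_ge0 => c _; rewrite mulr_ge0 ?expR_ge0.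
by rewrite -expRM_natl -expRD ler_expR; lra.
Qed.

Definition typical q (d : R) w := [forall c, `|emp w c - q c| <= d].

(** Union bound over the [m] letters and the two signs of the deviation. *)
Lemma typical_prob q n (d : R) : (0 < n)%N -> prob q -> 0 <= d -> d <= 1 ->
  1 - 2 * m%:R * expR (- (n%:R * (d ^+ 2 / 4))) <= wordE q n (fun w => (typical q d w)%:R).
Proof.
move=> n0 pq d0 d1; have [q0 q1] := pq.
have nR : 0 < n%:R :> R by rewrite ltr0n.
pose f c (a : 'I_m) : R := (a == c)%:R - q c.
have qle c : q c <= 1.
  by rewrite -q1 (bigD1 c)//= lerDl sumr_ge0.
have f1 c a : `|f c a| <= 1.
  rewrite /f ler_norml; have := q0 c; have := qle c.
  by case: (a == c) => /= ? ?; apply/andP; split; lra.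
have qf c : wsum q (f c) = 0.
  rewrite wsumBr wsum_cst q1 mul1r /wsum (bigD1 c)//= eqxx mulr1 big1 ?addr0 ?subrr//.
  by move=> i /negbTE ->; rewrite mulr0.
have fsum c w : size w = n -> \sum_(a <- w) f c a = n%:R * (emp w c - q c).
  move=> wn; rewrite sumrB mulrBr /emp wn mulrCA divff ?lt0r_neq0// mulr1.
  rewrite big_const_seq count_predT wn iter_addr_0 mulr_natl; congr (_ - _).
  rewrite -natr_sum; congr _%:R; rewrite -sum1_count [RHS]big_mkcond.
  by apply: eq_bigr => i _ /=; case: (i == c).
have key : wordE q n (fun w => 1 + -1 * \sum_(c in 'I_m) (
    (n%:R * d <= \sum_(a <- w) f c a)%R%:R + (n%:R * d <= \sum_(a <- w) (- f c a))%R%:R))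
   <= wordE q n (fun w => (typical q d w)%:R).
  apply: ler_wordE => // w wn.
  have S0 : 0 <= \sum_(c in 'I_m) (
    (n%:R * d <= \sum_(a <- w) f c a)%R%:R + (n%:R * d <= \sum_(a <- w) (- f c a))%R%:R) :> R.
    by apply: sumr_ge0 => c _; rewrite addr_ge0.
  have [t|/forallPn[c]] := boolP (typical q d w); first by rewrite mulN1r gerDl oppr_le0.
  rewrite -ltNge ltr_normr => h.
  suff : 1 <= \sum_(c in 'I_m) (
    (n%:R * d <= \sum_(a <- w) f c a)%R%:R + (n%:R * d <= \sum_(a <- w) (- f c a))%R%:R) :> R.
    by move=> ?; rewrite mulN1r subr_le0.
  rewrite (bigD1 c)//= sumrN fsum// -mulrN !ler_pM2l//.
  apply: (@le_trans _ _ ((d <= emp w c - q c)%R%:R + (d <= - (emp w c - q c))%R%:R)).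
    by case/orP: h => /ltW -> /=; rewrite ?lerDl ?lerDr ler0n.
  by rewrite lerDl; apply: sumr_ge0 => i _; rewrite addr_ge0.
apply: le_trans key; rewrite wordED wordEZ wordE_cst// wordE_sum.
have : \sum_(c in 'I_m) wordE q n (fun w => (n%:R * d <= \sum_(a <- w) f c a)%R%:R
   + (n%:R * d <= \sum_(a <- w) (- f c a))%R%:R)
   <= \sum_(c in 'I_m) 2 * expR (- (n%:R * (d ^+ 2 / 4))).
  apply: ler_sum => c _; rewrite wordED (_ : 2 = 1 + 1)// mulrDl mul1r lerD//.
    exact: chernoff.
  apply: (@chernoff _ _ (fun a => - f c a)) => // [a|]; first by rewrite normrN.
  by rewrite /wsum; under eq_bigr do rewrite mulrN; rewrite sumrN -/(wsum q (f c)) qf oppr0.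
rewrite sumr_const card_ord -[_ *+ _]mulr_natl; lra.
Qed.

(** On typical words the logarithm of the density of [q] with respect to the uniform law deviates
    from [n * entu q] by at most [n * d] times the sum of the absolute logarithms; and under [q]
    most words are typical. *)
Lemma word_change_measure q n (d : R) : (0 < n)%N -> prob q -> 0 <= d -> d <= 1 ->
  (1 - 2 * m%:R * expR (- (n%:R * (d ^+ 2 / 4))))
    * expR (- (n%:R * (entu q + d * \sum_c `|ln (m%:R * q c)|)))
  <= wordE u n (fun w => (typical q d w)%:R).
Proof.
move=> n0 pq d0 d1; have [q0 q1] := pq; set L := entu q + _.
apply: (@le_trans _ _ (wordE u n (fun w => expR (- (n%:R * L)) *
   ((\prod_(c <- w) (m%:R * q c)) * (typical q d w)%:R)))).
  rewrite wordEZ wordE_density.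
  have -> : (fun c => u c * (m%:R * q c)) = q.
    by apply/funext => c; rewrite /unif mulrA mulVf ?mul1r// lt0r_neq0.
  by rewrite mulrC ler_wpM2l ?expR_ge0//; exact: typical_prob.
apply: ler_wordE => [c|w wn]; first exact: unif_ge0.
have [/forallP t|_] := boolP (typical q d w); last by rewrite !mulr0.
rewrite mulr1 expRN mulrC ler_pdivrMr ?expR_gt0// mul1r prod_count.
have -> : n%:R * L = \sum_c n%:R * (q c * ln (m%:R * q c) + d * `|ln (m%:R * q c)|).
  by rewrite -mulr_sumr big_split /= -mulr_sumr.
rewrite expR_sum; apply: ler_prod => c _; rewrite exprn_ge0 ?mulr_ge0//=.
(* For a letter of mass 0 the value [ln 0 = 0] makes the right factor 1, while the left one is a
   power of 0, hence 0 or 1. *)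
have [e|/negbTE ne] := eqVneq (q c) 0.
  rewrite e mulr0 ln0// normr0 !mulr0 addr0 mulr0 expR0 expr0n.
  by case: eqP.
have qc : 0 < m%:R * q c by rewrite mulr_gt0// lt0r ne q0.
rewrite -[X in X ^+ _]lnK ?posrE// -expRM_natl ler_expR.
have -> : (count_mem c w)%:R = n%:R * emp w c :> R.
  by rewrite /emp wn mulrCA divff ?mulr1// pnatr_eq0 -lt0n.
rewrite -mulrA ler_wpM2l//.
have := t c; set l := ln _; move=> h.
have : (emp w c - q c) * l <= d * `|l|.
  apply: (le_trans (ler_norm _)); rewrite normrM ler_wpM2r//.
lra.
Qed.

End Words.

(* No measurability is needed: the integral of a nonnegative function is a supremum over the simple functions below it. *)
Lemma ge0_le_integral_nomeas d (T : measurableType d) (R : realType)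
  (mu : {measure set T -> \bar R}) (D : set T) (f g : T -> \bar R) :
  (forall x, D x -> (0 <= f x)%E) -> (forall x, D x -> (f x <= g x)%E) ->
  (\int[mu]_(x in D) f x <= \int[mu]_(x in D) g x)%E.
Proof.
move=> f0 fg; rewrite !ge0_integralE//; last first.
  by move=> x Dx; exact: le_trans (f0 x Dx) (fg x Dx).
apply: ereal_sup_le => _ /= [h hf <-]; exists h => // x.
apply: (le_trans (hf x)); rewrite /patch; case: ifPn => //.
by rewrite inE => /fg.
Qed.

(** * Samples on the half line *)

Section Cells.
Variables (R : realType) (m : nat).
Hypothesis m0 : (0 < m)%N.
Local Notation mu := (@lebesgue_measure R).
Local Notation halfline := (`[0%R, +oo[%classic : set R).

Let mR : 0 < m%:R :> R. Proof. by rewrite ltr0n. Qed.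

(** The truncation acts on 1 - exp (- x), which closes the cells at their upper ends: cell [c] is
    c/m < exp (- x) <= (c + 1)/m, and x = 0 falls into the top cell. *)
Definition cell (x : R) : 'I_m :=
  insubd (Ordinal m0) (m - (Num.truncn (m%:R * (1 - expR (- x)))).+1)%N.

Lemma expRN_bounds (x : R) : 0 <= x -> 0 < expR (- x) /\ expR (- x) <= 1.
Proof. by move=> x0; rewrite expR_gt0 -expR0 ler_expR; split => //; lra. Qed.

Lemma cellP (x : R) : 0 <= x ->
  (cell x)%:R / m%:R < expR (- x) /\ expR (- x) <= gridv R (cell x).
Proof.
move=> x0; have [e0 e1] := expRN_bounds x0.
set y := m%:R * (1 - expR (- x)).
have y0 : 0 <= y by rewrite mulr_ge0// subr_ge0.
have ym : y < m%:R by rewrite /y -[ltRHS]mulr1 ltr_pM2l//; lra.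
have /andP[t1 t2] := truncn_itv y0.
have tm : (Num.truncn y < m)%N by rewrite -(ltr_nat R); exact: le_lt_trans ym.
have cE : (cell x : nat) = (m - (Num.truncn y).+1)%N.
  by rewrite /cell -/y val_insubd /= subnSK// leq_subr.
have cR : (cell x)%:R = m%:R - (Num.truncn y)%:R - 1 :> R.
  by rewrite cE natrB// -natr1; ring.
split.
  rewrite ltr_pdivrMr// cR; move: t2; rewrite -natr1 /y; lra.
rewrite /gridv ler_pdivlMr// -natr1 cR; move: t1; rewrite /y; lra.
Qed.

Lemma cell_eq (x : R) (c : 'I_m) : 0 <= x ->
  c%:R / m%:R < expR (- x) -> expR (- x) <= gridv R c -> cell x = c.
Proof.
move=> x0 c1 c2; have [d1 d2] := cellP x0.
have h1 : c%:R / m%:R < gridv R (cell x) by exact: lt_le_trans d2.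
have h2 : (cell x)%:R / m%:R < gridv R c by exact: lt_le_trans c2.
move: h1 h2; rewrite /gridv !ltr_pM2r ?invr_gt0// !ltr_nat !ltnS => h1 h2.
by apply/val_inj/eqP; rewrite eqn_leq h1 h2.
Qed.

Lemma measurable_cell (c : 'I_m) : measurable [set x : R | 0 <= x /\ cell x = c].
Proof.
have -> : [set x : R | 0 <= x /\ cell x = c] =
  halfline `&` ((fun x : R => expR (- x)) @^-1` `]c%:R / m%:R, gridv R c]).
  apply/seteqP; split => x /=; rewrite !in_itv /= ?andbT.
    by move=> [x0 <-]; have [-> ->] := cellP x0.
  by move=> [x0 /andP[c1 c2]]; split => //; exact: cell_eq.
apply: measurableI => //.
rewrite -[X in measurable X]setTI.
have h : measurable_fun [set: R] (fun x : R => expR (- x)).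
  by apply: measurableT_comp => //; exact: oppr_measurable.
by apply: h.
Qed.

Section Density.
Variable f : R -> R.
Hypotheses (f0 : forall x, 0 <= x -> 0 <= f x) (mf : measurable_fun [set: R] f).
Hypothesis f1 : (\int[mu]_(x in halfline) (f x)%:E = 1)%E.

Lemma measurable_mul_cell c : measurable_fun halfline (fun x => f x * (cell x == c)%:R).
Proof.
apply: measurable_funM; first exact: measurable_funTS.
have h : measurable_fun [set: R] (\1_([set x : R | 0 <= x /\ cell x = c]) : R -> R).
  exact: (measurable_indic (measurable_cell c)).
apply: (eq_measurable_fun (\1_([set x : R | 0 <= x /\ cell x = c]) : R -> R)); last first.
  exact: measurable_funTS.
move=> x; rewrite inE /= in_itv /= andbT => x0; rewrite indicE.
by congr _%:R; congr nat_of_bool; apply/idP/eqP; rewrite inE /=; [case|].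
Qed.

Definition mass (c : 'I_m) : R :=
  fine (\int[mu]_(x in halfline) (f x * (cell x == c)%:R)%:E)%E.

Lemma massE c : (\int[mu]_(x in halfline) (f x * (cell x == c)%:R)%:E)%E = (mass c)%:E.
Proof.
rewrite /mass fineK// ge0_fin_numE; last first.
  apply: integral_ge0 => x /=; rewrite in_itv /= andbT => x0.
  by rewrite lee_fin mulr_ge0// f0.
apply: (@le_lt_trans _ _ 1%E); last exact: ltry.
rewrite -f1; apply: ge0_le_integral_nomeas => x /=; rewrite in_itv /= andbT => x0.
  by rewrite lee_fin mulr_ge0// f0.
by rewrite lee_fin ler_piMr ?f0//; case: (_ == _).
Qed.

Lemma mass_ge0 c : 0 <= mass c.
Proof.
rewrite /mass fine_ge0//; apply: integral_ge0 => x /=; rewrite in_itv /= andbT => x0.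
by rewrite lee_fin mulr_ge0// f0.
Qed.

Lemma integral_cell (a : 'I_m -> R) : (forall c, 0 <= a c) ->
  (\int[mu]_(x in halfline) (f x * a (cell x))%:E = (wsum mass a)%:E)%E.
Proof.
move=> a0.
transitivity (\int[mu]_(x in halfline) (\sum_(c < m) (a c)%:E * (f x * (cell x == c)%:R)%:E))%E.
  apply: eq_integral => x _; rewrite (bigD1 (cell x))//= eqxx mulr1 big1 ?adde0.
    by rewrite -EFinM mulrC.
  by move=> c; rewrite eq_sym => /negbTE ->; rewrite mulr0 mule0.
have pos c x : halfline x -> (0 <= (f x * (cell x == c)%:R)%:E)%E.
  by rewrite /= in_itv /= andbT => x0; rewrite lee_fin mulr_ge0// f0.
rewrite ge0_integral_sum//; last 2 first.
- by move=> c; apply: measurable_funeM; apply/measurable_EFinP; exact: measurable_mul_cell.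
- by move=> c x Dx; apply: mule_ge0; [rewrite lee_fin|exact: pos].
rewrite /wsum -sumEFin; apply: eq_bigr => c _.
rewrite ge0_integralZl_EFin//; last 2 first.
- by move=> x Dx; exact: pos.
- by apply/measurable_EFinP; exact: measurable_mul_cell.
by rewrite massE EFinM muleC.
Qed.

Lemma mass_sum : \sum_c mass c = 1.
Proof.
have := @integral_cell (fun=> 1) (fun=> ler01).
under eq_integral do rewrite mulr1.
by rewrite f1 wsum_cst mulr1 => -[].
Qed.

Lemma mass_prob : prob mass.
Proof. by split; [exact: mass_ge0|exact: mass_sum]. Qed.

Lemma iidE_cell n (F : seq 'I_m -> R) : (forall w, 0 <= F w) ->
  iidE f n (fun s => (F (map cell s))%:E) = (wordE mass n F)%:E.
Proof.
elim: n F => [|n IH] F F0 //=.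
transitivity (\int[mu]_(x in halfline) (f x * wordE mass n (fun w => F (cell x :: w)))%:E)%E.
  apply: eq_integral => x _; rewrite (IH (fun w => F (cell x :: w)))//.
rewrite (integral_cell (a := fun c => wordE mass n (fun w => F (c :: w))))//.
by move=> c; apply: wordE_ge0 => // *; exact: mass_ge0.
Qed.

Lemma iidE_ge0 n (F : seq R -> \bar R) :
  (forall s, all (fun x => 0 <= x) s -> (0 <= F s)%E) -> (0 <= iidE f n F)%E.
Proof.
elim: n F => [|n IH] F F0 /=; first exact: F0.
apply: integral_ge0 => x /=; rewrite in_itv /= andbT => x0.
by rewrite mule_ge0 ?lee_fin ?f0//; apply: IH => s s0; apply: F0; rewrite /= x0.
Qed.

Lemma le_iidE n (F G : seq R -> \bar R) :
  (forall s, all (fun x => 0 <= x) s -> (0 <= F s)%E) ->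
  (forall s, all (fun x => 0 <= x) s -> size s = n -> (F s <= G s)%E) ->
  (iidE f n F <= iidE f n G)%E.
Proof.
elim: n F G => [|n IH] F G F0 FG /=; first exact: FG.
apply: ge0_le_integral_nomeas => x /=; rewrite in_itv /= andbT => x0.
  rewrite mule_ge0 ?lee_fin ?f0//; apply: iidE_ge0 => s s0; apply: F0; by rewrite /= x0.
rewrite lee_wpmul2l ?lee_fin ?f0//; apply: IH => s s0; first by apply: F0; rewrite /= x0.
by move=> sn; apply: FG; rewrite /= ?x0 ?sn.
Qed.

Lemma ind_ge0 (P : Prop) : 0 <= ind R P.
Proof. by rewrite /ind; case: ifP. Qed.

Lemma ind_le1 (P : Prop) : ind R P <= 1.
Proof. by rewrite /ind; case: ifP. Qed.

Lemma iidE_ind_fin n (A : seq R -> Prop) :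
  iidE f n (fun s => (ind R (A s))%:E) \is a fin_num.
Proof.
have p0 : (0 <= iidE f n (fun s => (ind R (A s))%:E))%E.
  by apply: iidE_ge0 => s _; rewrite lee_fin ind_ge0.
rewrite ge0_fin_numE//; apply: (@le_lt_trans _ _ 1%E); last exact: ltry.
have := iidE_cell n (F := fun=> 1) (fun=> ler01); rewrite (wordE_cst n 1 mass_sum) => <-.
by apply: le_iidE => s *; rewrite lee_fin ?ind_ge0 ?ind_le1.
Qed.

(** Events on samples are enclosed between events on cells, for which the iterated integral is a
    finite sum; the event itself enters only through monotonicity. *)
Lemma iid_prob_upper n (A : seq R -> Prop) (B : pred (seq 'I_m)) :
  (forall s, all (fun x => 0 <= x) s -> size s = n -> A s -> B (map cell s)) ->
  iid_prob f n A <= wordE mass n (fun w => (B w)%:R).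
Proof.
move=> AB; rewrite /iid_prob -lee_fin fineK ?iidE_ind_fin//.
rewrite -(iidE_cell n (F := fun w => (B w)%:R))//.
apply: le_iidE => s s0; first by rewrite lee_fin ind_ge0.
move=> sn; rewrite lee_fin /ind; case: asboolP => // As.
by rewrite AB.
Qed.

Lemma iid_prob_lower n (A : seq R -> Prop) (B : pred (seq 'I_m)) :
  (forall s, all (fun x => 0 <= x) s -> size s = n -> B (map cell s) -> A s) ->
  wordE mass n (fun w => (B w)%:R) <= iid_prob f n A.
Proof.
move=> BA; rewrite /iid_prob -lee_fin fineK ?iidE_ind_fin//.
rewrite -(iidE_cell n (F := fun w => (B w)%:R))//.
apply: le_iidE => s s0; first by rewrite lee_fin.
move=> sn; rewrite lee_fin /ind; case: asboolP => // nA; first by case: (B _).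
by have /negP/negbTE -> : ~ B (map cell s) by move/(BA s s0 sn).
Qed.

Lemma iid_prob_ge0 n (A : seq R -> Prop) : 0 <= iid_prob f n A.
Proof.
by rewrite /iid_prob fine_ge0//; apply: iidE_ge0 => s _; rewrite lee_fin ind_ge0.
Qed.

End Density.
End Cells.

(** * The statistic as a quinary form in the empirical law *)

Section Sample.
Variables (R : realType) (m : nat).
Hypothesis m0 : (0 < m)%N.
Local Notation cell := (@cell R m m0).

Lemma ind_kmax (a b c t : R) :
  ind R (Num.max a (Num.max b c) < t)
  = (kmax (expR (- a)) (expR (- b)) (expR (- c)) 0 (expR (- t)))%:R.
Proof.
rewrite /ind /kmax !lt_min !ltr_expR !ltrN2 !gt_max asboolb.
by case: ifP.
Qed.

Lemma ind_kmed (x a b c t : R) :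
  ind R (x + med3 a b c < t)
  = (kmed (expR (- a)) (expR (- b)) (expR (- c)) (expR (- x)) (expR (- t)))%:R.
Proof.
have -> : kmed (expR (- a)) (expR (- b)) (expR (- c)) (expR (- x)) (expR (- t))
  = (x + med3 a b c < t).
  rewrite /kmed addrC -ltrBrDr med3_lt mulrC -ltr_pdivrMr ?expR_gt0//.
  rewrite -expRN opprK -expRD lt_med3 !ltr_expR.
  have E y : (- t + x < - y) = (y < t - x) by apply/idP/idP; lra.
  by rewrite !E; case: (a < _); case: (b < _); case: (c < _).
by rewrite /ind asboolb; case: ifP.
Qed.

Lemma sum_nth_ord (s : seq R) (F : R -> R) :
  \sum_(x <- s) F x = \sum_(i < size s) F (nth 0 s i).
Proof. by rewrite (big_nth 0) big_mkord. Qed.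

Definition sample_ker (s : seq R) (a b c d e : 'I_(size s)) : R :=
  ker5 (expR (- nth 0 s a)) (expR (- nth 0 s b)) (expR (- nth 0 s c))
    (expR (- nth 0 s d)) (expR (- nth 0 s e)).

(** The dummy slot of [kmax] averages to 1, and a rotation brings the slot of the integration by F_n
    to the outermost position. *)
Lemma In_diag5 (s : seq R) : (0 < size s)%N ->
  In s = diag5 (@sample_ker s) (fun=> (size s)%:R^-1).
Proof.
move=> n0; set n := size s; have nR : n%:R != 0 :> R by rewrite pnatr_eq0 -lt0n.
pose q (i : 'I_n) : R := n%:R^-1.
have q1 : \sum_i q i = 1.
  by rewrite /q sumr_const card_ord -[_ *+ _]mulr_natl divff.
have wE (F : R -> R) : \sum_(x <- s) F x = n%:R * wsum q (fun i => F (nth 0 s i)).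
  by rewrite sum_nth_ord /wsum -mulr_sumr mulrA divff// mul1r.
pose x (i : 'I_n) : R := nth 0 s i.
have S2 (F : R -> R -> R) : \sum_(a <- s) \sum_(b <- s) F a b
    = n%:R ^+ 2 * wsum q (fun a => wsum q (fun b => F (x a) (x b))).
  by under eq_bigr => a _ do rewrite wE; rewrite -mulr_sumr wE mulrA.
have S3 (F : R -> R -> R -> R) : \sum_(a <- s) \sum_(b <- s) \sum_(c <- s) F a b c
    = n%:R ^+ 3 * wsum q (fun a => wsum q (fun b => wsum q (fun c => F (x a) (x b) (x c)))).
  by under eq_bigr => a _ do rewrite S2; rewrite -mulr_sumr wE mulrA -exprSr.
have S4 (F : R -> R -> R -> R -> R) :
    \sum_(a <- s) \sum_(b <- s) \sum_(c <- s) \sum_(d <- s) F a b c d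
    = n%:R ^+ 4 * wsum q (fun a => wsum q (fun b => wsum q (fun c => wsum q (fun d =>
        F (x a) (x b) (x c) (x d))))).
  by under eq_bigr => a _ do rewrite S3; rewrite -mulr_sumr wE mulrA -exprSr.
pose K (k : R -> R -> R -> R -> R -> bool) (a b c d e : 'I_n) : R :=
  (k (expR (- x a)) (expR (- x b)) (expR (- x c)) (expR (- x d)) (expR (- x e)))%:R.
have HE (e : 'I_n) : Hn s (x e) = wsum q (fun a => wsum q (fun b => wsum q (fun c =>
    wsum q (fun d => K (@kmax R) a b c d e)))).
  rewrite /Hn -/n S3 mulrA mulVf ?expf_neq0// mul1r.
  apply: eq_wsum => a; apply: eq_wsum => b; apply: eq_wsum => c.
  by rewrite wsum_cst q1 mul1r ind_kmax.
have GE (e : 'I_n) : Gn s (x e) = wsum q (fun a => wsum q (fun b => wsum q (fun c =>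
    wsum q (fun d => K (@kmed R) a b c d e)))).
  rewrite /Gn -/n S4 mulrA mulVf ?expf_neq0// mul1r wsum_exchange.
  apply: eq_wsum => a; rewrite wsum_exchange; apply: eq_wsum => b.
  rewrite wsum_exchange; apply: eq_wsum => c; apply: eq_wsum => d.
  by rewrite ind_kmed.
rewrite /In wE mulrA mulVf// mul1r /diag5.
rewrite -[RHS](form5_rot (fun e a b c d => sample_ker a b c d e)) /form5.
apply: eq_wsum => e; rewrite -/(x e) HE GE.
rewrite -wsumBr; apply: eq_wsum => a; rewrite -wsumBr; apply: eq_wsum => b.
by rewrite -wsumBr; apply: eq_wsum => c; rewrite -wsumBr; apply: eq_wsum => d.
Qed.

(** The rounding lemma is applied with the positions in the sample as its index set, so that ties
    are included. *)
Lemma In_emp (s : seq R) (delta : R) : (0 < size s)%N -> all (fun x => 0 <= x) s ->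
  0 <= delta -> (forall c, emp R (map cell s) c <= delta) ->
  `|In s - diag5 (@kerm R m) (emp R (map cell s))| <= 10 * delta.
Proof.
move=> n0 /allP s0 d0 hd; rewrite In_diag5//.
pose q (i : 'I_(size s)) : R := (size s)%:R^-1.
pose w (i : 'I_(size s)) := cell (nth 0 s i).
have nR : (size s)%:R != 0 :> R by rewrite pnatr_eq0 -lt0n.
have pE : pushw q w = emp R (map cell s).
  apply/funext => c; rewrite /pushw /emp size_map count_map -sum1_count.
  rewrite (big_nth 0) big_mkord natr_sum mulr_suml.
  by apply: eq_bigr => i _; rewrite mul1r.
have xi (i : 'I_(size s)) : 0 <= nth 0 s i by apply: s0; rewrite mem_nth.
have := @diag5_rounding R _ _ q (fun i => expR (- nth 0 s i)) w (@gridv R m).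
rewrite pE; apply => //.
- by move=> i; rewrite invr_ge0.
- by rewrite /q sumr_const card_ord -[_ *+ _]mulr_natl divff.
- by move=> c; exact: gridv_ge0.
- exact: gridv_inj.
- by move=> i; have [] := cellP m0 (xi i).
- move=> i j; have [h _] := cellP m0 (xi j); move=> h2; apply: le_lt_trans h.
  have mR : 0 < m%:R :> R by rewrite ltr0n.
  move: h2; rewrite /gridv ltr_pM2r ?invr_gt0// ltr_nat ltnS => h2.
  by rewrite ler_pM2r ?invr_gt0// ler_nat.
Qed.

End Sample.

(** * Integrals on the half line *)

Section HalfLineIntegrals.
Variable R : realType.
Local Notation mu := (@lebesgue_measure R).
Local Notation halfline := (`[0%R, +oo[%classic : set R).
Implicit Types (f g F : R -> R).

(** Integrability is carried along with the value, which makes linear combinations and comparisons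
    free of side conditions. *)
Definition hasint f (v : R) :=
  mu.-integrable halfline (EFin \o f) /\ (\int[mu]_(x in halfline) (f x)%:E = v%:E)%E.

Lemma hasint_eq f g v : (forall x, 0 <= x -> f x = g x) -> hasint f v -> hasint g v.
Proof.
move=> fg [fi fv]; have fg' : {in halfline, f =1 g}.
  by move=> x; rewrite inE /= in_itv /= andbT => /fg.
split; first by apply: eq_integrable fi => // x xD; rewrite /= fg'.
by rewrite -fv; apply: eq_integral => x xD; rewrite fg'.
Qed.

Lemma hasintZ k f v : hasint f v -> hasint (fun x => k * f x) (k * v).
Proof.
move=> [fi fv]; split; first exact: (integrableZl _ _ fi).
under eq_integral do rewrite EFinM.
by rewrite integralZl// fv.
Qed.

Lemma hasintD f g v w : hasint f v -> hasint g w -> hasint (fun x => f x + g x) (v + w).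
Proof.
move=> [fi fv] [gi gv]; split; first exact: (integrableD _ fi gi).
by rewrite EFinD -fv -gv -integralD_EFin.
Qed.

Lemma hasint_uniq f v w : hasint f v -> hasint f w -> v = w.
Proof. by move=> [_ h1] [_]; rewrite h1 => -[]. Qed.

Lemma hasint_le f g v w : (forall x, 0 <= x -> f x <= g x) ->
  hasint f v -> hasint g w -> v <= w.
Proof.
move=> fg [fi fv] [gi gv]; rewrite -lee_fin -fv -gv; apply: le_integral => //.
by move=> x; rewrite inE /= in_itv /= andbT => /fg; rewrite lee_fin.
Qed.

Lemma hasint_dominated f g v : measurable_fun [set: R] f ->
  (forall x, 0 <= x -> `|f x| <= g x) -> hasint g v -> exists w, hasint f w.
Proof.
move=> mf fg [gi gv].
have fi : mu.-integrable halfline (EFin \o f).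
  apply: le_integrable gi => //.
    by apply/measurable_EFinP; exact: measurable_funTS.
  move=> x /=; rewrite in_itv /= andbT => x0; rewrite lee_fin.
  by rewrite (le_trans (fg x x0))// ler_norm.
exists (fine (\int[mu]_(x in halfline) (f x)%:E)%E); split => //.
by rewrite fineK//; exact: integrable_fin_num.
Qed.

Lemma expR_half_cvg0 : expR (- (x / 2)) @[x --> +oo] --> (0 : R).
Proof.
rewrite (_ : (fun x : R => expR (- (x / 2))) = (fun z => expR (- z)) \o (fun z => 2^-1 * z)).
  apply: (@cvg_comp _ _ _ _ _ _ (pinfty_nbhs R)); last exact: cvgr_expR.
  exact: gt0_cvgMry.
by apply/funext => x /=; rewrite mulrC.
Qed.

(** The decay exp (- x/2) is a common majorant for all the primitives below, exponentials times
    polynomials. *)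
Lemma ge0_FTC_tail f F (a K : R) : (forall x, a <= x -> 0 <= f x) ->
  (forall x : R, is_derive x (1 : R) F (f x)) -> (forall x : R, {for x, continuous f}) ->
  (forall x, a <= x -> `|F x| <= K * expR (- (x / 2))) ->
  (\int[mu]_(x in `[a, +oo[) (f x)%:E = (- F a)%:E)%E.
Proof.
move=> f0 dF cf FK.
have cF (x : R) : {for x, continuous F}.
  by apply: differentiable_continuous; apply/derivable1_diffP; have := dF x => h; exact: ex_derive.
rewrite (@ge0_continuous_FTC2y _ f F a 0) ?sub0e//.
- apply/continuous_within_itvcyP; split; first by move=> x _; exact: cf.
  by apply: cvg_at_right_filter; exact: cf.
- apply/cvgrPdist_le => e e0; near=> x.
  rewrite sub0r normrN (le_trans (FK _ _))//.
  have K0 : 0 < `|K| + 1 by rewrite ltr_wpDl.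
  rewrite (le_trans (ler_wpM2r (expR_ge0 _) (ler_norm K)))//.
  apply: (@le_trans _ _ ((`|K| + 1) * expR (- (x / 2)))).
    by rewrite ler_wpM2r ?expR_ge0// lerDl.
  rewrite -ler_pdivlMl//.
  near: x; have := expR_half_cvg0 => /cvgrPdist_le/(_ ((`|K| + 1)^-1 * e)).
  rewrite mulr_gt0 ?invr_gt0// => /(_ isT); apply: filterS => x.
  by rewrite sub0r normrN ger0_norm ?expR_ge0.
- by apply: cvg_at_right_filter; exact: cF.
- by move=> x _; rewrite derive1E; have := dF x => h; exact: derive_val.
Unshelve. all: by end_near.
Qed.

Lemma hasint_FTC f F (K : R) : (forall x, 0 <= x -> 0 <= f x) ->
  (forall x : R, is_derive x (1 : R) F (f x)) -> (forall x : R, {for x, continuous f}) ->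
  (forall x, 0 <= x -> `|F x| <= K * expR (- (x / 2))) ->
  hasint f (- F 0).
Proof.
move=> f0 dF cf FK; have I := ge0_FTC_tail f0 dF cf FK.
split => //; apply/integrableP; split.
  apply/measurable_EFinP; apply: measurable_funTS.
  exact: continuous_measurable_fun.
under eq_integral => x.
  rewrite inE /= in_itv /= andbT => x0; rewrite ger0_norm ?f0//.
over.
by rewrite I ltry.
Qed.

End HalfLineIntegrals.

Section Moments.
Variable R : realType.
Local Notation E x := (expR (- x)).

Lemma expRN_split (x : R) : E x = E (x / 2) * E (x / 2).
Proof. by rewrite -expRD; congr expR; lra. Qed.

Lemma expRN_le_half (x : R) : 0 <= x -> E x <= E (x / 2).
Proof. by move=> x0; rewrite ler_expR; lra. Qed.

(** 1 + x is at most 4 (1 + x/4), hence at most 4 exp (x/4). *)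
Lemma poly2_expRN (x : R) : 0 <= x -> (1 + x) ^+ 2 * E x <= 16 * E (x / 2).
Proof.
move=> x0; have h : 1 + x / 4 <= expR (x / 4) by exact: expR_ge1Dx.
have h2 : (1 + x / 4) * (1 + x / 4) <= expR (x / 4) * expR (x / 4) by rewrite ler_pM//; lra.
have h3 : expR (x / 4) * expR (x / 4) * E (x / 2) = 1.
  by rewrite -!expRD -expR0; congr expR; lra.
rewrite expRN_split mulrA ler_wpM2r ?expR_ge0//.
apply: (@le_trans _ _ (16 * ((1 + x / 4) * (1 + x / 4)) * E (x / 2))).
  by rewrite ler_wpM2r ?expR_ge0//; nra.
have := ler_wpM2r (expR_ge0 (- (x / 2))) h2; rewrite h3; lra.
Qed.

Lemma expRNX_le (k : nat) (x : R) : 0 <= x -> E x ^+ k.+1 <= E x.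
Proof.
move=> x0; have [e0 e1] := expRN_bounds x0.
rewrite exprS ler_piMr ?expR_ge0//; apply: exprn_ile1 => //; exact: expR_ge0.
Qed.

Let cexpN (x : R) : {for x, continuous (fun x : R => E x)}.
Proof.
apply: continuous_comp; first exact: opp_continuous.
exact: continuous_expR.
Qed.

Let cexpNM (c x : R) : {for x, continuous (fun x : R => expR (- (c * x)))}.
Proof.
apply: (@continuous_comp _ _ _ (fun x : R => - (c * x)) expR); last exact: continuous_expR.
apply: continuousN; apply: continuousM; [exact: cst_continuous|exact: cvg_id].
Qed.

Let expRNM (k : nat) (x : R) : expR (- (k.+1%:R * x)) = E x ^+ k.+1.
Proof. by rewrite -mulrN expRM_natl. Qed.

Lemma hasint_expX (k : nat) : hasint (fun x : R => E x ^+ k.+1) (k.+1%:R^-1).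
Proof.
pose n : R := k.+1%:R; have k0 : n != 0 by rewrite pnatr_eq0.
have -> : k.+1%:R^-1 = - (- n^-1 * expR (- (n * 0))) :> R.
  by rewrite mulr0 oppr0 expR0 mulr1 opprK.
apply: (@hasint_eq _ (fun x => expR (- (n * x)))); first by move=> x _; exact: expRNM.
apply: (@hasint_FTC _ _ (fun x => - n^-1 * expR (- (n * x))) 1).
- by move=> x _; exact: expR_ge0.
- by move=> x; apply: is_derive_eq; rewrite /GRing.scale /=; field.
- by move=> x; exact: cexpNM.
- move=> x x0; rewrite normrM normrN mul1r !ger0_norm ?invr_ge0 ?expR_ge0//.
  apply: (@le_trans _ _ (E x ^+ k.+1)); last exact: le_trans (expRNX_le k x0) (expRN_le_half x0).
  by rewrite /n expRNM ler_piMl ?exprn_ge0 ?expR_ge0// invf_le1 ?ltr0n// ler1n.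
Qed.

Lemma hasint_xexpX (k : nat) : hasint (fun x : R => x * E x ^+ k.+1) (k.+1%:R^-1 ^+ 2).
Proof.
pose n : R := k.+1%:R; have k0 : n != 0 by rewrite pnatr_eq0.
pose c : R := n^-1.
have c0 : 0 <= c by rewrite invr_ge0.
have c1 : c <= 1 by rewrite invf_le1 ?ltr0n// ler1n.
have -> : k.+1%:R^-1 ^+ 2 = - (- (c * 0 + c ^+ 2) * expR (- (n * 0))) :> R.
  by rewrite !mulr0 oppr0 expR0 mulr1 add0r opprK.
apply: (@hasint_eq _ (fun x => x * expR (- (n * x)))); first by move=> x _; rewrite /n expRNM.
apply: (@hasint_FTC _ _ (fun x => - (c * x + c ^+ 2) * expR (- (n * x))) 16).
- by move=> x x0; rewrite mulr_ge0// expR_ge0.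
- by move=> x; apply: is_derive_eq; rewrite /GRing.scale /= /c; field.
- by move=> x; apply: continuousM; [exact: cvg_id|exact: cexpNM].
- move=> x x0; have l0 : 0 <= c * x + c ^+ 2 by rewrite addr_ge0 ?mulr_ge0 ?sqr_ge0.
  rewrite normrM normrN (ger0_norm l0) ger0_norm ?expR_ge0//.
  apply: le_trans (poly2_expRN x0); apply: ler_pM; rewrite ?expR_ge0//.
  + have : c * x <= x by rewrite ler_piMl.
    have : c ^+ 2 <= 1 by rewrite expr_le1.
    have := sqr_ge0 x; lra.
  + by rewrite /n expRNM; exact: expRNX_le.
Qed.

Lemma hasint_x2exp : hasint (fun x : R => x ^+ 2 * E x) 2.
Proof.
pose F (x : R) : R := - (x ^+ 2 + 2 * x + 2) * E x.
have e : - F 0 = 2 by rewrite /F oppr0 expR0; ring.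
rewrite -[X in hasint _ X]e.
apply: (@hasint_FTC _ (fun x => x ^+ 2 * E x) F 32).
- by move=> x x0; rewrite mulr_ge0 ?sqr_ge0 ?expR_ge0.
- by move=> x; apply: is_derive_eq; rewrite /GRing.scale /=; ring.
- move=> x; apply: continuousM; last exact: cexpN.
  rewrite (_ : (fun x : R => x ^+ 2) = (fun x : R => x * x)).
    by apply: continuousM; exact: cvg_id.
  by apply/funext => y; rewrite expr2.
- move=> x x0; have := poly2_expRN x0; have e0 := expR_ge0 (- x).
  have l0 : 0 <= x ^+ 2 + 2 * x + 2 by have := sqr_ge0 x; lra.
  rewrite /F normrM normrN (ger0_norm l0) (ger0_norm e0).
  have : 0 <= x ^+ 2 * E x by rewrite mulr_ge0 ?sqr_ge0.
  have : 0 <= x * E x by rewrite mulr_ge0.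
  lra.
Qed.

Lemma exp_tail (a : R) : (\int[@lebesgue_measure R]_(x in `[a, +oo[) (E x)%:E = (E a)%:E)%E.
Proof.
rewrite -[in RHS](opprK (E a)).
apply: (@ge0_FTC_tail _ (fun x => E x) (fun x => - E x) a (expR (- (a / 2)))).
- by move=> x _; exact: expR_ge0.
- by move=> x; apply: is_derive_eq; rewrite /GRing.scale /=; ring.
- exact: cexpN.
- move=> x ax; rewrite normrN ger0_norm ?expR_ge0// -expRD ler_expR; lra.
Qed.

Variables (m : nat) (m0 : (0 < m)%N).
Local Notation halfline := (`[0%R, +oo[%classic : set R).

Lemma exp_dens_ge0 (x : R) : 0 <= x -> 0 <= exp_dens x.
Proof. by move=> _; exact: expR_ge0. Qed.

Lemma measurable_exp_dens : measurable_fun [set: R] (@exp_dens R).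
Proof. by apply: measurableT_comp => //; exact: oppr_measurable. Qed.

Lemma exp_dens_int : (\int[@lebesgue_measure R]_(x in halfline) (exp_dens x)%:E = 1)%E.
Proof. by rewrite exp_tail oppr0 expR0. Qed.

(** The cells up to [c] form a half line in x, whose exponential mass is the grid value of [c]; the
    cell masses are differences of these. *)
Lemma mass_exp : mass m0 (@exp_dens R) = unif R (m := m).
Proof.
have mR : 0 < m%:R :> R by rewrite ltr0n.
pose p := mass m0 (@exp_dens R).
have cum (c : 'I_m) : \sum_(i < m | (i <= c)%N) p i = gridv R c.
  have := @integral_cell R m m0 _ exp_dens_ge0 measurable_exp_dens exp_dens_int
    (fun i => (i <= c)%N%:R) (fun=> ler0n _ _).
  have -> : wsum (mass m0 (@exp_dens R)) (fun i : 'I_m => (i <= c)%N%:R) = \sum_(i < m | (i <= c)%N) p i.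
    rewrite [RHS]big_mkcond; apply: eq_bigr => i _; case: ifP => _; rewrite ?mulr1 ?mulr0//.
  move=> h; apply: EFin_inj; rewrite -h.
  pose a := - ln (gridv R c).
  have a0 : 0 <= a by rewrite oppr_ge0 ln_le0// gridv_le1.
  have -> : gridv R c = E a by rewrite /a opprK lnK// posrE gridv_gt0.
  rewrite -exp_tail [RHS]integral_mkcond [LHS]integral_mkcond.
  apply: eq_integral => x _; rewrite /patch !mem_setE /= !in_itv /= !andbT.
  have [ax|ax] := leP a x.
    have x0 : 0 <= x by exact: le_trans ax.
    rewrite x0; have -> : (cell m0 x <= c)%N; last by rewrite mulr1.
    have [h1 _] := cellP m0 x0; have : E x <= gridv R c.
      by rewrite -[leRHS]lnK ?posrE ?gridv_gt0// ler_expR; rewrite /a in ax; lra.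
    move=> /(lt_le_trans h1); rewrite /gridv ltr_pM2r ?invr_gt0// ltr_nat ltnS.
    by [].
  case: ifPn => // x0; have -> : (cell m0 x <= c)%N = false; last by rewrite mulr0.
  apply/negbTE; rewrite -ltnNge; have [_ h2] := cellP m0 x0.
  have : gridv R c < E x.
    by rewrite -[ltLHS]lnK ?posrE ?gridv_gt0// ltr_expR; rewrite /a in ax; lra.
  move=> /lt_le_trans/(_ h2); rewrite /gridv ltr_pM2r ?invr_gt0// ltr_nat ltnS.
  by [].
apply/funext => -[c cm]; case: c cm => [|c] cm.
  have := cum (Ordinal cm); rewrite (bigD1 (Ordinal cm))//= big1 ?addr0.
    by rewrite /p => ->; rewrite /gridv mul1r.
  move=> i /andP[]; rewrite leqn0 => /eqP i0 /eqP []; exact: val_inj.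
have h1 := cum (Ordinal cm); have h2 := cum (Ordinal (ltnW cm)).
move: h1; rewrite (bigD1 (Ordinal cm))//=.
have -> : \sum_(i < m | (i <= c.+1)%N && (i != Ordinal cm)) p i = \sum_(i < m | (i <= c)%N) p i.
  apply: eq_bigl => i; rewrite -val_eqE /= leq_eqVlt ltnS.
  by case: eqP => [->|_] /=; rewrite ?andbF ?andbT// ltnn.
rewrite h2 /= /gridv /unif /p => h.
have -> : mass m0 (@exp_dens R) (Ordinal cm) = c.+2%:R / m%:R - c.+1%:R / m%:R by rewrite -h addrK.
by rewrite -mulrBl -natr1 addrC addKr mul1r.
Qed.

End Moments.

(** * Large deviations under exponentiality *)

Section LargeDeviations.
Variable R : realType.

Lemma typical_dist m (q : 'I_m -> R) (d : R) w : typical q d w ->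
  norm1 (fun c => emp R w c - q c) <= m%:R * d.
Proof.
move/forallP => t; apply: (@le_trans _ _ (\sum_(c < m) d)); first exact: ler_sum.
by rewrite sumr_const card_ord -[_ *+ _]mulr_natl.
Qed.

Lemma In_typical m (m0 : (0 < m)%N) (q : 'I_m -> R) (d delta : R) (s : seq R) :
  prob q -> (forall c, q c <= delta) -> 0 <= d -> (0 < size s)%N ->
  all (fun x => 0 <= x) s -> typical q d (map (cell m0) s) ->
  `|In s - diag5 (@kerm R m) q| <= 10 * (delta + d) + 5 * (m%:R * d).
Proof.
move=> pq qd d0 n0 s0 t; have d1 := typical_dist t.
set w := map _ s in t d1.
have pw : prob (emp R w) by apply: emp_prob; rewrite size_map.
have h1 : forall c, emp R w c <= delta + d.
  move=> c; move/forallP/(_ c): t; rewrite ler_norml => /andP[_].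
  by have := qd c; lra.
have dd : 0 <= delta + d.
  have := emp_prob R (w := w); rewrite size_map => /(_ n0) [e0 _].
  by apply: le_trans (h1 (Ordinal m0)); exact: e0.
have h2 := In_emp n0 s0 dd h1.
have h3 := diag5_lipschitz (@ler_norm_kerm R m) (prob_norm1 pq) (prob_norm1 pw).
rewrite (_ : In s - _ = (In s - diag5 (@kerm R m) (emp R w))
  + (diag5 (@kerm R m) (emp R w) - diag5 (@kerm R m) q)); last by ring.
by rewrite (le_trans (ler_normD _ _))// lerD// (le_trans h3)// ler_wpM2l.
Qed.

Lemma ld_lower m (q : 'I_m -> R) (delta eps d : R) n : (0 < m)%N -> (0 < n)%N ->
  admissible q delta eps -> 0 <= d -> d <= 1 -> m%:R * d <= delta ->
  (1 - 2 * m%:R * expR (- (n%:R * (d ^+ 2 / 4))))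
    * expR (- (n%:R * (entu q + d * \sum_c `|ln (m%:R * q c)|)))
  <= iid_prob (@exp_dens R) n (fun s => eps <= In s).
Proof.
move=> m0 n0 [pq qd Tq] d0 d1 dm.
apply: le_trans (word_change_measure m0 n0 pq d0 d1) _.
rewrite -(mass_exp R m0).
apply: iid_prob_lower; [exact: exp_dens_ge0|exact: measurable_exp_dens|exact: exp_dens_int|].
move=> s s0 sn t; have n0' : (0 < size s)%N by rewrite sn.
have := In_typical pq qd d0 n0' s0 t; rewrite ler_norml => /andP[h _].
(* With d and m d at most [delta], the error of [In_typical] is at most 25 [delta], within the
   margin. *)
have : d <= m%:R * d by rewrite ler_peMl// ler1n.
lra.
Qed.

Lemma ld_upper m (L eps : R) n : (0 < m)%N -> (0 < n)%N ->
  (forall q : 'I_m -> R, prob q ->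
    (forall delta, (forall c, q c <= delta) -> eps - 10 * delta <= diag5 (@kerm R m) q) ->
    L <= entu q) ->
  iid_prob (@exp_dens R) n (fun s => eps <= In s) <= n.+1%:R ^+ m * expR (- (n%:R * L)).
Proof.
move=> m0 n0 hL.
pose B (w : seq 'I_m) := L <= entu (emp R w).
apply: (@le_trans _ _ (wordE (mass m0 (@exp_dens R)) n (fun w => (B w)%:R))).
  apply: iid_prob_upper; [exact: exp_dens_ge0|exact: measurable_exp_dens|exact: exp_dens_int|].
  move=> s s0 sn hs; apply: hL.
    by apply: emp_prob; rewrite size_map sn.
  move=> delta hd; have n0' : (0 < size s)%N by rewrite sn.
  have dd : 0 <= delta.
    have := emp_prob R (w := map (cell m0) s); rewrite size_map => /(_ n0') [e0 _].
    by apply: le_trans (hd (Ordinal m0)); exact: e0.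
  have := In_emp n0' s0 dd hd; rewrite ler_norml => /andP[_ h].
  lra.
by rewrite mass_exp; apply: word_type_bound.
Qed.

Lemma nat_large (x : R) : exists N : nat, forall n : nat, (N <= n)%N -> x <= n%:R.
Proof.
have [N [_ hN]] := big_nat_exists x; exists N => n Nn.
by rewrite (le_trans (ltW hN))// ler_nat.
Qed.

Lemma expRN_small (a e : R) : 0 < a -> 0 < e ->
  exists N : nat, forall n : nat, (N <= n)%N -> expR (- (n%:R * a)) <= e.
Proof.
move=> a0 e0; have [N hN] := nat_large (1 / (e * a)).
exists N => n /hN hn; rewrite expRN.
have ea0 : 0 < e * a by rewrite mulr_gt0.
have h1 : 1 <= e * (n%:R * a).
  by move: hn; rewrite (ler_pdivrMr _ _ ea0); lra.
have h2 := expR_ge1Dx (n%:R * a).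
have := ler_wpM2l (ltW e0) h2 => h3.
have h4 : 1 <= e * expR (n%:R * a) by lra.
by rewrite -[leLHS]mul1r ler_pdivrMr ?expR_gt0.
Qed.

(* [ln y <= a y - 1 - ln a] with a small slope [a] *)
Lemma ln_nat_small (m : nat) (e : R) : 0 < e ->
  exists N : nat, forall n : nat, (N <= n)%N -> m%:R * ln n.+1%:R <= n%:R * e.
Proof.
move=> e0; pose a := e / (2 * (m%:R + 1)).
have m1 : 0 < m%:R + 1 :> R by rewrite ltr_wpDl.
have a0 : 0 < a by rewrite divr_gt0// mulr_gt0.
have am : m%:R * a <= e / 2.
  rewrite /a mulrCA ler_pM2l// ler_pdivrMr ?mulr_gt0//; lra.
have [N hN] := nat_large (2 * (e / 2 - m%:R * (1 + ln a)) / e).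
exists N => n /hN; rewrite ler_pdivrMr// => hn.
have n1 : 0 < n.+1%:R :> R by rewrite ltr0n.
have an0 : 0 < a * n.+1%:R by rewrite mulr_gt0.
have h : ln n.+1%:R <= a * n.+1%:R - 1 - ln a.
  have := @le_ln1Dx R (a * n.+1%:R - 1); rewrite [1 + _]addrC subrK lnM ?posrE//.
  have h : -1 < a * n.+1%:R - 1 by lra.
  by move/(_ h); lra.
have h2 := ler_wpM2l (ler0n R m) h.
have h3 := ler_wpM2r (ltW n1) am.
move: h2 h3; rewrite -natr1; lra.
Qed.

(** The upper bound uses a grid of [m] cells from [rate_uniform_lower], the lower bound a grid of
    [k] cells that carries an almost optimal admissible law; the two grids are unrelated. *)
Theorem large_deviation (eps : R) : rateset eps !=set0 -> rate eps <= rho0 R ^+ 2 / 8 ->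
  (fun n : nat => - (n%:R^-1 * ln (iid_prob (@exp_dens R) n (fun s => eps <= In s))))
    @ \oo --> rate eps.
Proof.
move=> ne small; apply/cvgrPdist_le => e e0.
have e3 : 0 < e / 3 by rewrite divr_gt0.
have [m [m0 hm]] := rate_uniform_lower ne small e3.
have [N1 hN1] := ln_nat_small m e3.
have [x [[k [q [delta [k0 aq xE]]]] hx]] : exists x, rateset eps x /\ x < rate eps + e / 3.
  have hi : has_inf (rateset eps) by split => //; exists 0; exact: rateset_lbound.
  by have [x h1 h2] := inf_adherent e3 hi; exists x.
have kR : 0 < k%:R :> R by rewrite ltr0n.
have dl0 : 0 < delta.
  by have [pq qd _] := aq; apply: lt_le_trans (prob_max_ge k0 pq qd); rewrite invr_gt0.
pose Lam := \sum_c `|ln (k%:R * q c)|.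
have L0 : 0 <= Lam by apply: sumr_ge0.
(* The second bound keeps the typical samples within the margin, the third limits the change of
   measure to e/6. For large n the probability of typicality is at least 1/2, and the resulting
   [ln 2] costs another e/6 per observation. *)
pose d := Num.min 1 (Num.min (delta / k%:R) (e / 6 / (Lam + 1))).
have d0 : 0 < d by rewrite !lt_min ltr01 !divr_gt0//; lra.
have d1 : d <= 1 by rewrite ge_min lexx.
have dk : k%:R * d <= delta.
  rewrite mulrC -ler_pdivlMr//; by rewrite /d !ge_min lexx orbT.
have dL : d * Lam <= e / 6.
  apply: (@le_trans _ _ (d * (Lam + 1))); first by rewrite ler_wpM2l ?ltW//; lra.
  by rewrite -ler_pdivlMr ?/d ?ge_min ?lexx ?orbT//; lra.
have d4 : 0 < d ^+ 2 / 4 by rewrite divr_gt0// exprn_gt0.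
have k4 : 0 < 1 / (4 * k%:R) :> R by rewrite divr_gt0// mulr_gt0.
have [N2 hN2] := expRN_small d4 k4.
have [N3 hN3] := nat_large (6 * ln 2 / e).
exists (maxn 1 (maxn N1 (maxn N2 N3))) => // n /=.
rewrite !geq_max => /and4P[n0 nN1 nN2 nN3].
have nR : 0 < n%:R :> R by rewrite ltr0n.
set p := iid_prob _ _ _.
have plow : expR (- (n%:R * (entu q + d * Lam))) / 2 <= p.
  apply: le_trans (ld_lower k0 n0 aq (ltW d0) d1 dk); rewrite mulrC.
  rewrite ler_wpM2r ?expR_ge0//.
  have := ler_wpM2l (ltW (mulr_gt0 (ltr0n _ 2) kR)) (hN2 _ nN2).
  have -> : 2 * k%:R * (1 / (4 * k%:R)) = 1 / 2 :> R by field; rewrite lt0r_neq0.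
  lra.
have p0 : 0 < p by apply: lt_le_trans plow; rewrite divr_gt0// expR_gt0.
have pup : p <= n.+1%:R ^+ m * expR (- (n%:R * (rate eps - e / 3))) by exact: ld_upper.
have l1 : ln p <= m%:R * ln n.+1%:R - n%:R * (rate eps - e / 3).
  have : ln p <= ln (n.+1%:R ^+ m * expR (- (n%:R * (rate eps - e / 3)))).
    by rewrite ler_ln ?posrE// mulr_gt0 ?expR_gt0 ?exprn_gt0.
  by rewrite lnM ?posrE ?expR_gt0 ?exprn_gt0// expRK lnXn// -[_ *+ _]mulr_natl.
have l2 : - (n%:R * (entu q + d * Lam)) - ln 2 <= ln p.
  have : ln (expR (- (n%:R * (entu q + d * Lam))) / 2) <= ln p.
    by rewrite ler_ln ?posrE// divr_gt0// expR_gt0.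
  by rewrite ln_div ?posrE ?expR_gt0// expRK.
have l3 : ln 2 <= n%:R * (e / 6).
  by have := hN3 _ nN3; rewrite ler_pdivrMr//; lra.
have l4 := hN1 _ nN1.
have nn : n%:R * (n%:R^-1 * ln p) = ln p by rewrite mulrA divff ?mul1r// lt0r_neq0.
rewrite -nn in l1 l2.
have l5 : n%:R * (n%:R^-1 * ln p) <= n%:R * (2 * (e / 3) - rate eps) by lra.
have l6 : n%:R * (d * Lam) <= n%:R * (e / 6) by rewrite ler_wpM2l// ltW.
have l7 : n%:R * entu q <= n%:R * (rate eps + e / 3) by rewrite ler_wpM2l ?ltW// -xE.
have l8 : n%:R * (- (rate eps + e / 3) - e / 3) <= n%:R * (n%:R^-1 * ln p) by lra.
move: l5 l8; rewrite !ler_pM2l// => l5 l8.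
by rewrite opprK ler_norml; apply/andP; split; lra.
Qed.

End LargeDeviations.

(** * The limit in probability under the alternative *)

Section Weighted.
Variables (R : realType) (f : R -> R).
Hypotheses (f0 : forall x, 0 <= x -> 0 <= f x) (mf : measurable_fun [set: R] f).
Hypothesis f1 : hasint f 1.
Local Notation mu := (@lebesgue_measure R).
Local Notation halfline := (`[0%R, +oo[%classic : set R).

Let fint : (\int[mu]_(x in halfline) (f x)%:E = 1)%E. Proof. exact: f1.2. Qed.

Lemma hasint0 : hasint (fun=> 0 : R) 0.
Proof. by have := hasintZ 0 f1; rewrite mul0r; apply: hasint_eq => x _; rewrite mul0r. Qed.

Lemma hasint_sum (T : Type) (s : seq T) (F : T -> R -> R) (v : T -> R) :
  (forall t, hasint (F t) (v t)) -> hasint (fun x => \sum_(t <- s) F t x) (\sum_(t <- s) v t).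
Proof.
move=> h; elim: s => [|t s IH].
  rewrite big_nil; apply: hasint_eq hasint0 => x _; by rewrite big_nil.
rewrite big_cons; apply: hasint_eq (hasintD (h t) IH) => x _; by rewrite big_cons.
Qed.

Lemma hasint_cell m (m0 : (0 < m)%N) (a : 'I_m -> R) :
  hasint (fun x => f x * a (cell m0 x)) (wsum (mass m0 f) a).
Proof.
have h c : hasint (fun x => f x * (cell m0 x == c)%:R) (mass m0 f c).
  split; last exact: massE.
  apply/integrableP; split.
    by apply/measurable_EFinP; exact: measurable_mul_cell.
  under eq_integral => x.
    rewrite inE /= in_itv /= andbT => x0; rewrite ger0_norm ?mulr_ge0 ?f0//.
  over.
  by rewrite massE// ltry.
have := hasint_sum (index_enum 'I_m) (fun c => hasintZ (a c) (h c)).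
rewrite (_ : \sum_(t <- _) _ = wsum (mass m0 f) a); last first.
  by apply: eq_bigr => c _; rewrite mulrC.
apply: hasint_eq => x _; rewrite (bigD1 (cell m0 x))//= eqxx mulr1 big1 ?addr0.
  by rewrite mulrC.
by move=> c; rewrite eq_sym => /negbTE ->; rewrite !mulr0.
Qed.

Lemma cell_refine m k (m0 : (0 < m)%N) (mk0 : (0 < m * k)%N) (x : R) : 0 <= x ->
  (cell m0 x : nat) = (cell mk0 x %/ k)%N.
Proof.
move=> x0; have k0 : (0 < k)%N by move: mk0; rewrite muln_gt0 => /andP[].
have mR : 0 < m%:R :> R by rewrite ltr0n.
have kR : 0 < k%:R :> R by rewrite ltr0n.
have fr (y : R) : y / (m * k)%:R = y / k%:R / m%:R by rewrite natrM; field; rewrite !lt0r_neq0.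
set c := cell mk0 x; have [c1 c2] := cellP mk0 x0.
have jm : (c %/ k < m)%N by rewrite ltn_divLR.
suff -> : cell m0 x = Ordinal jm by [].
apply: cell_eq => //=.
  apply: le_lt_trans c1; rewrite -/c fr ler_pM2r ?invr_gt0//.
  rewrite ler_pdivlMr// -natrM ler_nat; exact: leq_trunc_div.
apply: (le_trans c2); rewrite -/c /gridv fr ler_pM2r ?invr_gt0//.
by rewrite ler_pdivrMr// -natrM ler_nat /= -ltn_divLR.
Qed.

(** Another instance of the rounding lemma, with the values of the fine grid as the letters to be
    rounded. *)
Lemma diag5_refine m k (m0 : (0 < m)%N) (mk0 : (0 < m * k)%N) (delta : R) :
  (forall c, mass m0 f c <= delta) ->
  `|diag5 (@kerm R (m * k)) (mass mk0 f) - diag5 (@kerm R m) (mass m0 f)| <= 10 * delta.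
Proof.
move=> hd; have k0 : (0 < k)%N by move: mk0; rewrite muln_gt0 => /andP[].
have mR : 0 < m%:R :> R by rewrite ltr0n.
have kR : 0 < k%:R :> R by rewrite ltr0n.
have fr (y : R) : y / (m * k)%:R = y / k%:R / m%:R by rewrite natrM; field; rewrite !lt0r_neq0.
have jm (c : 'I_(m * k)) : (c %/ k < m)%N by rewrite ltn_divLR.
pose w (c : 'I_(m * k)) := Ordinal (jm c).
have pE : pushw (mass mk0 f) w = mass m0 f.
  apply/funext => j.
  have h1 := @hasint_cell _ mk0 (fun c => (w c == j)%:R).
  have h2 := @hasint_cell _ m0 (fun c => (c == j)%:R).
  have e1 : wsum (mass m0 f) (fun c => (c == j)%:R) = mass m0 f j.
    rewrite /wsum (bigD1 j)//= eqxx mulr1 big1 ?addr0// => i /negbTE ->.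
    by rewrite mulr0.
  have e2 : wsum (mass mk0 f) (fun c => (w c == j)%:R) = pushw (mass mk0 f) w j.
    by rewrite /pushw [RHS]big_mkcond; apply: eq_bigr => i _; case: ifP; rewrite ?mulr1 ?mulr0.
  rewrite -e1 -e2; apply: hasint_uniq h1 _; apply: hasint_eq h2 => x x0.
  congr (_ * _); congr (_%:R); congr nat_of_bool.
  by rewrite -!val_eqE /= (cell_refine m0 mk0).
have [p0 p1] := mass_prob mk0 f0 mf fint.
have d0 : 0 <= delta by apply: le_trans (hd (Ordinal m0)); exact: mass_ge0.
have := @diag5_rounding R _ _ (mass mk0 f) (@gridv R (m * k)) w (@gridv R m).
rewrite pE; apply => //.
- by move=> c; exact: gridv_ge0.
- by move=> c; exact: gridv_ge0.
- exact: gridv_inj.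
- move=> c; rewrite /gridv fr ler_pM2r ?invr_gt0//.
  by rewrite ler_pdivrMr// -natrM ler_nat /= -ltn_divLR.
- move=> c c'; rewrite /gridv ltr_pM2r ?invr_gt0// ltr_nat ltnS /= => h.
  rewrite fr ltr_pM2r ?invr_gt0// ltr_pdivlMr// -natrM ltr_nat ltnS.
  by apply: leq_trans (leq_trunc_div c' k); rewrite leq_mul2r h orbT.
Qed.

End Weighted.

(** * Moments and cell masses of the alternatives *)

Section Family.
Variable R : realType.
Local Notation E x := (expR (- x)).

Lemma hasint_conv (f g : R -> R) v w : (forall x, 0 <= x -> f x = g x) -> v = w ->
  hasint f v -> hasint g w.
Proof. by move=> fg <-; exact: hasint_eq. Qed.

Lemma psiE (x : R) : psi x = psih (E x).
Proof.
have e2 : expR (- (2 * x)) = E x ^+ 2 by rewrite -mulrN expRM_natl.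
have e3 : expR (- (3 * x)) = E x ^+ 3 by rewrite -mulrN expRM_natl.
by rewrite /psi /psih e2 e3; ring.
Qed.

Lemma hasint_exp : hasint (fun x : R => E x) 1.
Proof.
by apply: hasint_conv (hasint_expX R 0) => [x _|]; rewrite ?expr1 ?invr1.
Qed.

Lemma hasint_xexp : hasint (fun x : R => x * E x) 1.
Proof.
by apply: hasint_conv (hasint_xexpX R 0) => [x _|]; rewrite ?expr1 ?invr1 ?expr1n.
Qed.

Lemma hasint_psi : hasint (fun x : R => E x * psi x) 0.
Proof.
apply: hasint_conv (hasintD (hasintZ (- (1 / 20)) (hasint_expX R 0))
  (hasintD (hasintZ (1 / 2) (hasint_expX R 1)) (hasintD (hasintZ (- (9 / 10)) (hasint_expX R 2))
  (hasintZ (2 / 5) (hasint_expX R 3))))) => [x _|]; last by field.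
by rewrite psiE /psih; field.
Qed.

Lemma hasint_xpsi : hasint (fun x : R => x * E x * psi x) 0.
Proof.
apply: hasint_conv (hasintD (hasintZ (- (1 / 20)) (hasint_xexpX R 0))
  (hasintD (hasintZ (1 / 2) (hasint_xexpX R 1)) (hasintD (hasintZ (- (9 / 10)) (hasint_xexpX R 2))
  (hasintZ (2 / 5) (hasint_xexpX R 3))))) => [x _|]; last by field.
by rewrite psiE /psih; field.
Qed.

Lemma hasint_psi2 : hasint (fun x : R => E x * psi x ^+ 2) (sigma2 R).
Proof.
apply: hasint_conv (hasintD (hasintZ (1 / 400) (hasint_expX R 0))
  (hasintD (hasintZ (- (1 / 20)) (hasint_expX R 1))
  (hasintD (hasintZ (1 / 4 + 9 / 100) (hasint_expX R 2))
  (hasintD (hasintZ (- (1 / 25) - 9 / 10) (hasint_expX R 3))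
  (hasintD (hasintZ (81 / 100 + 2 / 5) (hasint_expX R 4))
  (hasintD (hasintZ (- (18 / 25)) (hasint_expX R 5))
  (hasintZ (4 / 25) (hasint_expX R 6)))))))) => [x _|]; last by rewrite /sigma2; field.
by rewrite psiE /psih; field.
Qed.

Lemma psi_bound (x : R) : 0 <= x -> `|psi x| <= 2.
Proof.
move=> x0; rewrite psiE; have [e0 e1] := expRN_bounds x0.
by apply: psih_bound => //; exact: ltW.
Qed.

Variables C D : R.
Hypotheses (C0 : 0 < C) (D0 : 0 <= D).

Definition score (x : R) : R := C * psi x + D * (x - 1).

Lemma gfamE theta x : gfam C D theta x = E x + theta * (E x * score x).
Proof. by rewrite /gfam /score; ring. Qed.

Lemma hasint_score : hasint (fun x => E x * score x) 0.
Proof.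
apply: hasint_conv (hasintD (hasintZ C hasint_psi)
  (hasintD (hasintZ D hasint_xexp) (hasintZ (- D) hasint_exp))) => [x _|]; last by ring.
by rewrite /score; ring.
Qed.

Lemma hasint_xscore : hasint (fun x => x * (E x * score x)) D.
Proof.
apply: hasint_conv (hasintD (hasintZ C hasint_xpsi)
  (hasintD (hasintZ D (hasint_x2exp R)) (hasintZ (- D) hasint_xexp))) => [x _|]; last by ring.
by rewrite /score; ring.
Qed.

Lemma hasint_psiscore : hasint (fun x => E x * score x * psi x) (C * sigma2 R).
Proof.
apply: hasint_conv (hasintD (hasintZ C hasint_psi2)
  (hasintD (hasintZ D hasint_xpsi) (hasintZ (- D) hasint_psi))) => [x _|]; last by ring.
by rewrite /score; ring.
Qed.

Lemma hasint_score2 : hasint (fun x => E x * score x ^+ 2) (C ^+ 2 * sigma2 R + D ^+ 2).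
Proof.
apply: hasint_conv (hasintD (hasintZ (C ^+ 2) hasint_psi2)
  (hasintD (hasintZ (2 * C * D) hasint_xpsi) (hasintD (hasintZ (- (2 * C * D)) hasint_psi)
  (hasintD (hasintZ (D ^+ 2) (hasint_x2exp R)) (hasintD (hasintZ (- 2 * D ^+ 2) hasint_xexp)
  (hasintZ (D ^+ 2) hasint_exp)))))) => [x _|]; last by ring.
by rewrite /score; ring.
Qed.

Lemma score_bound (x : R) : 0 <= x -> `|score x| <= 2 * C + D * (x + 1).
Proof.
move=> x0; rewrite (le_trans (ler_normD _ _))// lerD//.
  by rewrite normrM (ger0_norm (ltW C0)) mulrC; apply: ler_wpM2r; [exact: ltW|exact: psi_bound].
rewrite normrM (ger0_norm D0) ler_wpM2l// ler_norml; apply/andP; split; lra.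
Qed.

Lemma measurable_score : measurable_fun [set: R] score.
Proof.
have me (c : R) : measurable_fun [set: R] (fun x : R => expR (- (c * x))).
  apply: measurableT_comp; first exact: measurable_expR.
  apply: measurableT_comp; first exact: oppr_measurable.
  exact: measurable_funM.
have me1 : measurable_fun [set: R] (fun x : R => E x).
  by apply: measurableT_comp => //; exact: oppr_measurable.
apply: measurable_funD; last first.
  by apply: measurable_funM => //; exact: measurable_funB.
apply: measurable_funM => //.
apply: measurable_funD; last exact: measurable_funM.
apply: measurable_funB; last exact: measurable_funM.
by apply: measurable_funD; last exact: measurable_funM.
Qed.

Lemma measurable_gfam theta : measurable_fun [set: R] (gfam C D theta).
Proof.
have me1 : measurable_fun [set: R] (fun x : R => E x).
  by apply: measurableT_comp => //; exact: oppr_measurable.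
rewrite (_ : gfam C D theta = fun x => E x + theta * (E x * score x)).
  apply: measurable_funD => //; apply: measurable_funM => //; apply: measurable_funM => //.
  exact: measurable_score.
by apply/funext => x; exact: gfamE.
Qed.

Section Density.
Variable theta : R.
Hypothesis theta0 : 0 < theta.
Hypothesis g0 : forall x : R, 0 <= x -> 0 <= gfam C D theta x.
Local Notation g := (gfam C D theta).

Lemma hasint_g : hasint g 1.
Proof.
apply: hasint_conv (hasintD hasint_exp (hasintZ theta hasint_score)) => [x _|]; last by ring.
by rewrite gfamE.
Qed.

Lemma hasint_xg : hasint (fun x => x * g x) (1 + theta * D).
Proof.
apply: hasint_conv (hasintD hasint_xexp (hasintZ theta hasint_xscore)) => [x _|]; last by ring.
by rewrite gfamE; ring.
Qed.

Lemma hasint_gpsi : hasint (fun x => g x * psi x) (theta * (C * sigma2 R)).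
Proof.
apply: hasint_conv (hasintD hasint_psi (hasintZ theta hasint_psiscore)) => [x _|]; last by ring.
by rewrite gfamE; ring.
Qed.

Let fint := hasint_g.2.
Let mg := measurable_gfam theta.

Section Grid.
Variables (m : nat) (m0 : (0 < m)%N).
Let mR : 0 < m%:R :> R. Proof. by rewrite ltr0n. Qed.
Local Notation pi_ := (mass m0 g).
Local Notation u := (unif R (m := m)).

Let hu (a : 'I_m -> R) : hasint (fun x => E x * a (cell m0 x)) (wsum u a).
Proof.
have := @hasint_cell R _ (@exp_dens_ge0 R) (@measurable_exp_dens R) hasint_exp m m0 a.
by rewrite mass_exp.
Qed.

Let hg (a : 'I_m -> R) : hasint (fun x => g x * a (cell m0 x)) (wsum pi_ a).
Proof. exact: (@hasint_cell R _ g0 mg hasint_g m m0 a). Qed.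

Lemma prob_pi : prob pi_.
Proof. exact: mass_prob. Qed.

(** Relative to exp (- x) the density grows like D x, so a cell of exponential mass 1/m need not
    have mass O(1/m). The inequality x <= lam x^2 / 2 + 1 / (2 lam) trades this growth against the
    second moment. *)
Lemma mass_small (lam : R) (c : 'I_m) : 0 < lam ->
  pi_ c <= (1 + 2 * C * theta) / m%:R + theta * D * (lam + (2 * lam)^-1 / m%:R).
Proof.
move=> l0; have e (q : 'I_m -> R) : wsum q (fun i => (i == c)%:R) = q c.
  rewrite /wsum (bigD1 c)//= eqxx mulr1 big1 ?addr0// => i /negbTE ->.
  by rewrite mulr0.
have h1 := hg (fun i => (i == c)%:R); have h2 := hu (fun i => (i == c)%:R).
rewrite e in h1; rewrite e in h2.
have h3 := hasintD (hasintZ (1 + 2 * C * theta) h2)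
   (hasintZ (theta * D) (hasintD (hasintZ (lam / 2) (hasint_x2exp R)) (hasintZ (2 * lam)^-1 h2))).
have := hasint_le _ h1 h3; rewrite /unif.
rewrite (_ : lam / 2 * 2 = lam); last by field.
apply => x x0; have e0 := expR_gt0 (- x).
have [e1|_] := eqVneq (cell m0 x) c; last first.
  rewrite /= !mulr0 add0r addr0; apply: mulr_ge0; first by apply: mulr_ge0 => //; exact: ltW.
  apply: mulr_ge0; first by rewrite divr_ge0// ltW.
  by apply: mulr_ge0; rewrite ?sqr_ge0 ?ltW.
rewrite /= !mulr1 gfamE.
have sb : score x <= 2 * C + D * x.
  rewrite /score; have := psi_bound x0; rewrite ler_norml => /andP[_ h].
  by have := ler_wpM2l (ltW C0) h; have := D0; lra.
have am : x <= lam / 2 * x ^+ 2 + (2 * lam)^-1.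
  rewrite -subr_ge0 (_ : _ - x = (lam * x - 1) ^+ 2 / (2 * lam)); last by field; rewrite lt0r_neq0.
  by rewrite divr_ge0 ?sqr_ge0// mulr_ge0// ltW.
have te : 0 <= theta * E x by rewrite mulr_ge0 ?ltW.
have h5 := ler_wpM2l te sb.
have h6 := ler_wpM2l (mulr_ge0 te D0) am.
lra.
Qed.

Lemma pi_dist : norm1 (fun c => pi_ c - u c) <= 4 * theta * (C + D).
Proof.
pose s c := Num.sg (pi_ c - u c).
have s1 c : -1 <= s c /\ s c <= 1.
  have : `|s c| <= 1 by rewrite /s normr_sg; case: eqP.
  by rewrite ler_norml => /andP[].
have [p0 p1] := prob_pi.
(* Adding 1 to the sign leaves the difference unchanged and makes the weights nonnegative, so that
   an upper bound on the score suffices. *)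
have -> : norm1 (fun c => pi_ c - u c) = wsum pi_ (fun c => 1 + s c) - wsum u (fun c => 1 + s c).
  rewrite !wsumDr !wsum_cst p1 unif_sum// opprD addrACA subrr add0r -wsumBl.
  by apply: eq_bigr => c _; rewrite [LHS]normrEsg mulrC.
have h1 := hg (fun c => 1 + s c); have h2 := hu (fun c => 1 + s c).
have h3 := hasintD h2 (hasintZ (2 * theta) (hasintD (hasintZ (2 * C) hasint_exp)
   (hasintZ D (hasintD hasint_xexp hasint_exp)))).
have := hasint_le _ h1 h3 => h; rewrite lerBlDl; apply: le_trans (h _) _; last by lra.
move=> x x0; rewrite gfamE; have e0 := expR_ge0 (- x).
have [a1 a2] := s1 (cell m0 x); move: (s _) a1 a2 => t a1 a2.
have := score_bound x0; rewrite ler_norml => /andP[_ b].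
have th0 : 0 <= theta * E x by apply: mulr_ge0 => //; exact: ltW.
have te : 0 <= theta * E x * (1 + t) by apply: mulr_ge0 => //; lra.
have h5 := ler_wpM2l te b.
have bb : 0 <= 2 * C + D * (x + 1).
  by apply: addr_ge0; apply: mulr_ge0 => //; [exact: ltW|lra].
have h6 : theta * E x * (1 + t) * (2 * C + D * (x + 1)) <= theta * E x * 2 * (2 * C + D * (x + 1)).
  by apply: ler_wpM2r => //; apply: ler_wpM2l => //; lra.
lra.
Qed.

Lemma pi_psih : `|wsum pi_ (fun c => psih (gridv R c)) - theta * (C * sigma2 R)| <= 4 / m%:R.
Proof.
have [p0 p1] := prob_pi.
have hc := hg (fun c => psih (gridv R c)).
have close (x : R) : 0 <= x -> `|g x * psih (gridv R (cell m0 x)) - g x * psi x| <= g x * (4 / m%:R).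
  move=> x0; rewrite -mulrBr normrM (ger0_norm (g0 x0)) ler_wpM2l ?g0// psiE.
  have [e0 e1] := expRN_bounds x0; have [c1 c2] := cellP m0 x0.
  apply: le_trans (psih_lip _ _ _ _) _; rewrite ?gridv_ge0 ?gridv_le1 ?(ltW e0)//.
  rewrite ler_wpM2l// ger0_norm ?subr_ge0//.
  have : gridv R (cell m0 x) = (cell m0 x)%:R / m%:R + m%:R^-1.
    by rewrite /gridv -natr1 mulrDl mul1r.
  lra.
have k1 := hasintD hasint_gpsi (hasintZ (4 / m%:R) hasint_g).
have k2 := hasintD hasint_gpsi (hasintZ (- (4 / m%:R)) hasint_g).
rewrite ler_norml; apply/andP; split.
  have := hasint_le _ k2 hc => h; rewrite lerBrDl; apply: le_trans (h _); first by lra.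
  by move=> x x0; have := close x x0; rewrite ler_norml => /andP[h1 _]; lra.
have := hasint_le _ hc k1 => h; rewrite lerBlDl; apply: le_trans (h _) _; last by lra.
by move=> x x0; have := close x x0; rewrite ler_norml => /andP[_ h1]; lra.
Qed.

(** Taylor expansion at the uniform law, at distance at most 4 theta (C + D); and 125 = 42 * 2 + 11
    + 5 (4 + 2). *)
Lemma diag5_pi : `|diag5 (@kerm R m) pi_ - 5 * theta * C * sigma2 R|
  <= 160 * (C + D) ^+ 2 * theta ^+ 2 + 125 / m%:R.
Proof.
have pp := prob_pi; have n1 := prob_norm1 pp; have u1 := norm1_unif R m0.
have h1 := diag5_taylor (@ler_norm_kerm R m) u1 n1.
have h2 := lin5_projection m0 (fun c => pi_ c - u c).
rewrite wsumBl in h2.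
have h3 := diag5_unif R m0; rewrite /close subr0 in h3.
have h4 := psim_close R m0; rewrite /close subr0 in h4.
have h5 := pi_psih; have h6 := pi_dist.
set d := norm1 _ in h1 h2 h6.
have d0 : 0 <= d by exact: norm1_ge0.
have d2 : d <= 2.
  have : d <= norm1 pi_ + norm1 u.
    by rewrite /d /norm1 -big_split; apply: ler_sum => c _; exact: ler_normB.
  by rewrite n1 u1; lra.
have h7 : d ^+ 2 <= 16 * ((C + D) ^+ 2 * theta ^+ 2).
  rewrite (_ : 16 * _ = (4 * theta * (C + D)) ^+ 2); last by ring.
  by rewrite lerXn2r// nnegrE (le_trans d0).
have mV : 0 <= m%:R^-1 :> R by rewrite invr_ge0 ltW.
have h8 := ler_wpM2r mV d2.
have e : wsum u (fun c => psih (gridv R c)) = psim R m by [].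
rewrite e in h2.
move: h1 h2 h3 h4 h5; rewrite !ler_norml.
move=> /andP[? ?] /andP[? ?] /andP[? ?] /andP[? ?] /andP[? ?].
apply/andP; split; lra.
Qed.

End Grid.
End Density.
End Family.

Section LawOfLargeNumbers.
Variables (R : realType) (C D theta : R).
Hypotheses (C0 : 0 < C) (D0 : 0 <= D) (theta0 : 0 < theta).
Hypothesis g0 : forall x : R, 0 <= x -> 0 <= gfam C D theta x.
Local Notation g := (gfam C D theta).
Local Notation T m := (diag5 (@kerm R m)).

Let mg := @measurable_gfam R C D theta.
Let g1 := hasint_g C D theta.

Lemma mass_uniformly_small (delta : R) : 0 < delta ->
  exists M : nat, forall m (m0 : (0 < m)%N), (M <= m)%N -> forall c, mass m0 g c <= delta.
Proof.
move=> d0; pose lam := delta / (3 * (theta * D + 1)).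
have tD : 0 <= theta * D by rewrite mulr_ge0// ltW.
have l0 : 0 < lam by rewrite divr_gt0// mulr_gt0//; lra.
have hl : theta * D * lam <= delta / 3.
  rewrite /lam mulrA ler_pdivrMr ?mulr_gt0//; last by lra.
  by have := mulr_ge0 tD (ltW d0); lra.
pose X := (1 + 2 * C * theta) + theta * D * (2 * lam)^-1.
have [M hM] := nat_large (3 * X / delta).
exists M => m m0 /hM; rewrite ler_pdivrMr// => hm c.
have mR : 0 < m%:R :> R by rewrite ltr0n.
apply: (le_trans (mass_small C0 D0 theta0 g0 m0 c l0)).
have -> : (1 + 2 * C * theta) / m%:R + theta * D * (lam + (2 * lam)^-1 / m%:R)
  = theta * D * lam + X / m%:R by rewrite /X; ring.
have : X / m%:R <= 2 * delta / 3 by rewrite ler_pdivrMr//; have := mulr_gt0 d0 mR; lra.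
lra.
Qed.

(** Both grids are compared with their common refinement into [m * k] cells. *)
Lemma diag5_mass_close m k (m0 : (0 < m)%N) (k0 : (0 < k)%N) (delta : R) :
  (forall c, mass m0 g c <= delta) -> (forall c, mass k0 g c <= delta) ->
  `|T m (mass m0 g) - T k (mass k0 g)| <= 20 * delta.
Proof.
move=> hm hk.
have key N j (N0 : (0 < N)%N) (j0 : (0 < j)%N) i : N = (j * i)%N -> (forall c, mass j0 g c <= delta) ->
    `|T N (mass N0 g) - T j (mass j0 g)| <= 10 * delta.
  by move=> e hj; subst N; exact: (diag5_refine g0 mg g1).
have N0 : (0 < m * k)%N by rewrite muln_gt0 m0.
have h1 := key _ _ N0 m0 k erefl hm.
have h2 := key _ _ N0 k0 m (mulnC _ _) hk.
rewrite (_ : _ - _ = (T (m * k)%N (mass N0 g) - T k (mass k0 g))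
  - (T (m * k)%N (mass N0 g) - T m (mass m0 g))); last by ring.
by rewrite (le_trans (ler_normB _ _))// (le_trans (lerD h2 h1))//; lra.
Qed.

Definition limseq (n : nat) : R := T n.+1 (mass (ltn0Sn n) g).

Definition limI : R := lim (limseq @ \oo).

Lemma limseq_cvg : limseq @ \oo --> limI.
Proof.
suff : cvg (limseq @ \oo) by [].
apply/cauchy_cvgP/cauchy_exP => e e0.
have d0 : 0 < e / 21 by rewrite divr_gt0.
have [M hM] := mass_uniformly_small d0.
exists (limseq M); exists M => // n /= Mn.
have := @diag5_mass_close _ _ (ltn0Sn M) (ltn0Sn n) _ (hM _ _ (leqnSn _)) (hM _ _ (leq_trans Mn (leqnSn _))).
move=> h; apply: (le_lt_trans h); lra.
Qed.

Lemma diag5_limI m (m0 : (0 < m)%N) (delta : R) : 0 < delta ->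
  (forall c, mass m0 g c <= delta) -> `|T m (mass m0 g) - limI| <= 20 * delta.
Proof.
move=> d0 hm; apply/ler_addgt0Pr => e e0.
have [M hM] := mass_uniformly_small d0.
have /cvgrPdist_le/(_ e e0)[N _ hN] := limseq_cvg.
have h1 := hN _ (leq_maxl N M).
have h2 := @diag5_mass_close _ _ m0 (ltn0Sn (maxn N M)) _ hm
   (hM _ _ (leq_trans (leq_maxr N M) (leqnSn _))).
rewrite (_ : _ - limI = (T m (mass m0 g) - limseq (maxn N M)) - (limI - limseq (maxn N M)));
  last by ring.
by rewrite (le_trans (ler_normB _ _))// lerD.
Qed.

Lemma limI_expansion :
  `|limI - 5 * theta * C * sigma2 R| <= 160 * (C + D) ^+ 2 * theta ^+ 2.
Proof.
apply/ler_addgt0Pr => e e0.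
have e2 : 0 < e / 2 by rewrite divr_gt0.
have /cvgrPdist_le/(_ _ e2)[N _ hN] := limseq_cvg.
have [M hM] := nat_large (250 / e).
set n := maxn N M; have h1 := hN n (leq_maxl N M).
have h2 := diag5_pi C0 D0 theta0 g0 (ltn0Sn n).
have h3 : 250 / e <= n.+1%:R := hM _ (leq_trans (leq_maxr N M) (leqnSn _)).
have nR : 0 < n.+1%:R :> R by rewrite ltr0n.
have h4 : 125 / n.+1%:R <= e / 2.
  rewrite (ler_pdivrMr _ _ nR); rewrite (ler_pdivrMr _ _ e0) in h3.
  by move: (n.+1%:R : R) h3 => y h3; lra.
rewrite (_ : limI - _ = (limI - limseq n) + (limseq n - 5 * theta * C * sigma2 R)); last by ring.
rewrite (le_trans (ler_normD _ _))// (le_trans (lerD h1 h2))//.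
move: h4; move: (125 / _) (160 * _ * _) => y A h4; lra.
Qed.

Theorem law_of_large_numbers (eps : R) : 0 < eps ->
  (fun n : nat => iid_prob g n (fun s => eps < `|In s - limI|)) @ \oo --> (0 : R).
Proof.
(* On typical samples the total error is 30 [delta] plus at most 15 m d, that is 3/8 + 1/4 of
   [eps]. *)
move=> eps0; pose delta := eps / 80.
have d0 : 0 < delta by apply: (divr_gt0 eps0); lra.
have [m hm] := mass_uniformly_small d0.
have {}hm := hm m.+1 (ltn0Sn m) (leqnSn m).
have hb := diag5_limI d0 hm.
have pp : prob (mass (ltn0Sn m) g) by exact: prob_pi.
have mR : 0 < m.+1%:R :> R by rewrite ltr0n.
have m1 : 1 <= m.+1%:R :> R by rewrite ler1n.
pose d := Num.min 1 (eps / 60 / m.+1%:R).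
have dd0 : 0 < d by rewrite lt_min ltr01 divr_gt0//; lra.
have dd1 : d <= 1 by rewrite ge_min lexx.
have dm : m.+1%:R * d <= eps / 60.
  by rewrite mulrC -ler_pdivlMr// /d ge_min lexx orbT.
have ddm : d <= m.+1%:R * d by rewrite ler_peMl// ltW.
have d4 : 0 < d ^+ 2 / 4 by rewrite divr_gt0// exprn_gt0.
apply/cvgrPdist_le => e e0.
have e' : 0 < e / (2 * m.+1%:R) by rewrite divr_gt0// mulr_gt0.
have [N hN] := expRN_small d4 e'.
exists (maxn 1 N) => // n /=; rewrite geq_max => /andP[n0 nN].
rewrite sub0r normrN ger0_norm; last exact: iid_prob_ge0.
pose q := mass (ltn0Sn m) g.
apply: (@le_trans _ _ (wordE q n (fun w => (~~ typical q d w)%:R))).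
  apply: (iid_prob_upper g0 mg g1.2) => s s0 sn; apply: contraTN => t.
  have n0' : (0 < size s)%N by rewrite sn.
  have h := In_typical pp hm (ltW dd0) n0' s0 t.
  rewrite -leNgt (_ : In s - limI = (In s - T m.+1 q) + (T m.+1 q - limI)); last by ring.
  rewrite (le_trans (ler_normD _ _))// (le_trans (lerD h hb))// /delta; lra.
have := typical_prob n0 pp (ltW dd0) dd1.
have key : wordE q n (fun w => (typical q d w)%:R) + wordE q n (fun w => (~~ typical q d w)%:R) = 1.
  rewrite -wordED -[RHS](wordE_cst n 1 pp.2); apply: eq_wordE => w _.
  by case: (typical q d w); rewrite /= ?addr0 ?add0r.
have := ler_wpM2l (ltW (mulr_gt0 (ltr0n _ 2) mR)) (hN _ nN).
have -> : 2 * m.+1%:R * (e / (2 * m.+1%:R)) = e by field; rewrite lt0r_neq0.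
rewrite -/q; move: key; lra.
Qed.

End LawOfLargeNumbers.

(** * Local expansions *)

Section RateAsymptotics.
Variable R : realType.

(** With t = b / (5 sigma2), equal to C theta + O(theta^2), the tilt of parameter t reaches the
    level b to first order. Its parameter is raised by a multiple of t^2 for the upper bound;
    [admissible_lower] at t itself gives the lower one. *)
Lemma rate_asymptotics (C Q : R) : 0 < C -> 0 <= Q ->
  exists L th0 : R, [/\ 0 <= L, 0 < th0 & forall theta b : R, 0 < theta -> theta <= th0 ->
    `|b - 5 * theta * C * sigma2 R| <= Q * theta ^+ 2 ->
    rateset b !=set0 /\ `|rate b - C ^+ 2 * sigma2 R / 2 * theta ^+ 2| <= L * theta ^+ 3].
Proof.
move=> C0 Q0; have s0 := sigma2_gt0 R.
pose Q' := Q / (5 * sigma2 R).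
have Q'0 : 0 <= Q' by rewrite divr_ge0// mulr_ge0// ltW.
pose S := C + Q'; have S0 : 0 < S by rewrite ltr_wpDr.
(* 5 * 130 = 650 exceeds 160 * 2^2 = 640: as [t'] is at most 2 t, the shift k t^2 more than pays for
   the quadratic loss of the tilt. *)
pose k := 130 / sigma2 R.
have k0 : 0 < k by rewrite divr_gt0.
have ks : k * sigma2 R = 130 by rewrite /k divfK ?lt0r_neq0.
pose P := Q' + k * S ^+ 2.
have P0 : 0 <= P by rewrite addr_ge0// mulr_ge0 ?sqr_ge0// ltW.
pose a := C ^+ 2 * sigma2 R / 2.
have a0 : 0 < a by rewrite divr_gt0// mulr_gt0// exprn_gt0.
pose U := sigma2 R / 2 * (2 * C * P + P ^+ 2) + 64 * (C + P) ^+ 3.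
have CP0 : 0 < C + P by rewrite ltr_wpDr.
have U0 : 0 <= U.
  rewrite /U addr_ge0//.
    apply: mulr_ge0; first by rewrite divr_ge0// ltW.
    by rewrite addr_ge0 ?sqr_ge0// mulr_ge0// mulr_ge0// ltW.
  by rewrite mulr_ge0// exprn_ge0// ltW.
pose V := sigma2 R * C * Q' + 64 * S ^+ 3 + 16 * S * (a + U).
have V0 : 0 <= V.
  rewrite /V; apply: addr_ge0; first apply: addr_ge0.
  - by rewrite mulr_ge0// mulr_ge0// ltW.
  - by rewrite mulr_ge0// exprn_ge0// ltW.
  - by apply: mulr_ge0; [apply: mulr_ge0 => //; exact: ltW|apply: addr_ge0 => //; exact: ltW].
(* Besides theta <= 1, the bounds ensure that t is at least C theta / 2, that [t'] is at most 1/8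
   and that k t is at most 1. *)
pose th0 := Num.min 1 (Num.min (C / (2 * (Q' + 1))) (Num.min (1 / (8 * (C + P))) (1 / (k * S)))).
exists (U + V), th0; split; first exact: addr_ge0.
  rewrite !lt_min ltr01 /=; apply/and3P; split; apply: divr_gt0 => //.
  - by rewrite mulr_gt0// ltr_wpDl.
  - by rewrite mulr_gt0.
  - by rewrite mulr_gt0.
move=> th b th_gt0; rewrite /th0 !le_min => /and4P[h1 h2 h3 h4] hb.
have th_ge0 := ltW th_gt0.
have h2' : Q' * th <= C / 2.
  move: h2; rewrite ler_pdivlMr; last by rewrite mulr_gt0// ltr_wpDl.
  by have := mulr_ge0 th_ge0 Q'0; lra.
have h3' : (C + P) * th <= 1 / 8.
  by move: h3; rewrite ler_pdivlMr ?mulr_gt0//; lra.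
have h4' : k * S * th <= 1 by move: h4; rewrite (ler_pdivlMr _ _ (mulr_gt0 k0 S0)) mulrC.
pose t := b / (5 * sigma2 R).
have s5 : 0 < 5 * sigma2 R by rewrite mulr_gt0.
have bt : b = 5 * t * sigma2 R by rewrite /t; field; rewrite lt0r_neq0.
have tC : `|t - C * th| <= Q' * th ^+ 2.
  rewrite -(ler_pM2l s5) -{1}(gtr0_norm s5) -normrM.
  rewrite (_ : 5 * sigma2 R * (t - C * th) = b - 5 * th * C * sigma2 R); last by rewrite bt; ring.
  by rewrite (_ : 5 * sigma2 R * (Q' * th ^+ 2) = Q * th ^+ 2)// /Q'; field; rewrite lt0r_neq0.
move: tC; rewrite ler_norml => /andP[tlo thi].
have q1 : Q' * th ^+ 2 <= C / 2 * th by have := ler_wpM2r th_ge0 h2'; lra.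
have th2 : th ^+ 2 <= th by rewrite expr2 ler_piMl.
have th3 : th ^+ 4 <= th ^+ 3 by rewrite exprSr ler_piMr// exprn_ge0.
have q2 : Q' * th ^+ 2 <= Q' * th by rewrite ler_wpM2l.
have t0 : 0 < t.
  have : 0 < C / 2 * th by rewrite mulr_gt0// divr_gt0.
  lra.
have tS : t <= S * th by rewrite /S; lra.
have kt : k * t <= 1 by have := ler_wpM2l (ltW k0) tS; lra.
pose t' := t + k * t ^+ 2.
have kt0 : 0 <= k * t ^+ 2 by apply: mulr_ge0; [exact: ltW|exact: sqr_ge0].
have t'0 : 0 <= t' by rewrite addr_ge0// ltW.
have tt2 : t ^+ 2 <= S ^+ 2 * th ^+ 2 by rewrite -exprMn lerXn2r// nnegrE; lra.
have t'P : t' <= C * th + P * th ^+ 2.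
  by have := ler_wpM2l (ltW k0) tt2; rewrite /t' /P; lra.
have t'8 : t' <= (C + P) * th by have := ler_wpM2l P0 th2; lra.
have t'1 : t' <= 1 / 8 by lra.
have t't : t' <= 2 * t by have := ler_wpM2r (ltW t0) kt; rewrite /t'; lra.
have t'2 : t' ^+ 2 <= 4 * t ^+ 2.
  by rewrite (_ : 4 * t ^+ 2 = (2 * t) ^+ 2); [rewrite lerXn2r// nnegrE; lra|ring].
have gap : b < 5 * t' * sigma2 R - 160 * t' ^+ 2.
  have : 0 < t ^+ 2 by rewrite exprn_gt0.
  have : 5 * (k * t ^+ 2) * sigma2 R = 650 * t ^+ 2.
    by rewrite (_ : 650 = 5 * 130); [rewrite -ks; ring|ring].
  by rewrite bt /t'; rewrite /t' in t'2; lra.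
have [ne rup] := rate_upper t'0 t'1 gap.
split => //.
have up : rate b <= a * th ^+ 2 + U * th ^+ 3.
  apply: (le_trans rup).
  have CPth : 0 <= C * th + P * th ^+ 2 by lra.
  have e1 : t' ^+ 2 <= (C * th + P * th ^+ 2) ^+ 2 by rewrite lerXn2r// nnegrE.
  have e2 : t' ^+ 3 <= ((C + P) * th) ^+ 3 by rewrite lerXn2r// nnegrE (le_trans t'0).
  have e3 := ler_wpM2l (sqr_ge0 P) th3.
  have e4 := ler_wpM2l (ltW s0) e1; have e5 := ler_wpM2l (ltW s0) e3.
  rewrite /a /U; lra.
have rate0 : 0 <= rate b by apply: rate_ge => //; exact: rateset_lbound.
have low : t ^+ 2 * sigma2 R / 2 - 64 * t ^+ 3 <= rate b * (1 + 16 * t).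
  have p1 : 0 < 1 + 16 * t by lra.
  rewrite -ler_pdivrMr//; apply: rate_ge => // x [m [q [delta [m0 aq ->]]]].
  rewrite ler_pdivrMr//; apply: (admissible_lower m0 (delta := delta)).
  - exact: ltW.
  - by apply: le_trans t'1; rewrite lerDl.
  - by rewrite -bt.
have lo : a * th ^+ 2 - V * th ^+ 3 <= rate b.
  have f1 : (C * th - Q' * th ^+ 2) ^+ 2 <= t ^+ 2.
    by rewrite lerXn2r// ?nnegrE; lra.
  have f2 : t ^+ 3 <= (S * th) ^+ 3 by rewrite lerXn2r// nnegrE; lra.
  have f3 : rate b * t <= (a + U) * th ^+ 2 * (S * th).
    apply: ler_pM => //; first exact: ltW.
    apply: (le_trans up).
    have : th ^+ 3 <= th ^+ 2 by rewrite exprSr ler_piMr// sqr_ge0.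
    by move=> /(ler_wpM2l U0); lra.
  have f4 := ler_wpM2r (ltW s0) f1.
  have f5 : 0 <= sigma2 R * (Q' * th ^+ 2) ^+ 2 by rewrite mulr_ge0 ?sqr_ge0// ltW.
  rewrite /a /V in low *; lra.
have v3 : 0 <= V * th ^+ 3 by rewrite mulr_ge0// exprn_ge0.
have u3 : 0 <= U * th ^+ 3 by rewrite mulr_ge0// exprn_ge0.
by rewrite -/a ler_norml; apply/andP; split; lra.
Qed.

End RateAsymptotics.

(** * The distance to the exponential family *)

Section KullbackLeibler.
Variable R : realType.
Local Notation E x := (expR (- x)).

(** The score may be unbounded above, so large y must be allowed; beyond 1/2 the bound ln (1 + y) <=
    y is enough, because y^2 / 2 is at most y^3 there. *)
Lemma xlnx_upper_half (y : R) : - (1 / 2) <= y ->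
  (1 + y) * ln (1 + y) <= y + y ^+ 2 / 2 + `|y| ^+ 3.
Proof.
move=> y1; have [y2|y2] := leP y (1 / 2).
  by apply: xlnx_upper; rewrite ler_norml; apply/andP; split; lra.
have y0 : 0 <= y by lra.
have l1 : ln (1 + y) <= y by apply: le_ln1Dx; lra.
have h := ler_wpM2l (_ : 0 <= 1 + y) l1; have {}h := h (addr_ge0 ler01 y0).
have h2 : 0 <= y ^+ 2 * (y - 1 / 2) by rewrite mulr_ge0 ?sqr_ge0//; lra.
by rewrite ger0_norm//; lra.
Qed.

Lemma hasint_exp_half : hasint (fun x : R => E (x / 2)) 2.
Proof.
pose F (x : R) : R := -2 * E (2^-1 * x).
have e : - F 0 = 2 by rewrite /F mulr0 oppr0 expR0; ring.
rewrite -[X in hasint _ X]e.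
apply: (@hasint_eq _ (fun x => E (2^-1 * x))); first by move=> x _; rewrite mulrC.
apply: (@hasint_FTC _ (fun x => E (2^-1 * x)) F 2).
- by move=> x _; exact: expR_ge0.
- by move=> x; apply: is_derive_eq; rewrite /GRing.scale /=; field.
- move=> x.
  apply: (@continuous_comp _ _ _ (fun x : R => - (2^-1 * x)) expR); last exact: continuous_expR.
  by apply: continuousN; apply: continuousM; [exact: cst_continuous|exact: cvg_id].
- move=> x x0; rewrite /F normrM normrN (ger0_norm (expR_ge0 _)) normr_nat.
  by rewrite mulrC (mulrC _ x) mulrC.
Qed.

Variables C D : R.
Hypotheses (C0 : 0 < C) (D0 : 0 <= D).
Local Notation w := (score C D).
Local Notation B := (2 * C + D).
Let B0 : 0 <= B. Proof. by rewrite addr_ge0// mulr_ge0// ltW. Qed.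
Local Notation v := (C ^+ 2 * sigma2 R + D ^+ 2).

Lemma score_growth (x : R) : 0 <= x -> `|w x| <= B * (1 + x).
Proof.
move=> x0; apply: (le_trans (score_bound C0 D0 x0)).
have : 0 <= C * x by rewrite mulr_ge0// ltW.
lra.
Qed.

Lemma exp_cube (x : R) : 0 <= x -> (1 + x) ^+ 3 * E x <= 216 * E (x / 2).
Proof.
move=> x0; have h : 1 + x / 6 <= expR (x / 6) by exact: expR_ge1Dx.
have h0 : 0 <= 1 + x / 6 by lra.
have h2 : (1 + x / 6) ^+ 3 <= expR (x / 6) ^+ 3.
  by rewrite lerXn2r// nnegrE ?expR_ge0.
have h3 : expR (x / 6) ^+ 3 = expR (x / 2) by rewrite -expRM_natl; congr expR; lra.
have h4 : (1 + x) ^+ 3 <= (6 * (1 + x / 6)) ^+ 3 by rewrite lerXn2r ?nnegrE//; lra.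
have e : expR (x / 2) * E x = E (x / 2) by rewrite -expRD; congr expR; lra.
rewrite -e mulrA ler_wpM2r ?expR_ge0//; rewrite h3 in h2.
apply: (le_trans h4); rewrite exprMn.
rewrite (_ : 6 ^+ 3 = 216 :> R); last by ring.
by apply: ler_wpM2l.
Qed.

Lemma score_cube (x : R) : 0 <= x -> E x * `|w x| ^+ 3 <= 216 * B ^+ 3 * E (x / 2).
Proof.
move=> x0; have h : `|w x| ^+ 3 <= (B * (1 + x)) ^+ 3.
  by rewrite lerXn2r ?nnegrE ?score_growth// mulr_ge0//; lra.
apply: (le_trans (ler_wpM2l (expR_ge0 _) h)).
have := ler_wpM2l (exprn_ge0 3 B0) (exp_cube x0).
by rewrite exprMn; lra.
Qed.

Section Theta.
Variable theta : R.
Hypotheses (theta0 : 0 < theta) (thetaB : theta * B <= 1 / 2).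

Lemma score_theta_lower (x : R) : 0 <= x -> - (1 / 2) <= theta * w x.
Proof.
move=> x0; have : - B <= w x.
  have := psi_bound x0; rewrite ler_norml => /andP[h _].
  have := ler_wpM2l (ltW C0) h; have := mulr_ge0 D0 x0; rewrite /score; lra.
by move=> /(ler_wpM2l (ltW theta0)); have := thetaB; rewrite mulrN; lra.
Qed.

Definition xlogx (x : R) := E x * ((1 + theta * w x) * ln (1 + theta * w x)).

Lemma theta_cube (x : R) : 0 <= x ->
  E x * `|theta * w x| ^+ 3 <= theta ^+ 3 * (216 * B ^+ 3) * E (x / 2).
Proof.
move=> x0; rewrite normrM (gtr0_norm theta0) exprMn mulrCA -mulrA.
by rewrite ler_wpM2l ?exprn_ge0 ?(ltW theta0)//; exact: score_cube.
Qed.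

Let up (x : R) := theta * (E x * w x) + theta ^+ 2 / 2 * (E x * w x ^+ 2)
  + theta ^+ 3 * (216 * B ^+ 3) * E (x / 2).
Let lo (x : R) := theta * (E x * w x) + theta ^+ 2 / 2 * (E x * w x ^+ 2)
  + - (3 * (theta ^+ 3 * (216 * B ^+ 3))) * E (x / 2).

Let hup : hasint up (theta ^+ 2 / 2 * v + theta ^+ 3 * (432 * B ^+ 3)).
Proof.
apply: hasint_conv (hasintD (hasintD (hasintZ theta (hasint_score C D))
  (hasintZ (theta ^+ 2 / 2) (hasint_score2 C D)))
  (hasintZ (theta ^+ 3 * (216 * B ^+ 3)) hasint_exp_half)) => [x _|] //.
by ring.
Qed.

Let hlo : hasint lo (theta ^+ 2 / 2 * v - 3 * (theta ^+ 3 * (432 * B ^+ 3))).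
Proof.
apply: hasint_conv (hasintD (hasintD (hasintZ theta (hasint_score C D))
  (hasintZ (theta ^+ 2 / 2) (hasint_score2 C D)))
  (hasintZ (- (3 * (theta ^+ 3 * (216 * B ^+ 3)))) hasint_exp_half)) => [x _|] //.
by ring.
Qed.

Let xlogx_up (x : R) : 0 <= x -> xlogx x <= up x.
Proof.
move=> x0; have h := xlnx_upper_half (score_theta_lower x0).
have := ler_wpM2l (expR_ge0 (- x)) h; have := theta_cube x0; rewrite /xlogx /up; lra.
Qed.

Let xlogx_lo (x : R) : 0 <= x -> lo x <= xlogx x.
Proof.
move=> x0; have h := xlnx_lower (score_theta_lower x0).
have := ler_wpM2l (expR_ge0 (- x)) h; have := theta_cube x0; rewrite /xlogx /lo; lra.
Qed.

Lemma hasint_xlogx : exists A : R, [/\ hasint xlogx A,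
  A <= theta ^+ 2 / 2 * v + theta ^+ 3 * (432 * B ^+ 3) &
  theta ^+ 2 / 2 * v - 3 * (theta ^+ 3 * (432 * B ^+ 3)) <= A].
Proof.
have mE : measurable_fun [set: R] (fun x : R => E x).
  by apply: measurableT_comp => //; exact: oppr_measurable.
have mw : measurable_fun [set: R] (fun x => 1 + theta * w x).
  by apply: measurable_funD => //; apply: measurable_funM => //; exact: measurable_score.
have mx : measurable_fun [set: R] xlogx.
  apply: measurable_funM => //; apply: measurable_funM => //.
  by apply: measurableT_comp mw; exact: measurable_ln.
have mlo : measurable_fun [set: R] lo.
  have mE2 : measurable_fun [set: R] (fun x : R => E (x / 2)).
    by apply: measurableT_comp => //; apply: measurableT_comp; [exact: oppr_measurable|exact: measurable_funM].
  have ms := measurable_score C D.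
  apply: measurable_funD; last exact: measurable_funM.
  apply: measurable_funD; apply: measurable_funM => //; apply: measurable_funM => //.
  exact: measurable_funX.
(* Integrability comes from the enclosure: [xlogx - lo] is nonnegative and dominated by
   [up - lo]. *)
have hm := hasintD hup (hasintZ (-1) hlo).
have [A' hA'] : exists A', hasint (fun x => xlogx x - lo x) A'.
  apply: hasint_dominated hm; first exact: measurable_funB.
  move=> x x0; rewrite ger0_norm ?subr_ge0 ?xlogx_lo//.
  by have := xlogx_up x0; lra.
have hA : hasint xlogx (A' + (theta ^+ 2 / 2 * v - 3 * (theta ^+ 3 * (432 * B ^+ 3)))).
  by apply: hasint_eq (hasintD hA' hlo) => x _; rewrite subrK.
exists (A' + (theta ^+ 2 / 2 * v - 3 * (theta ^+ 3 * (432 * B ^+ 3)))); split => //.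
  exact: hasint_le xlogx_up hA hup.
exact: hasint_le xlogx_lo hlo hA.
Qed.

Lemma KL_value (A lam : R) : hasint xlogx A -> 0 < lam ->
  KL (gfam C D theta) lam = (A - ln lam + (lam - 1) * (1 + theta * D))%:E.
Proof.
move=> hA l0.
have h := hasintD hA (hasintD (hasintZ (- ln lam) (hasint_g C D theta))
   (hasintZ (lam - 1) (hasint_xg C D theta))).
rewrite /KL; rewrite (_ : A - ln lam + _ = A + (- ln lam * 1 + (lam - 1) * (1 + theta * D))); last by ring.
rewrite -h.2; apply: eq_integral => x; rewrite inE /= in_itv /= andbT => x0.
congr EFin; have y0 := score_theta_lower x0.
have gE : gfam C D theta x = E x * (1 + theta * w x) by rewrite gfamE; ring.
have p0 : 0 < 1 + theta * w x by lra.
rewrite gE ln_div ?posrE ?mulr_gt0 ?expR_gt0//.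
by rewrite !lnM ?posrE ?expR_gt0// !expRK /xlogx; ring.
Qed.

(** The best rate is the inverse of the mean 1 + theta D; its optimality is ln z <= z - 1 at z = l
    m. *)
Lemma Kdist_value (A : R) : hasint xlogx A ->
  Kdist (gfam C D theta) = A + ln (1 + theta * D) - theta * D.
Proof.
move=> hA; rewrite /Kdist; set m := 1 + theta * D.
have m0 : 0 < m by rewrite /m; have := mulr_ge0 (ltW theta0) D0; lra.
suff -> : ereal_inf [set KL (gfam C D theta) l | l in (`]0%R, +oo[%classic : set R)]
   = (A + ln m + (1 - m))%:E :> \bar R by rewrite /=; rewrite /m; ring.
apply/eqP; rewrite eq_le; apply/andP; split.
  apply: ereal_inf_lbound; exists m^-1; first by rewrite /= in_itv /= andbT invr_gt0.
  rewrite (KL_value hA) ?invr_gt0// lnV ?posrE// -/m mulrBl mulVf ?gt_eqF// mul1r.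
  by congr EFin; ring.
apply: le_ereal_inf_tmp => y [l] /=; rewrite in_itv /= andbT => l0 <-.
rewrite (KL_value hA l0) lee_fin -/m.
have h : ln (l * m) <= l * m - 1.
  by have := @le_ln1Dx _ (l * m - 1); rewrite addrCA subrr addr0; apply; have := mulr_gt0 l0 m0; lra.
by rewrite lnM ?posrE// in h; lra.
Qed.

(** The second order term of ln (1 + theta D) cancels the D^2 part of the second moment of the
    score. *)
Lemma Kdist_asymptotics :
  `|Kdist (gfam C D theta) - C ^+ 2 * sigma2 R / 2 * theta ^+ 2|
    <= (1296 * B ^+ 3 + 3 * D ^+ 3) * theta ^+ 3.
Proof.
have [A [hA Aup Alo]] := hasint_xlogx; rewrite (Kdist_value hA).
have z0 : 0 <= theta * D by rewrite mulr_ge0// ltW.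
have z3 := exprn_ge0 3 z0.
have l1 : ln (1 + theta * D) <= theta * D - (theta * D) ^+ 2 / 2 + (theta * D) ^+ 3 / 3.
  by apply: ln_taylor3; lra.
have l2 : theta * D - (theta * D) ^+ 2 / 2 - 3 * (theta * D) ^+ 3 <= ln (1 + theta * D).
  have p0 : 0 < 1 + theta * D by lra.
  rewrite -(ler_pM2l p0).
  have : - (1 / 2) <= theta * D by lra.
  move=> /xlnx_lower; rewrite ger0_norm//; apply: le_trans.
  have := exprn_ge0 4 z0; lra.
rewrite exprMn in l1 l2 z3.
have b3 : 0 <= B ^+ 3 * theta ^+ 3 by apply: mulr_ge0; apply: exprn_ge0 => //; exact: ltW.
rewrite ler_norml; apply/andP; split; lra.
Qed.

End Theta.
End KullbackLeibler.

Lemma drift_ge0 (R : realType) (C D : R) : 0 < C ->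
  (\forall theta \near 0^'+, forall x : R, 0 <= x -> 0 <= gfam C D theta x) -> 0 <= D.
Proof.
move=> C0 hdens; rewrite leNgt; apply/negP => D0.
suff [t [t0 ht]] : exists t : R, 0 < t /\ forall x : R, 0 <= x -> 0 <= gfam C D t x.
  have it : 0 < t^-1 by rewrite invr_gt0.
  have x0 : 0 <= (2 * C + t^-1) / (- D).
    by rewrite divr_ge0//; [have := C0; lra|rewrite oppr_ge0 ltW].
  (* Here D (x - 1) = D - 2 C - 1/t, and [psi] is at most 2, so the score falls below -1/t. *)
  pose x := 2 + (2 * C + t^-1) / (- D).
  have x1 : 0 <= x by rewrite /x addr_ge0.
  have := ht _ x1; apply/negP; rewrite -ltNge gfamE.
  have e : D * (x - 1) = D - (2 * C + t^-1).
    have Dn : D != 0 by rewrite lt_eqF.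
    have tn : t != 0 by rewrite gt_eqF.
    by rewrite /x; field; rewrite ?Dn ?tn ?oppr_eq0.
  have wx : score C D x < - t^-1.
    have := psi_bound x1; rewrite ler_norml => /andP[_ /(ler_wpM2l (ltW C0))].
    by rewrite /score e; lra.
  have wt : 1 + t * score C D x < 0.
    by move: wx; rewrite -(ltr_pM2l t0) mulrN divff ?gt_eqF//; lra.
  have -> : expR (- x) + t * (expR (- x) * score C D x) = expR (- x) * (1 + t * score C D x) by ring.
  by rewrite pmulr_rlt0 ?expR_gt0.
have /filter_ex[t [t0 ht]] : \forall t \near (0 : R)^'+, 0 < t /\
    forall x : R, 0 <= x -> 0 <= gfam C D t x.
  by near=> t; split => //; near: t; exact: hdens.
by exists t.
Unshelve. all: by end_near.
Qed.

Lemma rate_small_at_right (R : realType) (a L r : R) : 0 <= a -> 0 <= L -> 0 < r ->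
  \forall theta \near 0^'+, a * theta ^+ 2 + L * theta ^+ 3 <= r.
Proof.
move=> a0 L0 r0; have p0 : 0 < r / (a + L + 1) by rewrite divr_gt0//; lra.
near=> t.
have t0 : 0 < t by near: t; exact: nbhs_right_gt.
have t1 : t <= 1 by near: t; exact: nbhs_right_le.
have t2 : t <= r / (a + L + 1) by near: t; exact: nbhs_right_le.
rewrite ler_pdivlMr in t2; last by lra.
have h2 : t ^+ 2 <= t by rewrite expr2 ler_piMl// ltW.
have h3 : t ^+ 3 <= t by rewrite exprSr; apply: ler_piMl; [exact: ltW|lra].
have := ler_wpM2l a0 h2; have := ler_wpM2l L0 h3; lra.
Unshelve. all: by end_near.
Qed.

Lemma equivalent_quadratics_ratio (R : realType) (a L1 L2 : R) (c K : R -> R) :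
  0 < a -> 0 <= L1 -> 0 <= L2 ->
  (\forall t \near 0^'+, `|c t / 2 - a * t ^+ 2| <= L1 * t ^+ 3) ->
  (\forall t \near 0^'+, `|K t - a * t ^+ 2| <= L2 * t ^+ 3) ->
  (fun t => c t / (2 * K t)) @ 0^'+ --> (1 : R).
Proof.
move=> a0 L10 L20 hc hK; apply/cvgrPdist_le => e e0.
have p1 : 0 < a / (2 * L2 + 1) by rewrite divr_gt0//; lra.
have p2 : 0 < e * a / (2 * (L1 + L2) + 1) by rewrite divr_gt0 ?mulr_gt0//; lra.
near=> t.
have t0 : 0 < t by near: t; exact: nbhs_right_gt.
(* This bound keeps [K t] above half its leading term; the next one makes the numerator of the error
   at most [e] times that half. *)
have t1 : t <= a / (2 * L2 + 1) by near: t; exact: nbhs_right_le.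
have t2 : t <= e * a / (2 * (L1 + L2) + 1) by near: t; exact: nbhs_right_le.
have c1 : `|c t / 2 - a * t ^+ 2| <= L1 * t ^+ 3 by near: t.
have K1 : `|K t - a * t ^+ 2| <= L2 * t ^+ 3 by near: t.
rewrite ler_pdivlMr in t1; last by lra.
rewrite ler_pdivlMr in t2; last by lra.
have q0 : 0 < t ^+ 2 by rewrite exprn_gt0.
have h1 := ler_wpM2r (ltW q0) t1; have h2 := ler_wpM2r (ltW q0) t2.
have q3 : 0 < t ^+ 3 by rewrite exprn_gt0.
move: c1 K1; rewrite !ler_norml => /andP[c1 c2] /andP[K1 K2].
have Kl : a * t ^+ 2 / 2 <= K t by lra.
have K0 : 0 < K t by apply: lt_le_trans Kl; rewrite divr_gt0// mulr_gt0.
have -> : 1 - c t / (2 * K t) = (K t - c t / 2) / K t by field; rewrite gt_eqF.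
have eK := ler_wpM2l (ltW e0) Kl.
apply/andP; split; [rewrite ler_pdivlMr//|rewrite ler_pdivrMr//]; lra.
Unshelve. all: by end_near.
Qed.

Theorem theorem1 (R : realType) (C D : R) (hC : 0 < C)
  (hdens : \forall theta \near 0^'+,
      forall x : R, 0 <= x -> 0 <= gfam C D theta x) :
  exists b c : R -> R,
    (* b(theta) = limit in probability of I_n under g(.,theta) *)
    (\forall theta \near 0^'+, forall eps : R, 0 < eps ->
        (fun n : nat => iid_prob (gfam C D theta) n
                          (fun s => eps < `|In s - b theta|)) @ \oo --> (0 : R))
    (* c(theta) = 2 f_I(b(theta)), f_I(e) = -lim n^{-1} ln P_H0{I_n >= e} *)
    /\ (\forall theta \near 0^'+,
        (fun n : nat => - (n%:R^-1 *
             ln (iid_prob (@exp_dens R) n (fun s => b theta <= In s))))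
          @ \oo --> c theta / 2)
    (* local Bahadur efficiency = 1 *)
    /\ (fun theta => c theta / (2 * Kdist (gfam C D theta))) @ 0^'+ --> (1 : R).
Proof.
have D0 := drift_ge0 hC hdens; have sig0 := sigma2_gt0 R.
pose a := C ^+ 2 * sigma2 R / 2.
have a0 : 0 < a by rewrite divr_gt0// mulr_gt0// exprn_gt0.
have Q0 : 0 <= 160 * (C + D) ^+ 2 by have := sqr_ge0 (C + D); lra.
have [L [th0 [L0 th0_gt0 hrate]]] := rate_asymptotics hC Q0.
have [L2 L20 hK] : exists2 L2 : R, 0 <= L2 &
    \forall t \near 0^'+, `|Kdist (gfam C D t) - a * t ^+ 2| <= L2 * t ^+ 3.
  have B0 : 0 < 2 * C + D by have := hC; lra.
  exists (1296 * (2 * C + D) ^+ 3 + 3 * D ^+ 3).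
    have := exprn_ge0 3 (ltW B0); have := exprn_ge0 3 D0; lra.
  near=> t; apply: Kdist_asymptotics => //.
  rewrite -ler_pdivlMr//; near: t; apply: nbhs_right_le.
  by rewrite divr_gt0.
have hb : \forall t \near 0^'+, rateset (limI C D t) !=set0 /\
    `|rate (limI C D t) - a * t ^+ 2| <= L * t ^+ 3.
  near=> t; have t0 : 0 < t by [].
  apply: hrate => //; first by near: t; exact: nbhs_right_le.
  have g0 : forall x : R, 0 <= x -> 0 <= gfam C D t x by near: t; exact: hdens.
  exact: limI_expansion hC D0 t0 g0.
exists (limI C D), (fun t => 2 * rate (limI C D t)); split; [|split].
- near=> t => eps eps0; apply: law_of_large_numbers => //; near: t; exact: hdens.
(* For small theta the rate is O(theta^2), hence below the threshold of [large_deviation]. *)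
- have r0 : 0 < rho0 R ^+ 2 / 8 by rewrite divr_gt0// exprn_gt0// /rho0 /s0; lra.
  have hr := rate_small_at_right (ltW a0) L0 r0.
  near=> t.
  have -> : 2 * rate (limI C D t) / 2 = rate (limI C D t) by field.
  have [ne hd] : rateset (limI C D t) !=set0 /\
      `|rate (limI C D t) - a * t ^+ 2| <= L * t ^+ 3 by near: t; exact: hb.
  apply: large_deviation => //.
  have : a * t ^+ 2 + L * t ^+ 3 <= rho0 R ^+ 2 / 8 by near: t; exact: hr.
  by move: hd; rewrite ler_norml => /andP[_]; lra.
- apply: (equivalent_quadratics_ratio a0 L0 L20 _ hK).
  near=> t; have -> : 2 * rate (limI C D t) / 2 = rate (limI C D t) by field.
  have [_ hd] : rateset (limI C D t) !=set0 /\
      `|rate (limI C D t) - a * t ^+ 2| <= L * t ^+ 3 by near: t; exact: hb.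
  exact: hd.
Unshelve. all: by end_near.
Qed.
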